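(* There exist absolute constants $L>1$ and $c<1$, and an assignment $(\epsilon,\tilde J,T)\mapsto J(\epsilon,\tilde J;T)$ of solutions of the Renormalization Equation (see context), such that the following holds. Let $d_1,d_2,\dots$ be integers $\ge2$, let $T_1,T_2,\dots$ be expanding polynomials normalized on $[-1,1]$ with $\deg T_k=d_k$, all of whose critical values have modulus at least $L$, and let $\epsilon_0,\epsilon_1,\dots$ be integers with $0\le\epsilon_k\le d_{k+1}-1$. For a Jacobi matrix $\tilde J$ on $l^2(\mathbb Z)$ with spectrum contained in $[-1,1]$ put $$J_n=J(\epsilon_0+\epsilon_1d_1+\dots+\epsilon_{n-1}d_1\cdots d_{n-1},\ \tilde J;\ T_n\circ\dots\circ T_2\circ T_1).$$ Then the limit $J=\lim_{n\to\infty}J_n$ exists in operator norm and does not depend on $\tilde J$. Moreover, there is $A>0$ such that $$\|J-S^{-d_1\cdots d_l m}\,J\,S^{d_1\cdots d_l m}\|\le A\,c^l\qquad\text{for all } l\ge1,\ m\in\mathbb Z,$$ and $\rho_J(k):=\|S^{-k}JS^k-J\|$ defines on $\mathbb Z$ the topology for which the subgroups $d_1\cdots d_l\mathbb Z$, $l\ge1$, form a basis of neighbourhoods of $0$.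
   Context: $\{|k\rangle\}_{k\in\mathbb Z}$ is the standard orthonormal basis of $l^2(\mathbb Z)$ and $S|k\rangle=|k+1\rangle$ is the shift. A Jacobi matrix is a bounded self-adjoint operator $J$ on $l^2(\mathbb Z)$ of the form $J|k\rangle=p_k|k-1\rangle+q_k|k\rangle+p_{k+1}|k+1\rangle$ with $p_k\ge 0$, $q_k\in\mathbb R$. An expanding polynomial normalized on $[-1,1]$ is a real polynomial $T$ of degree $d\ge2$ with positive leading coefficient, all of whose critical points are real and simple, whose critical values have modulus $>1$, and for which the full preimage satisfies $T^{-1}([-1,1])\subset[-1,1]$. Compositions of such polynomials are again of this type. For such $T$ of degree $d$, an integer $0\le\epsilon\le d-1$ and a Jacobi matrix $\tilde J$ with spectrum in $[-1,1]$, a solution of the Renormalization Equation is a Jacobi matrix $J$ with spectrum in $T^{-1}([-1,1])$ such that $$V_\epsilon^*(z-J)^{-1}V_\epsilon=(T(z)-\tilde J)^{-1}\,T'(z)/d,\qquad z\in\mathbb C\setminus T^{-1}([-1,1]),$$ where $V_\epsilon|k\rangle=|\epsilon+dk\rangle$. The assignment in the claim gives, for every such $(\epsilon,\tilde J,T)$, one solution $J(\epsilon,\tilde J;T)$. *)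

(* Defs.v *)
From HB Require Import structures.
From mathcomp Require Import all_boot all_order all_algebra.
From mathcomp Require Import all_classical all_reals all_analysis.
From mathcomp Require Import ring.
From mathcomp Require Export complex.
Import Order.TTheory GRing.Theory Num.Theory.
Import ComplexField.Normc.

Set Implicit Arguments.
Unset Strict Implicit.
Unset Printing Implicit Defensive.

Local Open Scope classical_set_scope.
Local Open Scope ring_scope.
Local Open Scope complex_scope.

Section SequenceSpace.
Variable R : realType.
Local Notation C := R[i].
Implicit Types (u v : int -> C) (a z : C).

(* The extended-real value of the sum of |u_k|^2. *)
Definition esqnorm u : \bar R := \esum_(k in [set: int]) (normc (u k) ^+ 2)%:E.

Definition l2_pred : {pred int -> C} := fun u => `[< (esqnorm u < +oo)%E >].

Lemma normc_nneg z : 0 <= normc z.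
Proof. by case: z => x y; apply: sqrtr_ge0. Qed.

Lemma normcZsq a z : normc (a * z) ^+ 2 = normc a ^+ 2 * normc z ^+ 2.
Proof. by rewrite normcM exprMn. Qed.

Lemma normcD_sq z w :
  normc (z + w) ^+ 2 <= 2 * normc z ^+ 2 + 2 * normc w ^+ 2.
Proof.
have h : normc (z + w) ^+ 2 <= (normc z + normc w) ^+ 2.
  rewrite ler_sqr ?nnegrE ?addr_ge0 ?normc_nneg //; exact: le_normcD.
apply: (le_trans h); rewrite -subr_ge0.
have -> : 2 * normc z ^+ 2 + 2 * normc w ^+ 2 - (normc z + normc w) ^+ 2
        = (normc z - normc w) ^+ 2.
  by ring.
exact: sqr_ge0.
Qed.

Lemma esqnorm_ge0 u : (0 <= esqnorm u)%E.
Proof. by apply: esum_ge0 => k _; rewrite lee_fin sqr_ge0. Qed.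

Lemma esumZ (r : R) (f : int -> R) : 0 <= r -> (forall k, 0 <= f k) ->
  (\esum_(k in [set: int]) (r * f k)%:E <= r%:E * \esum_(k in [set: int]) (f k)%:E)%E.
Proof.
move=> r0 f0; apply: ge_ereal_sup => _ [A [finA AT] <-].
have -> : (\sum_(k \in A) (r * f k)%:E = r%:E * \sum_(k \in A) (f k)%:E)%E.
  rewrite ge0_mule_fsumr//.
apply: lee_wpmul2l; first by rewrite lee_fin.
by apply: ereal_sup_ubound; exists A.
Qed.

Lemma esqnormD u v : (esqnorm (u + v)%R <= 2%:E * esqnorm u + 2%:E * esqnorm v)%E.
Proof.
apply: (@le_trans _ _ (\esum_(k in [set: int])
   ((2 * normc (u k) ^+ 2)%:E + (2 * normc (v k) ^+ 2)%:E))%E).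
  by apply: le_esum => k _; rewrite -EFinD lee_fin; apply: normcD_sq.
rewrite esumD; last 2 first.
- by move=> k _; rewrite lee_fin mulr_ge0 ?sqr_ge0.
- by move=> k _; rewrite lee_fin mulr_ge0 ?sqr_ge0.
by apply: leeD; apply: esumZ => // k; apply: sqr_ge0.
Qed.

Lemma esqnormZ a u : (esqnorm (a *: u)%R <= (normc a ^+ 2)%:E * esqnorm u)%E.
Proof.
apply: (le_trans _ (esumZ _ _)); last 2 first.
- exact: sqr_ge0.
- by move=> k; apply: sqr_ge0.
by apply: le_esum => k _; rewrite lee_fin normcZsq.
Qed.

Lemma esqnorm0 : esqnorm 0 = 0%E.
Proof. by apply: esum1 => k _; rewrite normc0 expr0n. Qed.

Fact l2_submod_closed : submod_closed l2_pred.
Proof.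
split=> [|a u v /asboolP hu /asboolP hv]; apply/asboolP.
  by rewrite esqnorm0 ltry.
apply: (le_lt_trans (esqnormD _ _)); apply: lte_add_pinfty.
  apply: lte_mul_pinfty; rewrite ?lee_fin//.
  apply: (le_lt_trans (esqnormZ _ _)).
  by apply: lte_mul_pinfty; rewrite ?lee_fin ?sqr_ge0.
by apply: lte_mul_pinfty; rewrite ?lee_fin.
Qed.
HB.instance Definition _ :=
  GRing.isSubmodClosed.Build C (int -> C) l2_pred l2_submod_closed.

Record l2 := L2 { l2val :> int -> C; l2valP : l2val \in l2_pred }.
HB.instance Definition _ := [isSub for l2val].
HB.instance Definition _ := [Choice of l2 by <:].
HB.instance Definition _ := [SubChoice_isSubLmodule of l2 by <:].
Implicit Types f g : l2.

Definition l2norm f : R := Num.sqrt (fine (esqnorm f)).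

(* The sum of an absolutely summable family of reals, through its positive and
   negative parts. *)
Definition zsum (x : int -> R) : R :=
  fine (\esum_(k in [set: int]) (Num.max (x k) 0)%:E)
  - fine (\esum_(k in [set: int]) (Num.max (- x k) 0)%:E).

(* The inner product, conjugate-linear on the left. *)
Definition l2dot f g : C :=
  zsum (fun k => complex.Re ((f k)^* * g k))
  +i* zsum (fun k => complex.Im ((f k)^* * g k)).


Lemma l2_fin f : esqnorm f \is a fin_num.
Proof. by rewrite ge0_fin_numE ?esqnorm_ge0//; apply/asboolP/(l2valP f). Qed.

Lemma l2norm_ge0 f : 0 <= l2norm f. Proof. exact: sqrtr_ge0. Qed.

Lemma l2norm_sq f : l2norm f ^+ 2 = fine (esqnorm f).
Proof. by rewrite sqr_sqrtr// fine_ge0// esqnorm_ge0. Qed.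

Lemma l2norm_le (r : R) f : 0 <= r -> (esqnorm f <= (r ^+ 2)%:E)%E -> l2norm f <= r.
Proof.
move=> r0 h; rewrite -(ler_pXn2r (n := 2)) ?nnegrE ?l2norm_ge0// l2norm_sq.
by rewrite -lee_fin fineK ?l2_fin.
Qed.

Lemma l2norm0 : l2norm 0 = 0.
Proof. by rewrite /l2norm esqnorm0 sqrtr0. Qed.

Lemma l2normD f g : l2norm (f + g) <= 2 * (l2norm f + l2norm g).
Proof.
apply: l2norm_le; first by rewrite mulr_ge0 ?addr_ge0 ?l2norm_ge0.
apply: (le_trans (esqnormD _ _)).
rewrite -(fineK (l2_fin f)) -(fineK (l2_fin g)) -!l2norm_sq -!EFinM -EFinD.
rewrite lee_fin -subr_ge0.
have -> : (2 * (l2norm f + l2norm g)) ^+ 2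
    - (2 * l2norm f ^+ 2 + 2 * l2norm g ^+ 2)
  = 2 * l2norm f ^+ 2 + 2 * l2norm g ^+ 2 + 8 * (l2norm f * l2norm g) by ring.
by rewrite !addr_ge0 ?mulr_ge0 ?sqr_ge0 ?l2norm_ge0.
Qed.

Lemma l2normZ a f : l2norm (a *: f) <= normc a * l2norm f.
Proof.
apply: l2norm_le; first by rewrite mulr_ge0 ?l2norm_ge0 ?normc_nneg.
apply: (le_trans (esqnormZ _ _)).
by rewrite -(fineK (l2_fin f)) -l2norm_sq -EFinM exprMn.
Qed.

(* Bounded operators on l^2(Z) form a unital C-algebra, with composition as
   product. A unit of this algebra is an operator with a bounded two-sided
   inverse, and for such A the algebra inverse A^-1 is the inverse operator. *)
Definition bop_pred : {pred l2 -> l2} :=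
  fun A => `[< linear A /\ exists M : R, forall f, l2norm (A f) <= M * l2norm f >].

Fact bop_submod_closed : submod_closed bop_pred.
Proof.
split=> [|a A B /asboolP[lA [M hM]] /asboolP[lB [N hN]]]; apply/asboolP; split.
- by move=> b f g; rewrite /= scaler0 addr0.
- by exists 0 => f; rewrite mul0r /= l2norm0.
- by move=> b f g /=; rewrite !fctE lA lB !scalerDr !scalerA [a * b]mulrC !addrA;
     congr (_ + _); rewrite -!addrA; congr (_ + _); rewrite addrC.
exists (2 * (normc a * M + N)) => f.
apply: (le_trans (l2normD (a *: A f) (B f))).
rewrite -mulrA; apply: ler_wpM2l => //; rewrite mulrDl; apply: lerD => //.
rewrite -mulrA; apply: (le_trans (l2normZ _ _)).
by apply: ler_wpM2l => //; apply: normc_nneg.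
Qed.
HB.instance Definition _ :=
  GRing.isSubmodClosed.Build C (l2 -> l2) bop_pred bop_submod_closed.

Record bop := Bop { bopval :> l2 -> l2; bopvalP : bopval \in bop_pred }.
HB.instance Definition _ := [isSub for bopval].
HB.instance Definition _ := [Choice of bop by <:].
HB.instance Definition _ := [SubChoice_isSubLmodule of bop by <:].

Fact bop_linear (A : bop) : linear A.
Proof. by have /asboolP[] := bopvalP A. Qed.
HB.instance Definition _ (A : bop) :=
  GRing.isLinear.Build C l2 l2 *:%R (bopval A) (bop_linear A).

Fact bop1_subproof : (id : l2 -> l2) \in bop_pred.
Proof. by apply/asboolP; split => //; exists 1 => f; rewrite mul1r. Qed.
Definition bop1 : bop := Bop bop1_subproof.

Fact bopM_subproof (A B : bop) : (A \o B) \in bop_pred.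
Proof.
have /asboolP[_ [M hM]] := bopvalP A; have /asboolP[_ [N hN]] := bopvalP B.
apply/asboolP; split=> [b f g /=|]; first by rewrite !linearP.
exists (`|M| * N) => f /=; apply: (le_trans (hM _)).
apply: (le_trans (ler_wpM2r (l2norm_ge0 _) (ler_norm M))).
by rewrite -mulrA ler_wpM2l.
Qed.
Definition bopM (A B : bop) : bop := Bop (bopM_subproof A B).

Lemma bopP (A B : bop) : (forall f, A f = B f) -> A = B.
Proof. by move=> h; apply: val_inj; apply/funext. Qed.

Fact ket_subproof (k : int) : (fun j => (j == k)%:R : C) \in l2_pred.
Proof.
apply/asboolP; suff -> : esqnorm (fun j => (j == k)%:R) = 1%E by rewrite ltry.
rewrite -(@esum_set1 R int k (fun=> 1%E) lee01) [RHS]esum_mkcond.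
apply: eq_esum => j _.
case: (eqVneq j k) => [->|/eqP jk].
  by rewrite mem_set// normc1 expr1n.
by rewrite memNset// normc0 expr0n.
Qed.
Definition ket (k : int) : l2 := L2 (ket_subproof k).

Fact bop1_neq0 : bop1 != 0.
Proof.
apply/eqP => /(congr1 (fun A : bop => (A (ket 0)) 0)) /= /eqP.
by rewrite oner_eq0.
Qed.

Fact bopMA : associative bopM. Proof. by move=> A B D; apply: bopP. Qed.
Fact bop1M : left_id bop1 bopM. Proof. by move=> A; apply: bopP. Qed.
Fact bopM1 : right_id bop1 bopM. Proof. by move=> A; apply: bopP. Qed.
Fact bopMDl : left_distributive bopM +%R.
Proof. by move=> A B D; apply: bopP. Qed.
Fact bopMDr : right_distributive bopM +%R.
Proof. by move=> A B D; apply: bopP => f /=; rewrite linearD. Qed.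
HB.instance Definition _ :=
  GRing.Zmodule_isNzRing.Build bop bopMA bop1M bopM1 bopMDl bopMDr bop1_neq0.

Fact bopZAl (a : C) (A B : bop) : a *: (A * B) = (a *: A) * B.
Proof. exact: bopP. Qed.
HB.instance Definition _ := GRing.Lmodule_isLalgebra.Build C bop bopZAl.
Fact bopZAr (a : C) (A B : bop) : a *: (A * B) = A * (a *: B).
Proof. by apply: bopP => f /=; rewrite linearZ. Qed.
HB.instance Definition _ := GRing.Lalgebra_isAlgebra.Build C bop bopZAr.

Definition bop_unit : pred bop :=
  fun A => `[< exists B : bop, B * A = 1 /\ A * B = 1 >].
Definition bop_inv (A : bop) : bop :=
  if pselect (exists B : bop, B * A = 1 /\ A * B = 1) is left e
  then sval (cid e) else A.
Fact bop_mulVr : {in bop_unit, left_inverse 1 bop_inv *%R}.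
Proof.
move=> A /asboolP h; rewrite /bop_inv; case: pselect => // e.
by have [] := svalP (cid e).
Qed.
Fact bop_mulrV : {in bop_unit, right_inverse 1 bop_inv *%R}.
Proof.
move=> A /asboolP h; rewrite /bop_inv; case: pselect => // e.
by have [] := svalP (cid e).
Qed.
Fact bop_unitP (A B : bop) : B * A = 1 /\ A * B = 1 -> bop_unit A.
Proof. by move=> h; apply/asboolP; exists B. Qed.
Fact bop_invr_out : {in [predC bop_unit], bop_inv =1 id}.
Proof. by move=> A /asboolP h; rewrite /bop_inv; case: pselect. Qed.
HB.instance Definition _ := GRing.NzRing_hasMulInverse.Build bop
  bop_mulVr bop_mulrV bop_unitP bop_invr_out.

Implicit Types A B J : bop.

Definition opnorm A : R :=
  sup [set l2norm (A f) | f in [set f | l2norm f <= 1]].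

Definition spectrum A : set C := [set z | z%:A - A \isn't a GRing.unit].

Definition is_adjoint A B : Prop := forall f g, l2dot (A f) g = l2dot f (B g).

(* The default value 0 is never used: every bounded operator on l^2(Z) has
   exactly one adjoint. *)
Definition adjoint A : bop := xget 0 [set B | is_adjoint A B].

(* In coordinates, the operator mapping |k> to |a + b k>, for b != 0. *)
Section Embedding.
Variables a b : int.

Definition emb_fun (u : int -> C) : int -> C :=
  fun j => if (b %| j - a)%Z then u ((j - a) %/ b)%Z else 0.

Lemma esqnorm_emb u : (esqnorm (emb_fun u) <= esqnorm u)%E.
Proof.
pose D := [set j : int | (b %| j - a)%Z].
pose phi (j : int) := ((j - a) %/ b)%Z.
have inj : set_bij D (phi @` D) phi.
  split=> // j k; rewrite !inE => hj hk e; apply: (addIr (- a)).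
  by rewrite -(divzK hj) -(divzK hk); congr (_ * _).
rewrite /esqnorm (_ : esum _ _ =
    \esum_(j in D) (normc (u (phi j)) ^+ 2)%:E)%E; last first.
  rewrite [RHS]esum_mkcond; apply: eq_esum => j _; rewrite /emb_fun.
  by case: ifPn => h; [rewrite mem_set|rewrite memNset//; [rewrite normc0 expr0n|exact/negP]].
rewrite -(reindex_esum _ _ _ (fun j => (normc (u j) ^+ 2)%:E) inj).
rewrite esum_mkcond; apply: le_esum => k _.
by case: ifP => // _; rewrite lee_fin sqr_ge0.
Qed.

Fact emb_subproof f : emb_fun f \in l2_pred.
Proof.
apply/asboolP; apply: (le_lt_trans (esqnorm_emb _)).
exact/asboolP/(l2valP f).
Qed.

Fact emb_bop_subproof : (fun f : l2 => L2 (emb_subproof f)) \in bop_pred.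
Proof.
apply/asboolP; split=> [c f g|].
  apply: val_inj; apply/funext => j /=; rewrite /emb_fun !fctE /=.
  by case: ifP => // _; rewrite scaler0 addr0.
exists 1 => f; rewrite mul1r; apply: l2norm_le; first exact: l2norm_ge0.
by rewrite l2norm_sq fineK ?l2_fin//; apply: esqnorm_emb.
Qed.
Definition emb : bop := Bop emb_bop_subproof.

Lemma emb_ket (k : int) : b != 0 -> emb (ket k) = ket (a + b * k).
Proof.
move=> b0; apply: val_inj; apply/funext => j /=; rewrite /emb_fun.
case: ifPn => [h|h].
  congr (_%:R); congr nat_of_bool; apply/eqP/eqP => [<-|->].
    by rewrite mulrC divzK// addrC subrK.
  by rewrite addrC addKr mulKz.
case: eqP => // e; case/negP: h; rewrite e addrC addKr dvdz_mulr//.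
Qed.

End Embedding.

Definition shiftZ : bop := emb 1 1.

Lemma shiftZ_ket k : shiftZ (ket k) = ket (k + 1).
Proof. by rewrite emb_ket// mul1r addrC. Qed.

Lemma shiftZ_unit : shiftZ \is a GRing.unit.
Proof.
apply/unitrP; exists (emb (- 1) 1); split; apply: bopP => f; apply: val_inj;
  by apply/funext => j /=; rewrite /emb_fun !dvd1z !divz1 ?opprK ?subrK ?addrK.
Qed.

Definition is_jacobi J : Prop :=
  is_adjoint J J /\
  exists p q : int -> R,
    (forall k, 0 <= p k) /\
    (forall k, J (ket k) = (p k)%:C *: ket (k - 1) + (q k)%:C *: ket k
                           + (p (k + 1))%:C *: ket (k + 1)).

Definition unit_segment : set C := [set x%:C | x in `[-1, 1]].

Definition complexify (T : {poly R}) : {poly C} := map_poly (real_complex R) T.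

(* The full preimage of [-1, 1] in the complex plane. *)
Definition preimage_segment (T : {poly R}) : set C :=
  [set z | unit_segment (complexify T).[z]].

Definition critical_point (T : {poly R}) (z : C) : Prop := root (complexify T)^`() z.

(* Critical points range over all complex roots of T'; being simple means that
   they are simple roots of T'. *)
Definition expanding (T : {poly R}) : Prop :=
  [/\ (2 < size T)%N, 0 < lead_coef T,
      forall z, critical_point T z ->
        z \is Num.real /\ mup z (complexify T)^`() = 1%N,
      forall z, critical_point T z -> 1 < normc (complexify T).[z]
    & preimage_segment T `<=` unit_segment].

Definition degree (T : {poly R}) : nat := (size T).-1.

Definition renormalization_solution (eps : nat) (Jt : bop) (T : {poly R}) J
    : Prop :=
  let d := degree T in
  let V := emb eps%:Z d%:Z in
  [/\ is_jacobi J, spectrum J `<=` preimage_segment T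
    & forall z : C, ~ preimage_segment T z ->
      adjoint V * (z%:A - J)^-1 * V
      = ((complexify T)^`().[z] / d%:R) *: ((complexify T).[z]%:A - Jt)^-1].

(* poly_iter T n is T_n o ... o T_2 o T_1; T 0 is not used. *)
Fixpoint poly_iter (T : nat -> {poly R}) (n : nat) : {poly R} :=
  if n is m.+1 then T m.+1 \Po poly_iter T m else 'X.

Definition rho J (k : int) : R := opnorm (shiftZ ^ (- k) * J * shiftZ ^ k - J).

(* The open sets of the topology of the translation-invariant pseudometric
   (x, y) |-> rho J (y - x) on Z. *)
Definition rho_open J (U : set int) : Prop :=
  forall x, U x -> exists2 r : R, 0 < r & forall y, rho J (y - x) < r -> U y.

End SequenceSpace.

Arguments unit_segment R _ : clear implicits.

(* d_1 ... d_l; the value d 0 is not used. *)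
Definition deg_prod (d : nat -> nat) (l : nat) : nat := \prod_(1 <= i < l.+1) d i.

(* The open sets of the group topology on Z in which the subgroups
   d_1 ... d_l Z, l >= 1, form a basis of neighbourhoods of 0. *)
Definition adic_open (d : nat -> nat) (U : set int) : Prop :=
  forall x, U x -> exists2 l, (1 <= l)%N &
    forall m : int, U (x + (deg_prod d l)%:Z * m).

(* Main.v *)
Require Import Defs.
From HB Require Import structures.
From mathcomp Require Import all_boot all_order all_algebra.
From mathcomp Require Import all_classical all_reals all_analysis.
From mathcomp Require Import complex.
From mathcomp Require Import ring lra zify.
Import Order.TTheory GRing.Theory Num.Theory.
Import numFieldNormedType.Exports.
Import ComplexField.Normc.

(** Written through its coefficients (p, q), a Jacobi matrix J solves the
    renormalization equation for (a, Jt, T) as soon as there is an operator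
    Phi(z), polynomial in z, with (z - J) Phi(z) = V (T(z) - Jt) and
    V^* Phi(z) = T'(z)/d. The columns of Phi(z) live on two neighbouring blocks
    of d sites; such a family of columns is the notion [kernel], and it turns
    the equation between operators into algebra of polynomials.

    At a critical point c of T the diagonal entry T'/d vanishes, and
    W_k(c) = - p_(b_k) phi_k(b_k - 1)(c) obeys the recursion
    W_k = T(c) - qt_k - pt_(k+1)^2 / W_(k+1), the one of the Weyl function of Jt
    at the energy T(c), which lies outside [-1, 1]. The numbers W_k(c) determine
    a block of J by a finite inverse problem: T(c) T''(c) < 0 makes
    - W_k(c) / (lead T * l_c(c)) a positive weight on the critical points, and
    the coefficients of J inside the block are the recurrence coefficients of
    the orthogonal polynomials of this weight ([sol_kernel]). Conversely
    the kernel with given Weyl values is unique ([good_unique]).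

    When |T(c)| >= 100, |W_k(c)| >= 98 and two sets of data at distance delta
    give weights with a relative difference at most delta / 49. Recurrence
    coefficients depend on the weight in a controlled way, uniformly in the
    degree, so that renormalization contracts the distance between coefficients
    by the factor 10 ([good_lip]). Because the solution is unique among those
    with |W| >= 1 ([good_unique_big]), solving for a composition T2 o T1 is
    solving for T2 and then for T1 ([comp_good], [comp_big]). Hence J_n is an
    n-fold composition of contractions applied to Jt: the limit exists and is
    independent of Jt. J itself is the image under the first l contractions of
    a matrix J', and shifting J' by m shifts J by d_1 ... d_l m; since these
    contractions bring any two matrices within a multiple of 10^-l, J is limit
    periodic. A near-period of J which is not a multiple of d_1 ... d_l is
    impossible: a solution of J u = c u which
    vanishes on a lattice and decays would have small Wronskian with the translate
    of another one, although this Wronskian is, up to a factor W of modulus at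
    least 1, an entry of the kernel ([shift_separation]).

    On the operator side, a Jacobi matrix has spectrum in [-1, 1] exactly when
    its quadratic form is bounded by 1 on finitely supported vectors
    ([spectrum_form_bd], [form_bd_spectrum]), a condition stable under
    entrywise limits. That the spectrum of the constructed J lies in
    T^-1([-1, 1]) comes from a lower bound for |(t - J) u| at real t
    with T(t) outside [-1, 1] ([real_point_unit]): the restriction of u to the
    lattice is controlled by the kernel, and inside a block u is controlled by
    the orthogonal polynomials, except at a critical point, where a contractive
    recursion along the blocks is used ([weighted_recursion]). *)

Set Implicit Arguments.
Unset Strict Implicit.
Unset Printing Implicit Defensive.

Local Open Scope ring_scope.

(** * Lagrange interpolation and discrete orthogonal polynomials *)

Section Nodes.
Variable R : realType.
Variable cs : seq R.
Hypothesis cs_uniq : uniq cs.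
Local Notation m := (size cs).
Implicit Types (f g r : {poly R}) (c e : R).

Definition nodal : {poly R} := \prod_(c <- cs) ('X - c%:P).
Definition lpoly c : {poly R} := \prod_(e <- cs | e != c) ('X - e%:P).

Lemma nodal_lpoly c : c \in cs -> nodal = ('X - c%:P) * lpoly c.
Proof. by move=> hc; rewrite /nodal (bigD1_seq c). Qed.

Lemma monic_nodal : nodal \is monic.
Proof. exact: monic_prod_XsubC. Qed.

Lemma size_nodal : size nodal = m.+1.
Proof. exact: size_prod_XsubC. Qed.

Lemma monic_lpoly c : lpoly c \is monic.
Proof. exact: monic_prod_XsubC. Qed.

Lemma size_lpoly c : c \in cs -> size (lpoly c) = m.
Proof.
move=> hc; have := size_nodal; rewrite (nodal_lpoly hc) size_monicM ?monicXsubC//.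
  by rewrite size_XsubC /= => -[].
exact/monic_neq0/monic_lpoly.
Qed.

Lemma lpoly_root c e : e \in cs -> e != c -> (lpoly c).[e] = 0.
Proof.
move=> he ec; rewrite /lpoly horner_prod; apply/eqP; rewrite prodf_seq_eq0.
by apply/hasP; exists e; rewrite // ec hornerXsubC subrr eqxx.
Qed.

Lemma lpoly_neq0 c : (lpoly c).[c] != 0.
Proof.
rewrite /lpoly horner_prod prodf_seq_neq0; apply/allP => e _ /=.
by apply/implyP => ec; rewrite hornerXsubC subr_eq0 eq_sym.
Qed.

Lemma nodal_root c : c \in cs -> nodal.[c] = 0.
Proof. by move=> hc; rewrite (nodal_lpoly hc) hornerM hornerXsubC subrr mul0r. Qed.

Lemma nodal_deriv c : c \in cs -> nodal^`().[c] = (lpoly c).[c].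
Proof.
move=> hc; rewrite (nodal_lpoly hc) derivM derivXsubC mul1r hornerD hornerM.
by rewrite hornerXsubC subrr mul0r addr0.
Qed.

Lemma poly_nodes0 f : (size f <= m)%N -> (forall c, c \in cs -> f.[c] = 0) -> f = 0.
Proof.
move=> sf hf; apply/eqP/negPn/negP => f0.
have : (m < size f)%N by apply: max_poly_roots => //; apply/allP => c hc; apply/eqP/hf.
by rewrite ltnNge sf.
Qed.

Lemma poly_nodes f g : (size f <= m)%N -> (size g <= m)%N ->
  (forall c, c \in cs -> f.[c] = g.[c]) -> f = g.
Proof.
move=> sf sg h; apply/eqP; rewrite -subr_eq0; apply/eqP/poly_nodes0.
  by rewrite (leq_trans (size_polyD _ _))// size_polyN geq_max sf.
by move=> c hc; rewrite hornerD hornerN h// subrr.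
Qed.

Lemma size_lsum (F : R -> R) : (size (\sum_(c <- cs) F c *: lpoly c)%R <= m)%N.
Proof.
apply: (leq_trans (size_sum _ _ _)); rewrite big_seq.
elim/big_ind: _ => // [a b ha hb|c hc]; first by rewrite geq_max ha.
by rewrite (leq_trans (size_scale_leq _ _))// size_lpoly.
Qed.

Lemma horner_lsum (F : R -> R) c : c \in cs ->
  (\sum_(e <- cs) F e *: lpoly e)%R.[c] = F c * (lpoly c).[c].
Proof.
move=> hc; rewrite horner_sum (bigD1_seq c)//= hornerZ big_seq_cond big1 ?addr0//.
by move=> e /andP[he ec]; rewrite hornerZ lpoly_root ?mulr0// eq_sym.
Qed.

Lemma lagrange f : (size f <= m)%N ->
  f = \sum_(c <- cs) (f.[c] / (lpoly c).[c]) *: lpoly c.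
Proof.
move=> sf; apply: poly_nodes => // [|c hc]; first exact: size_lsum.
by rewrite horner_lsum// divfK// lpoly_neq0.
Qed.

Lemma coef_lsum (F : R -> R) : (0 < m)%N ->
  (\sum_(c <- cs) F c *: lpoly c)%R`_m.-1 = \sum_(c <- cs) F c.
Proof.
move=> m0; rewrite coef_sum big_seq [RHS]big_seq; apply: eq_bigr => c hc.
rewrite coefZ; have /monicP := monic_lpoly c.
by rewrite /lead_coef size_lpoly// => ->; rewrite mulr1.
Qed.

Section Orthogonal.
Variable w : R -> R.
Hypothesis w_gt0 : forall c, c \in cs -> 0 < w c.

Definition ip f g : R := \sum_(c <- cs) w c * f.[c] * g.[c].

Lemma ipC f g : ip f g = ip g f.
Proof. by apply: eq_bigr => c _; ring. Qed.
Lemma ipDr f g r : ip f (g + r) = ip f g + ip f r.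
Proof. by rewrite -big_split; apply: eq_bigr => c _; rewrite hornerD mulrDr. Qed.
Lemma ipZr a f g : ip f (a *: g) = a * ip f g.
Proof. by rewrite mulr_sumr; apply: eq_bigr => c _; rewrite hornerZ; ring. Qed.
Lemma ipDl f g r : ip (f + g) r = ip f r + ip g r.
Proof. by rewrite ipC ipDr !(ipC r). Qed.
Lemma ipZl a f g : ip (a *: f) g = a * ip f g.
Proof. by rewrite ipC ipZr ipC. Qed.
Lemma ipBr f g r : ip f (g - r) = ip f g - ip f r.
Proof. by rewrite ipDr -scaleN1r ipZr mulN1r. Qed.
Lemma ipBl f g r : ip (f - g) r = ip f r - ip g r.
Proof. by rewrite ipC ipBr !(ipC r). Qed.
Lemma ip0r f : ip f 0 = 0.
Proof. by rewrite -(scale0r 0) ipZr mul0r. Qed.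
Lemma ipX f g : ip ('X * f) g = ip f ('X * g).
Proof. by apply: eq_bigr => c _; rewrite !hornerM !hornerX; ring. Qed.

Lemma ipterm_ge0 f c : c \in cs -> 0 <= w c * f.[c] * f.[c].
Proof. by move=> hc; rewrite -mulrA -expr2 mulr_ge0 ?sqr_ge0// ltW// w_gt0. Qed.

Lemma ip_ge0 f : 0 <= ip f f.
Proof. by rewrite /ip big_seq; apply: sumr_ge0 => c hc; apply: ipterm_ge0. Qed.

Lemma ip_eq0 f : ip f f = 0 -> forall c, c \in cs -> f.[c] = 0.
Proof.
move=> h c hc; apply/eqP; move: h; rewrite /ip (bigD1_seq c)//= => /eqP.
rewrite paddr_eq0 ?ipterm_ge0//; last first.
  by rewrite big_seq_cond; apply: sumr_ge0 => e /andP[he _]; apply: ipterm_ge0.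
case/andP; rewrite !mulf_eq0; have /lt0r_neq0/negPf-> := w_gt0 hc.
by move=> /= /orP[] ->.
Qed.

(** Two consecutive orthogonal polynomials. The predecessor of the first one is
    0, so that the quotient by its norm 0 does not matter. *)
Fixpoint opol2 (n : nat) : {poly R} * {poly R} :=
  if n is k.+1 then
    let: (f, g) := opol2 k in
    (('X * f - (ip ('X * f) f / ip f f) *: f - (ip f f / ip g g) *: g), f)
  else (1, 0).
Definition opol n := (opol2 n).1.
Definition hnorm n := ip (opol n) (opol n).
Definition opQ n := ip ('X * opol n) (opol n) / hnorm n.
Definition opP2 n := hnorm n.+1 / hnorm n.

Lemma opol0 : opol 0 = 1. Proof. by []. Qed.
Lemma opol1 : opol 1 = 'X - (opQ 0)%:P.
Proof. by rewrite /opol /= scaler0 subr0 mulr1 /opQ mulr1 alg_polyC. Qed.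
Lemma opolS n : opol n.+2 = 'X * opol n.+1 - opQ n.+1 *: opol n.+1 - opP2 n *: opol n.
Proof. by rewrite /opQ /opP2 /hnorm /opol /=; case: (opol2 n). Qed.

Lemma opol_lead n : size (opol n) = n.+1 /\ opol n \is monic.
Proof.
suff: forall k, (k <= n)%N -> size (opol k) = k.+1 /\ opol k \is monic by apply.
elim: n => [|n IH] k; first by rewrite leqn0 => /eqP->; rewrite opol0 size_poly1 monic1.
rewrite leq_eqVlt => /orP[/eqP->|]; last exact: IH.
case: n IH => [|n] IH.
  by rewrite opol1 size_XsubC monicXsubC.
have [s1 m1] := IH n.+1 (leqnn _); have [s0 m0] := IH n (leqnSn _).
have sX : size ('X * opol n.+1) = n.+3 by rewrite size_monicM ?monicX ?monic_neq0// size_polyX s1.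
have lt2 : (size (- (opQ n.+1 *: opol n.+1) - opP2 n *: opol n)%R < size ('X * opol n.+1)%R)%N.
  rewrite sX ltnS (leq_trans (size_polyD _ _))// !size_polyN geq_max.
  rewrite (leq_trans (size_scale_leq _ _)) ?s1//.
  by rewrite (leq_trans (size_scale_leq _ _)) ?s0.
rewrite opolS -addrA; split; first by rewrite size_polyDl// sX.
by apply/monicP; rewrite lead_coefDl//; apply/monicP; rewrite monicMl ?monicX.
Qed.
Lemma size_opol n : size (opol n) = n.+1. Proof. by case: (opol_lead n). Qed.
Lemma monic_opol n : opol n \is monic. Proof. by case: (opol_lead n). Qed.
Lemma coef_opol n : (opol n)`_n = 1.
Proof. by have /monicP := monic_opol n; rewrite /lead_coef size_opol. Qed.

Lemma hnorm_gt0 n : (n < m)%N -> 0 < hnorm n.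
Proof.
move=> nm; rewrite lt0r ip_ge0 andbT; apply/eqP => /ip_eq0 h.
have : opol n = 0 by apply: poly_nodes0 => //; rewrite size_opol.
by move/eqP; rewrite (negPf (monic_neq0 (monic_opol n))).
Qed.

Definition opprev n := if n is k.+1 then opP2 k *: opol k else 0.

Lemma opol_three n : 'X * opol n = opol n.+1 + opQ n *: opol n + opprev n.
Proof.
case: n => [|n]; last by rewrite opolS /opprev; ring.
by rewrite opol1 opol0 /opprev mulr1 addr0 alg_polyC subrK.
Qed.

Lemma opol_orth n j : (n <= m)%N -> (j < n)%N -> ip (opol n) (opol j) = 0.
Proof.
move=> nm; suff: forall k, (k <= n)%N -> forall j, (j < k)%N -> ip (opol k) (opol j) = 0.
  by move=> H; apply: H.
elim: n nm => [|n IH] nm k; first by rewrite leqn0 => /eqP->.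
rewrite leq_eqVlt => /orP[/eqP->|]; last by apply: IH; apply: ltnW.
move=> {}j jn.
have {}IH : forall k, (k <= n)%N -> forall j, (j < k)%N -> ip (opol k) (opol j) = 0.
  by apply: IH; apply: ltnW.
have -> : opol n.+1 = 'X * opol n - opQ n *: opol n - opprev n.
  by rewrite opol_three; ring.
rewrite !ipBl ipX ipZl.
move: jn; rewrite ltnS leq_eqVlt => /orP[/eqP->|jn].
  rewrite -ipX [opQ n * _]mulrC {1}/opQ mulrCA mulfV ?mulr1 ?subrr ?add0r ?sub0r.
    rewrite /opprev; case: (n) IH => [|i] IH; first by rewrite ipC ip0r oppr0.
    by rewrite ipZl ipC IH// mulr0 oppr0.
  by apply: lt0r_neq0; apply: hnorm_gt0.
rewrite opol_three !ipDr ipZr !(IH n (leqnn n) j jn) ?mulr0 ?addr0 ?subr0.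
have -> : ip (opol n) (opprev j) = 0.
  by rewrite /opprev; case: (j) jn => [|i] ji; rewrite ?ip0r// ipZr (IH n) ?mulr0// ltnW// ltnW.
rewrite addr0; case: n IH nm jn => [//|n] IH nm jn.
rewrite ipZl; move: jn; rewrite ltnS leq_eqVlt => /orP[/eqP->|jn].
  rewrite -/(hnorm n) -/(hnorm n.+1) /opP2 divfK ?subrr//.
  by apply/lt0r_neq0/hnorm_gt0/ltnW.
by rewrite (IH n.+1)// (IH n)// mulr0 subr0.
Qed.

Lemma opol_reduce n r : (size r <= n.+1)%N -> (size (r - r`_n *: opol n)%R <= n)%N.
Proof.
move=> sr; apply/leq_sizeP => i; rewrite leq_eqVlt => /orP[/eqP<-|ki].
  by rewrite coefB coefZ coef_opol mulr1 subrr.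
rewrite coefB coefZ [r`_i]nth_default ?(leq_trans sr)//.
by rewrite [(opol n)`_i]nth_default ?size_opol// mulr0 subrr.
Qed.

Lemma opol_orth_low n r : (n <= m)%N -> (size r <= n)%N -> ip (opol n) r = 0.
Proof.
move=> nm sr; suff: forall k, (k <= n)%N -> forall r, (size r <= k)%N -> ip (opol n) r = 0.
  by move=> H; apply: (H n).
elim=> [|k IH] kn {sr}r sr.
  by move: sr; rewrite leqn0 size_poly_eq0 => /eqP->; rewrite ip0r.
rewrite -(subrK (r`_k *: opol k) r) ipDr ipZr opol_orth// mulr0 addr0.
by apply: IH; [exact: ltnW|exact: opol_reduce].
Qed.

Lemma ip_opol_lead n r : (n <= m)%N -> (size r <= n.+1)%N ->
  ip (opol n) r = r`_n * hnorm n.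
Proof.
move=> nm sr; rewrite -{1}(subrK (r`_n *: opol n) r) ipDr ipZr.
by rewrite opol_orth_low ?add0r ?opol_reduce.
Qed.

(** Modulo polynomials of smaller degree, both sides are orthogonal to everything
    of degree < m: the nodal polynomial vanishes at all nodes. *)
Lemma opol_nodal : opol m = nodal.
Proof.
have sD : (size (opol m - nodal)%R <= m)%N.
  apply/leq_sizeP => i; rewrite leq_eqVlt => /orP[/eqP<-|ki].
    rewrite coefB coef_opol; have /monicP := monic_nodal.
    by rewrite /lead_coef size_nodal => ->; rewrite subrr.
  by rewrite coefB !nth_default ?subrr ?size_opol ?size_nodal.
apply/eqP; rewrite -subr_eq0; apply/eqP/poly_nodes0 => // c hc.
rewrite hornerD hornerN nodal_root// subr0.
apply: ip_eq0 hc; have <- := opol_orth_low (leqnn m) sD.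
rewrite ipBr [X in _ - X](_ : _ = 0) ?subr0//.
by rewrite /ip big_seq big1// => e /nodal_root->; rewrite mulr0.
Qed.

(** Pair the last orthogonal polynomial with l_c, which is monic of the same degree
    and vanishes at the other nodes. *)
Lemma opol_last c : c \in cs ->
  w c * (opol m.-1).[c] * (lpoly c).[c] = hnorm m.-1.
Proof.
move=> hc; have m0 : (0 < m)%N by case: (cs) hc.
have -> : w c * (opol m.-1).[c] * (lpoly c).[c] = ip (opol m.-1) (lpoly c).
  rewrite /ip (bigD1_seq c)//= big_seq_cond big1 ?addr0// => e /andP[he ec].
  by rewrite lpoly_root ?mulr0// eq_sym.
rewrite ip_opol_lead ?leq_pred// ?size_lpoly ?prednK//.
by have /monicP := monic_lpoly c; rewrite /lead_coef size_lpoly// => ->; rewrite mul1r.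
Qed.

Lemma opol_last_sum : (0 < m)%N ->
  \sum_(c <- cs) (w c * (opol m.-1).[c]) *: lpoly c = (hnorm m.-1)%:P.
Proof.
move=> m0; apply: poly_nodes => [||c hc]; first exact: size_lsum.
  by rewrite (leq_trans (size_polyC_leq1 _)).
by rewrite horner_lsum// opol_last// hornerC.
Qed.

(** The polynomial of degree < m with values w_c * opol n (c) * l_c(c) at the nodes,
    a second solution of the three-term recurrence; it plays the role of the
    functions of the second kind. *)
Definition lser n : {poly R} := \sum_(c <- cs) (w c * (opol n).[c]) *: lpoly c.

Lemma lser_mulX n : 'X * lser n
  = \sum_(c <- cs) (w c * ('X * opol n).[c]) *: lpoly c + (ip (opol n) 1) *: nodal.
Proof.
rewrite /lser /ip mulr_sumr scaler_suml -big_split /= big_seq [RHS]big_seq.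
apply: eq_bigr => c hc.
rewrite (nodal_lpoly hc) hornerM hornerX hornerC mulr1 -!mul_polyC !rmorphM/=.
by ring.
Qed.

Lemma lser_three n : (n < m)%N -> 'X * lser n = lser n.+1 + opQ n *: lser n
  + (if n is k.+1 then opP2 k *: lser k else hnorm 0 *: nodal).
Proof.
move=> nm; rewrite lser_mulX opol_three.
have E : \sum_(c <- cs) (w c * (opol n.+1 + opQ n *: opol n + opprev n).[c]) *: lpoly c
   = lser n.+1 + opQ n *: lser n + \sum_(c <- cs) (w c * (opprev n).[c]) *: lpoly c.
  rewrite /lser scaler_sumr -!big_split/=; apply: eq_bigr => c _.
  by rewrite !hornerD !hornerZ -!mul_polyC !(rmorphM, rmorphD)/=; ring.
rewrite {}E; case: n nm => [|n] nm.
  rewrite (_ : \sum_(c <- cs) _ *: _ = 0) ?addr0 ?/hnorm ?opol0//.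
  by rewrite big1// => c _; rewrite horner0 mulr0 scale0r.
rewrite opol_orth_low ?size_poly1//; last exact: ltnW.
rewrite scale0r addr0 /lser; congr (_ + _).
rewrite [in RHS]scaler_sumr; apply: eq_bigr => c _.
by rewrite hornerZ -!mul_polyC !rmorphM/=; ring.
Qed.

Lemma lser_last : lser m = 0.
Proof.
rewrite /lser opol_nodal big_seq big1// => c hc.
by rewrite nodal_root// mulr0 scale0r.
Qed.

Lemma opol_bound n c : c \in cs -> (w c) * (opol n).[c] ^+ 2 <= hnorm n.
Proof.
move=> hc; rewrite /hnorm /ip (bigD1_seq c)//= -mulrA -expr2 lerDl.
by rewrite big_seq_cond; apply: sumr_ge0 => e /andP[he _]; apply: ipterm_ge0.
Qed.

Lemma hnorm0 : hnorm 0 = \sum_(c <- cs) w c.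
Proof. by apply: eq_bigr => c _; rewrite opol0 hornerC !mulr1. Qed.

(** By [opol_last] the norm h of the last polynomial satisfies
    h = h^2 * sum_c 1 / (w_c l_c(c)^2). *)
Lemma hnorm_lastV : (0 < m)%N ->
  (hnorm m.-1)^-1 = \sum_(c <- cs) (w c * (lpoly c).[c] ^+ 2)^-1.
Proof.
move=> m0; have h0 : hnorm m.-1 != 0 by apply/lt0r_neq0/hnorm_gt0; rewrite prednK.
apply: (mulIf h0); rewrite mulVf//.
apply: (mulIf h0); rewrite mul1r {1}/hnorm /ip !mulr_suml big_seq [RHS]big_seq.
apply: eq_bigr => c hc; rewrite -!(opol_last hc).
have wc0 := lt0r_neq0 (w_gt0 hc); have l0 := lpoly_neq0 c.
by field; rewrite wc0 l0.
Qed.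

End Orthogonal.
End Nodes.

(** * Sublattices and kernels *)

Section Sites.
Variables (a : int) (d : nat).

(** Every integer is [site k - i] with 0 <= i < d, and [blk] and [off] return this
    k and i. Counting downwards from a lattice site is the order in which the
    orthogonal polynomials are attached to the sites of a block. *)
Definition site (k : int) : int := a + d%:Z * k.
Definition blk (n : int) : int := - ((a - n) %/ d%:Z)%Z.
Definition off (n : int) : nat := `|((a - n) %% d%:Z)%Z|%N.

Lemma blk_site k i : (i < d)%N -> blk (site k - i%:Z) = k.
Proof.
move=> id; have d0 : d%:Z != 0 by lia.
have -> : blk (site k - i%:Z) = - ((- k * d%:Z + i%:Z) %/ d%:Z)%Z.
  by rewrite /blk /site; congr (- (_ %/ _)%Z); ring.
by rewrite divzMDl// divz_small ?addr0 ?opprK//; lia.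
Qed.

Lemma blk_site0 k : (0 < d)%N -> blk (site k) = k.
Proof. by move=> d0; rewrite -{2}(blk_site k d0) subr0. Qed.

Lemma off_site k i : (i < d)%N -> off (site k - i%:Z) = i.
Proof.
move=> id; have d0 : d%:Z != 0 by lia.
have -> : off (site k - i%:Z) = `|((- k * d%:Z + i%:Z) %% d%:Z)%Z|%N.
  by rewrite /off /site; congr `|(_ %% _)%Z|%N; ring.
by rewrite modzMDl modz_small//; lia.
Qed.

Lemma siteP n : (0 < d)%N -> exists k i, (i < d)%N /\ n = site k - i%:Z.
Proof.
move=> d0; exists (blk n), (off n).
have dz : d%:Z != 0 by lia.
have d0' : (0 : int) < d%:Z by lia.
have := divz_eq (a - n) d%:Z; have := ltz_pmod (a - n) d0'; have := modz_ge0 (a - n) dz.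
rewrite /blk /off /site; set Q := (_ %/ _)%Z; set r := (_ %% _)%Z => r0 rd E.
split; first by lia.
have -> : `|r|%:Z = r by lia.
have : n = a - (Q * d%:Z + r) by rewrite -E; ring.
by move=> ->; ring.
Qed.

Lemma siteB1 k : site (k - 1) = site k - d%:Z.
Proof. by rewrite /site; ring. Qed.
Lemma siteD1 k : site (k + 1) = site k + d%:Z.
Proof. by rewrite /site; ring. Qed.
End Sites.

Section Kernel.
Variables (A : comNzRingType) (a : int) (d : nat).
Local Notation b := (site a d).

(** [F k] is the column k of Phi(z), for the values z of the variable, t of T and
    D of T'/d. [ker_latm], [ker_latp] and [ker_lat] say V^* Phi = D;
    [ker_in] and [ker_inr] are the equation (z - J) Phi = 0 inside the block
    below b_k, for the two columns which do not vanish there; the last three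
    fields are the entries (k, k), (k, k - 1) and (k, k + 1) of
    V^* (z - J) Phi = t - Jt. *)
Record kernel (z t D : A) (p q pt qt : int -> A) (F : int -> int -> A) : Prop :=
  Kernel {
  ker_lat : forall k, F k (b k) = D;
  ker_latm : forall k, F k (b (k - 1)) = 0;
  ker_latp : forall k, F k (b (k + 1)) = 0;
  ker_in : forall k i, (0 < i < d)%N -> let n := b k - i%:Z in
    z * F k n = p n * F k (n - 1) + q n * F k n + p (n + 1) * F k (n + 1);
  ker_inr : forall k i, (0 < i < d)%N -> let n := b k - i%:Z in
    z * F (k - 1) n = p n * F (k - 1) (n - 1) + q n * F (k - 1) n
                      + p (n + 1) * F (k - 1) (n + 1);
  ker_diag : forall k, z * D = p (b k) * F k (b k - 1) + q (b k) * D
                      + p (b k + 1) * F k (b k + 1) + (t - qt k);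
  ker_left : forall k, p (b k) * F (k - 1) (b k - 1) = pt k;
  ker_right : forall k, p (b k + 1) * F (k + 1) (b k + 1) = pt (k + 1) }.

(** The value (Phi x)(n), since at most two columns are nonzero at n. *)
Definition kext (F : int -> int -> A) (x : int -> A) (n : int) : A :=
  let k := blk a d n in F k n * x k + F (k - 1) n * x (k - 1).

Variables (z t D : A) (p q pt qt : int -> A) (F : int -> int -> A).
Hypothesis d1 : (1 < d)%N.
Hypothesis KF : kernel z t D p q pt qt F.
Variable x : int -> A.

Lemma kext_site k i : (i <= d)%N ->
  kext F x (b k - i%:Z) = F k (b k - i%:Z) * x k + F (k - 1) (b k - i%:Z) * x (k - 1).
Proof.
rewrite leq_eqVlt => /orP[/eqP->|id]; last by rewrite /kext blk_site.
rewrite -siteB1 (ker_latm KF) (ker_lat KF) mul0r add0r.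
rewrite /kext blk_site0 ?(ltnW d1)// (ker_lat KF).
have := ker_latp KF (k - 1 - 1); rewrite subrK => ->.
by rewrite mul0r addr0.
Qed.

Lemma kext_lat k : kext F x (b k) = D * x k.
Proof.
rewrite /kext blk_site0 ?(ltnW d1)// (ker_lat KF).
by have := ker_latp KF (k - 1); rewrite subrK => ->; rewrite mul0r addr0.
Qed.

Lemma kext_in k i : (0 < i < d)%N -> let n := b k - i%:Z in
  z * kext F x n = p n * kext F x (n - 1) + q n * kext F x n + p (n + 1) * kext F x (n + 1).
Proof.
move=> /andP[i0 id] n.
have e1 : n - 1 = b k - i.+1%:Z by rewrite /n; lia.
have e2 : n + 1 = b k - i.-1%:Z by rewrite /n; lia.
rewrite e1 e2 !kext_site ?(ltnW id)//; last by lia.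
have := ker_in KF k (i := i); rewrite i0 id => /(_ isT) /=; rewrite -/n e1 e2 => E.
have := ker_inr KF k (i := i); rewrite i0 id => /(_ isT) /=; rewrite -/n e1 e2 => E'.
rewrite -/n mulrDr [z * (_ * _)]mulrA E [z * (_ * x (k - 1))]mulrA E'.
by ring.
Qed.

Lemma kext_diag k :
  z * kext F x (b k) = p (b k) * kext F x (b k - 1) + q (b k) * kext F x (b k)
    + p (b k + 1) * kext F x (b k + 1)
    + (t * x k - (pt k * x (k - 1) + qt k * x k + pt (k + 1) * x (k + 1))).
Proof.
rewrite kext_lat -[b k - 1]/(b k - 1%:Z) kext_site ?(ltnW d1)//.
have e : b k + 1 = b (k + 1) - d.-1%:Z by rewrite siteD1; lia.
rewrite [in kext F x (b k + 1)]e kext_site ?leq_pred// -e addrK.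
have -> : b k - 1%:Z = b k - 1 by [].
rewrite !mulrDr ![p _ * (_ * _)]mulrA (ker_left KF) (ker_right KF).
by rewrite mulrA (ker_diag KF k); ring.
Qed.

End Kernel.

Lemma kernel_morph (A B : comNzRingType) (f : {rmorphism A -> B}) a d z t D p q pt qt F :
  kernel a d z t D p q pt qt F ->
  kernel a d (f z) (f t) (f D) (f \o p) (f \o q) (f \o pt) (f \o qt) (fun k n => f (F k n)).
Proof.
case=> h1 h2 h3 h4 h5 h6 h7 h8; split => /=.
- by move=> k; rewrite h1.
- by move=> k; rewrite h2 rmorph0.
- by move=> k; rewrite h3 rmorph0.
- by move=> k i hi; rewrite -rmorphM h4// !rmorphD !rmorphM.
- by move=> k i hi; rewrite -rmorphM h5// !rmorphD !rmorphM.
- by move=> k; rewrite -rmorphM (h6 k) rmorphD rmorphB !rmorphD !rmorphM.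
- by move=> k; rewrite -h7 rmorphM.
- by move=> k; rewrite -h8 rmorphM.
Qed.

(** * The inverse problem in a block *)

Section Explicit.
Variable R : realType.

(** What the algebra needs to know about T with critical points [cs]. Since
    T''(c) is a positive multiple of l_c(c), [crit_sgn] says T(c) T''(c) < 0. *)
Record critical (T : {poly R}) (cs : seq R) : Prop := Critical {
  crit_uniq : uniq cs;
  crit_size : size T = (size cs).+2;
  crit_nil : (0 < size cs)%N;
  crit_lead : 0 < lead_coef T;
  crit_deriv : T^`() = (lead_coef T * (size cs).+1%:R) *: nodal cs;
  crit_in : forall c, c \in cs -> `|c| <= 1;
  crit_sgn : forall c, c \in cs -> T.[c] * (lpoly cs c).[c] < 0;
  crit_val : forall c, c \in cs -> 1 < `|T.[c]|;
  crit_roots : exists xs : seq R,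
     T = lead_coef T *: \prod_(x <- xs) ('X - x%:P) /\
     forall x, x \in xs -> `|x| <= 1 }.

Variables (T : {poly R}) (cs : seq R).
Hypothesis CT : critical T cs.
Local Notation m := (size cs).
Local Notation d := (size cs).+1.
Local Notation tau := (lead_coef T).
Definition dpoly : {poly R} := tau *: nodal cs.

Section Data.
Variables (a : int) (pt : int -> R) (W : int -> R -> R).
Local Notation b := (site a d).

(** The residue at c of the rational function whose numerator interpolates
    - W_k / lead T at the critical points and whose denominator is [nodal cs]. *)
Definition wt (k : int) (c : R) : R := - W k c / (tau * (lpoly cs c).[c]).
Local Notation h k := (hnorm cs (wt k)).

Definition sol_q0 : R := (nodal cs)`_m.-1 - T`_m / tau.

(** The site b_k - 1 - i of a block carries the orthogonal polynomial of degree i.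
    The bond p at b_k - m leads to the next block and is the only one that
    involves pt. *)
Definition solp_at (k : int) (i : nat) : R :=
  if i is j.+1 then
    if i == m then pt k / (tau * Num.sqrt (h k m.-1))
    else Num.sqrt (h k i) / Num.sqrt (h k j)
  else Num.sqrt (h k 0).
Definition solq_at (k : int) (i : nat) : R :=
  if i is j.+1 then opQ cs (wt k) j else sol_q0.
(** [solL k i] is the column k at the site b_k - i, and [pt k * solP k i] is the
    column k - 1 at the same site. *)
Definition solL (k : int) (i : nat) : {poly R} :=
  if i is j.+1 then (tau / Num.sqrt (h k j)) *: lser cs (wt k) j else dpoly.
Definition solP (k : int) (i : nat) : {poly R} :=
  if i is j.+1 then (Num.sqrt (h k j))^-1 *: opol cs (wt k) j else 0.
Definition solF (k n : int) : {poly R} :=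
  let k' := blk a d n in let i := off a d n in
  if k' == k then solL k i else if k' == k + 1 then pt k' *: solP k' i else 0.

Definition solp (n : int) : R := solp_at (blk a d n) (off a d n).
Definition solq (n : int) : R := solq_at (blk a d n) (off a d n).

Lemma solpE k i : (i < d)%N -> solp (b k - i%:Z) = solp_at k i.
Proof. by move=> id; rewrite /solp blk_site// off_site. Qed.
Lemma solqE k i : (i < d)%N -> solq (b k - i%:Z) = solq_at k i.
Proof. by move=> id; rewrite /solq blk_site// off_site. Qed.
Lemma solFE k i : (i < d)%N -> solF k (b k - i%:Z) = solL k i.
Proof. by move=> id; rewrite /solF blk_site// off_site// eqxx. Qed.
Lemma solFrE k i : (i < d)%N -> solF (k - 1) (b k - i%:Z) = pt k *: solP k i.
Proof.
move=> id; rewrite /solF blk_site// off_site// subrK eqxx.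
by case: eqP => // ?; lia.
Qed.

Variable qt : int -> R.
Hypothesis Wrec : forall k c, c \in cs ->
  W k c = T.[c] - qt k - pt (k + 1) ^+ 2 / W (k + 1) c.
Hypothesis Wsgn : forall k c, c \in cs -> 0 < W k c * T.[c].

Let csU := crit_uniq CT.

Lemma W_neq0 k c : c \in cs -> W k c != 0.
Proof. by move=> hc; apply/eqP => W0; have := Wsgn k hc; rewrite W0 mul0r ltxx. Qed.

(** W_k(c) has the sign of T(c) and T(c) l_c(c) < 0. *)
Lemma wt_gt0 k c : c \in cs -> 0 < wt k c.
Proof.
move=> hc; have t0 := crit_lead CT; have l0 := lpoly_neq0 cs c.
have s1 := Wsgn k hc; have s2 := crit_sgn CT hc.
have T0 : 0 < T.[c] ^+ 2.
  by rewrite exprn_even_gt0//=; apply/eqP => T0; move: s1; rewrite T0 mulr0 ltxx.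
have l2 : 0 < (lpoly cs c).[c] ^+ 2 by rewrite exprn_even_gt0.
have -> : wt k c = (W k c * T.[c]) * (- (T.[c] * (lpoly cs c).[c]))
    / (tau * (T.[c] ^+ 2 * (lpoly cs c).[c] ^+ 2)).
  rewrite /wt; field; rewrite l0 (lt0r_neq0 t0) andbT.
  by apply: contraTneq T0 => ->; rewrite expr0n ltxx.
apply: divr_gt0; last by apply: mulr_gt0 => //; apply: mulr_gt0.
by apply: mulr_gt0 => //; rewrite oppr_gt0.
Qed.

Let w0 := wt_gt0.
Let wk0 k : forall c, c \in cs -> 0 < wt k c. Proof. exact: wt_gt0. Qed.

Lemma wtE k c : c \in cs -> tau * wt k c * (lpoly cs c).[c] = - W k c.
Proof.
move=> hc; rewrite /wt; field.
by rewrite (lpoly_neq0 cs c) (lt0r_neq0 (crit_lead CT)).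
Qed.

Lemma h_gt0 k i : (i < m)%N -> 0 < h k i.
Proof. by move=> im; exact: (hnorm_gt0 csU (@wk0 k) im). Qed.

Lemma sqrth_gt0 k i : (i < m)%N -> 0 < Num.sqrt (h k i).
Proof. by move=> im; rewrite sqrtr_gt0 h_gt0. Qed.

Lemma sqrt_h2 k i : (i < m)%N -> h k i = Num.sqrt (h k i) ^+ 2.
Proof. by move=> im; rewrite sqr_sqrtr// ltW// h_gt0. Qed.

Lemma hneq0 k i : (i < m)%N -> Num.sqrt (h k i) != 0.
Proof. by move=> im; apply/lt0r_neq0/sqrth_gt0. Qed.

Lemma solL_last k : solL k d = 0.
Proof. by rewrite /= lser_last ?scaler0//; apply: wk0. Qed.

Lemma solp_at_last k : solp_at k m = pt k / (tau * Num.sqrt (h k m.-1)).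
Proof. by have := crit_nil CT; rewrite /solp_at; case: (m) => // j _; rewrite eqxx. Qed.

Lemma solPm k : solP k m = (Num.sqrt (h k m.-1))^-1 *: opol cs (wt k) m.-1.
Proof. by rewrite -{1}(prednK (crit_nil CT)). Qed.

Lemma solLm k : solL k m = (tau / Num.sqrt (h k m.-1)) *: lser cs (wt k) m.-1.
Proof. by rewrite -{1}(prednK (crit_nil CT)). Qed.

Lemma solL_in k i : (0 < i < d)%N ->
  'X * solL k i = (if i == m then 0 else solp_at k i *: solL k i.+1)
     + solq_at k i *: solL k i + solp_at k i.-1 *: solL k i.-1.
Proof.
case: i => // i /andP[_ im0]; have {im0} im : (i < m)%N := im0.
have := lser_three csU (@wk0 k) im => E.
rewrite -scalerAr E !scalerDr !scalerA.
have -> : (tau / Num.sqrt (h k i)) *: lser cs (wt k) i.+1 =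
  (if i.+1 == m then 0
   else solp_at k i.+1 *: ((tau / Num.sqrt (h k i.+1)) *: lser cs (wt k) i.+1)).
  case: eqP => [->|/eqP im1]; first by rewrite lser_last ?scaler0//; apply: wk0.
  have i1m : (i.+1 < m)%N by rewrite ltn_neqAle im1.
  rewrite scalerA /= (negPf im1); congr (_ *: _).
  by field; rewrite !hneq0.
rewrite scalerA /=; congr (_ + _ *: _ + _); first by rewrite mulrC.
case: i im {E} => [|i] im /=.
  rewrite scalerA /dpoly scalerA; congr (_ *: _).
  by rewrite {2}(sqrt_h2 _ im); field; rewrite hneq0.
rewrite scalerA; case: eqP => [im'|_]; first by move: im; rewrite -im' ltnn.
rewrite scalerA /opP2; congr (_ *: _).
rewrite {2}(sqrt_h2 _ im) {1}(sqrt_h2 _ (ltnW im)).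
by field; rewrite !hneq0 ?(ltnW im).
Qed.

Lemma solP_in k i : (0 < i < d)%N ->
  'X * solP k i = (if i == m then (Num.sqrt (h k m.-1))^-1 *: nodal cs
                    else solp_at k i *: solP k i.+1)
     + solq_at k i *: solP k i + solp_at k i.-1 *: solP k i.-1.
Proof.
case: i => // i /andP[_ im0]; have {im0} im : (i < m)%N := im0.
rewrite -scalerAr opol_three !scalerDr [_ *: (opQ _ _ _ *: _)]scalerA.
have -> : (Num.sqrt (h k i))^-1 *: opol cs (wt k) i.+1 =
  (if i.+1 == m then (Num.sqrt (h k m.-1))^-1 *: nodal cs
   else solp_at k i.+1 *: ((Num.sqrt (h k i.+1))^-1 *: opol cs (wt k) i.+1)).
  case: eqP => [e|/eqP im1].
    by rewrite -(opol_nodal csU (@wk0 k)) -e.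
  have i1m : (i.+1 < m)%N by rewrite ltn_neqAle im1.
  rewrite scalerA /= (negPf im1); congr (_ *: _).
  by field; rewrite !hneq0.
congr (_ + _ + _); first by rewrite /= scalerA mulrC.
case: i im => [|i] im /=; first by rewrite !scaler0.
case: eqP => [im'|_]; first by move: im; rewrite -im' ltnn.
rewrite !scalerA /opP2; congr (_ *: _).
rewrite {2}(sqrt_h2 _ im) {1}(sqrt_h2 _ (ltnW im)).
by field; rewrite !hneq0 ?(ltnW im).
Qed.

Lemma size_dX : (size ('X * dpoly - sol_q0 *: dpoly - T)%R <= m)%N.
Proof.
have t0 : tau != 0 by apply/lt0r_neq0/(crit_lead CT).
have /monicP := monic_nodal cs; rewrite /lead_coef size_nodal /= => n1.
have m0 := crit_nil CT.
apply/leq_sizeP => i mi.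
rewrite coefB coefB coefZ coefXM /dpoly !coefZ.
case: i mi => [|i] mi; first by move: m0; rewrite lt0n -leqn0 mi.
rewrite /=; have [e|im] := eqVneq m i.+1.
  have -> : i = m.-1 by rewrite e.
  by rewrite prednK// n1 /sol_q0; field.
have im' : (m <= i)%N by rewrite -ltnS ltn_neqAle im.
rewrite [(nodal cs)`_i.+1]nth_default ?size_nodal// !mulr0 subr0.
move: im'; rewrite leq_eqVlt => /orP[/eqP<-|im'].
  by rewrite n1 mulr1 /lead_coef (crit_size CT) subrr.
by rewrite !nth_default ?mulr0 ?subrr ?size_nodal// (crit_size CT).
Qed.

(** The diagonal equation at b_k. The terms of degree m + 1 and m cancel, the latter
    by the choice of [sol_q0], and at a node the identity is the recursion for W. *)
Lemma sol_diag k : 'X * dpoly = tau *: lser cs (wt k) 0 + sol_q0 *: dpoly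
   + (pt (k + 1) ^+ 2 / (tau * h (k + 1) m.-1)) *: opol cs (wt (k + 1)) m.-1
   + (T - (qt k)%:P).
Proof.
have t0 : tau != 0 by apply/lt0r_neq0/(crit_lead CT).
have m0 := crit_nil CT; have m1 : (m.-1 < m)%N by rewrite prednK.
suff : 'X * dpoly - sol_q0 *: dpoly - T =
  tau *: lser cs (wt k) 0 + (pt (k + 1) ^+ 2 / (tau * h (k + 1) m.-1))
    *: opol cs (wt (k + 1)) m.-1 - (qt k)%:P.
  move=> H; have -> : 'X * dpoly = ('X * dpoly - sol_q0 *: dpoly - T) + (sol_q0 *: dpoly + T).
    by ring.
  by rewrite H; ring.
apply: (poly_nodes csU) => [||c hc]; first exact: size_dX.
  rewrite (leq_trans (size_polyD _ _))// geq_max; apply/andP; split.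
    rewrite (leq_trans (size_polyD _ _))// geq_max; apply/andP; split.
      by rewrite (leq_trans (size_scale_leq _ _))// size_lsum.
    by rewrite (leq_trans (size_scale_leq _ _))// size_opol prednK.
  by rewrite size_polyN (leq_trans (size_polyC_leq1 _)).
rewrite !(hornerD, hornerN, hornerZ, hornerM, hornerX, hornerC) nodal_root// !mulr0.
rewrite horner_lsum// opol0 hornerC mulr1 mulrA wtE// Wrec//.
rewrite -(opol_last csU (@wk0 (k + 1)) hc).
have w1 := lt0r_neq0 (wt_gt0 (k + 1) hc); have l0 := lpoly_neq0 cs c.
have -> : W (k + 1) c = - (tau * wt (k + 1) c * (lpoly cs c).[c]) by rewrite wtE// opprK.
have o1 : (opol cs (wt (k + 1)) m.-1).[c] != 0.
  apply/eqP => o0; have := opol_last csU (@wk0 (k + 1)) hc.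
  by rewrite o0 mulr0 mul0r => /esym/eqP; rewrite (negPf (lt0r_neq0 (h_gt0 _ m1))).
by field; rewrite t0 w1 l0 o1.
Qed.

(** Inside a block the columns are the two solutions of the three-term recurrence;
    at the ends of the block they are matched by [lser_last], [opol_nodal] and
    [opol_last_sum]. *)
Theorem sol_kernel : kernel a d 'X T dpoly (fun n => (solp n)%:P) (fun n => (solq n)%:P)
  (fun k => (pt k)%:P) (fun k => (qt k)%:P) solF.
Proof.
have t0 : tau != 0 by apply/lt0r_neq0/(crit_lead CT).
have m0 := crit_nil CT; have m1 : (m.-1 < m)%N by rewrite prednK.
have Fm k : solF k (b (k - 1)) = 0.
  rewrite /solF blk_site0//.
  by case: eqP => [|_]; [lia|case: eqP => // ?; lia].
have F0 k : solF k (b k) = dpoly by rewrite -[b k]subr0 -[0]/(0%:Z) solFE.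
have FL k i : (i <= d)%N -> solF k (b k - i%:Z) = solL k i.
  rewrite leq_eqVlt => /orP[/eqP->|]; last exact: solFE.
  by rewrite -siteB1 solL_last Fm.
have b1 k : b k + 1 = b (k + 1) - m%:Z by rewrite siteD1; lia.
have p0 k : solp (b k) = solp_at k 0 by have := @solpE k 0 isT; rewrite subr0.
have q0 k : solq (b k) = solq_at k 0 by have := @solqE k 0 isT; rewrite subr0.
have L1 k : solF k (b k - 1) = solL k 1 by exact: (@solFE k 1).
have P1 k : solF (k - 1) (b k - 1) = pt k *: solP k 1 by exact: (@solFrE k 1).
have Pm k : solF k (b (k + 1) - m%:Z) = pt (k + 1) *: solP (k + 1) m.
  by rewrite -[in LHS](addrK 1 k) subrK solFrE.
split => /=.
- exact: F0.
- exact: Fm.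
- move=> k; rewrite -[b (k + 1)]subr0 -[0]/(0%:Z) -{1}(addrK 1 k) solFrE//.
  by rewrite scaler0.
- move=> k i hi; have /andP[i0 id] := hi.
  have -> : b k - i%:Z + 1 = b k - i.-1%:Z by lia.
  have -> : b k - i%:Z - 1 = b k - i.+1%:Z by lia.
  rewrite !FL ?(ltnW id)//; last by lia.
  rewrite !mul_polyC solpE// solqE// solpE; last by lia.
  rewrite solL_in//; case: eqP => [->|_]//.
  by rewrite solL_last scaler0.
- move=> k i hi; have /andP[i0 id] := hi.
  have -> : b k - i%:Z + 1 = b k - i.-1%:Z by lia.
  have -> : b k - i%:Z - 1 = b k - i.+1%:Z by lia.
  rewrite [solF _ (b k - i%:Z)]solFrE// [solF _ (b k - i.-1%:Z)]solFrE; last by lia.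
  rewrite !mul_polyC solpE// solqE// [solp (_ - i.-1%:Z)]solpE; last by lia.
  rewrite -scalerAr solP_in// !scalerDr !scalerA ![pt k * _]mulrC; congr (_ + _ + _).
  case: eqP => [->|/eqP im].
    rewrite -siteB1 F0 /dpoly solp_at_last !scalerA; congr (_ *: _).
    by field; rewrite t0 hneq0.
  have i1 : (i.+1 < d)%N by move: id; rewrite !ltnS => id; rewrite ltn_neqAle im.
  rewrite solFrE// !scalerA; congr (_ *: _); ring.
- move=> k; rewrite b1 p0 q0 L1 Pm solpE// !mul_polyC.
  rewrite solp_at_last {1}(sol_diag k) solPm /= !scalerA.
  congr (_ *: _ + _ + _ *: _ + _).
    by field; rewrite hneq0.
  by rewrite {1}(sqrt_h2 _ m1); field; rewrite t0 hneq0.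
- move=> k; rewrite p0 P1 /= opol0 alg_polyC !mul_polyC -!alg_polyC !scalerA.
  by congr (_ *: _); field; rewrite hneq0.
- move=> k; rewrite b1 solpE// solFE// solp_at_last solLm.
  rewrite /lser (opol_last_sum csU (@wk0 _))// mul_polyC -alg_polyC !scalerA.
  rewrite -alg_polyC; congr (_ *: _).
  by rewrite {3}(sqrt_h2 _ m1); field; rewrite t0 hneq0.
Qed.

End Data.
End Explicit.

(** * Uniqueness of the solution with given Weyl values *)

Section SupBound.
Variable R : realType.

(** Take the supremum of both sides of the inequality. *)
Lemma sup_contraction (I : Type) (s : I -> I) (X : I -> R) (kappa e B : R) :
  0 <= kappa < 1 -> (forall i, X i <= B) -> (forall i, X i <= e + kappa * X (s i)) ->
  forall i, X i <= e / (1 - kappa).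
Proof.
move=> /andP[k0 k1] XB XS i0.
pose E := range X.
have hs : has_sup E by split; [exists (X i0), i0|exists B => _ [i _ <-]].
have Xs i : X i <= sup E by apply: ub_le_sup; [case: hs|exists i].
have S : sup E <= e + kappa * sup E.
  apply: ge_sup; first by case: hs.
  by move=> _ [i _ <-]; apply: (le_trans (XS i)); rewrite lerD2l ler_wpM2l.
apply: (le_trans (Xs i0)); rewrite ler_pdivlMr ?subr_gt0//; lra.
Qed.

Lemma contraction_eq0 (I : Type) (s : I -> I) (X : I -> R) (kappa B : R) :
  0 <= kappa < 1 -> (forall i, 0 <= X i <= B) -> (forall i, X i <= kappa * X (s i)) ->
  forall i, X i = 0.
Proof.
move=> hk XB XS i; apply/eqP; rewrite eq_le; case/andP: (XB i) => -> _; rewrite andbT.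
have := @sup_contraction I s X kappa 0 B hk; rewrite mul0r; apply=> j.
  by case/andP: (XB j).
by rewrite add0r.
Qed.
End SupBound.

Section Good.
Variable R : realType.
Implicit Types (p q pt qt : int -> R).

Local Notation cst f := (fun n => (f n)%:P).

(** A kernel whose bonds inside a block are positive. The bond between two blocks,
    at b_k - m, may vanish. *)
Record good (a : int) (T : {poly R}) (cs : seq R) pt qt p q (F : int -> int -> {poly R})
  : Prop := Good {
  good_ker : kernel a (size cs).+1 'X T (dpoly T cs) (cst p) (cst q) (cst pt) (cst qt) F;
  good_p0 : forall n, 0 <= p n;
  good_p : forall k i, (i < size cs)%N -> 0 < p (site a (size cs).+1 k - i%:Z) }.

(** The Weyl value at the critical point c, read off from the kernel. *)
Definition Wof (a : int) (d : nat) p (F : int -> int -> {poly R}) (k : int) (c : R) : R :=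
  - (p (site a d k) * (F k (site a d k - 1)).[c]).

Variables (T : {poly R}) (cs : seq R).
Hypothesis CT : critical T cs.
Local Notation m := (size cs).
Local Notation d := (size cs).+1.
Local Notation tau := (lead_coef T).
Variables (a : int) (pt qt : int -> R).
Local Notation b := (site a d).

Section One.
Variables (p q : int -> R) (F : int -> int -> {poly R}).
Hypothesis GF : good a T cs pt qt p q F.
Let KF := good_ker GF.
Local Notation W := (Wof a d p F).
Local Notation L k i := (F k (b k - i%:Z)).

Lemma dpoly_root c : c \in cs -> (dpoly T cs).[c] = 0.
Proof. by move=> hc; rewrite /dpoly hornerZ (nodal_root (crit_uniq CT) hc) mulr0. Qed.

(** At c both columns solve the same second-order recurrence in the block and
    vanish at b_k, hence they are proportional; the ratio is read at b_k - 1. *)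
Lemma good_ratio k c i : c \in cs -> (i <= m)%N ->
  W k c * (F (k - 1) (b k - i%:Z)).[c] = - pt k * (L k i).[c].
Proof.
move=> hc; have m0 := crit_nil CT.
have pb k' : 0 < p (b k') by have := good_p GF k' m0; rewrite subr0.
suff: forall j, (j < m)%N ->
   W k c * (F (k - 1) (b k - j%:Z)).[c] = - pt k * (L k j).[c] /\
   W k c * (F (k - 1) (b k - j.+1%:Z)).[c] = - pt k * (L k j.+1).[c].
  move=> H; rewrite leq_eqVlt => /orP[/eqP->|im]; last by have [] := H i im.
  by have [] := H m.-1; rewrite ?prednK.
elim=> [|j IH] jm.
  split.
    rewrite subr0 (ker_lat KF); have := ker_latp KF (k - 1); rewrite subrK => ->.
    by rewrite horner0 dpoly_root// !mulr0.
  apply: (mulfI (lt0r_neq0 (pb k))).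
  have := ker_left KF k => /(congr1 (horner^~ c)); rewrite hornerM !hornerC => E.
  rewrite mulrCA -[b k - 1%:Z]/(b k - 1) E /Wof; ring.
have [IH1 IH2] := IH (ltnW jm); split => //.
have pj : p (b k - j.+1%:Z) != 0 by apply/lt0r_neq0/(good_p GF).
apply: (mulfI pj).
have hj : (0 < j.+1 < d)%N by rewrite /= ltnS ltnW.
have e2 : b k - j.+1%:Z + 1 = b k - j%:Z by lia.
have e1 : b k - j.+1%:Z - 1 = b k - j.+2%:Z by lia.
have := ker_in KF k hj; rewrite /= e1 e2 => /(congr1 (horner^~ c)).
rewrite !(hornerD, hornerM, hornerC, hornerX) => E1.
have := ker_inr KF k hj; rewrite /= e1 e2 => /(congr1 (horner^~ c)).
rewrite !(hornerD, hornerM, hornerC, hornerX) => E2.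
have -> : p (b k - j.+1%:Z) * (W k c * (F (k - 1) (b k - j.+2%:Z)).[c]) =
  W k c * (c * (F (k - 1) (b k - j.+1%:Z)).[c] - q (b k - j.+1%:Z) * (F (k - 1) (b k - j.+1%:Z)).[c]
    - p (b k - j%:Z) * (F (k - 1) (b k - j%:Z)).[c]) by rewrite E2; ring.
have -> : p (b k - j.+1%:Z) * (- pt k * (L k j.+2).[c]) =
  - pt k * (c * (L k j.+1).[c] - q (b k - j.+1%:Z) * (L k j.+1).[c]
    - p (b k - j%:Z) * (L k j).[c]) by rewrite E1; ring.
rewrite !mulrBr ![W k c * (_ * _)]mulrCA IH1 IH2; ring.
Qed.

Lemma good_Wrec k c : c \in cs -> W (k + 1) c != 0 ->
  W k c = T.[c] - qt k - pt (k + 1) ^+ 2 / W (k + 1) c.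
Proof.
move=> hc W0; have := ker_diag KF k => /(congr1 (horner^~ c)).
rewrite !(hornerD, hornerM, hornerC, hornerX, hornerN) dpoly_root// !mulr0 addr0.
have := good_ratio (k + 1) hc (leqnn m); rewrite addrK.
have -> : b (k + 1) - m%:Z = b k + 1 by rewrite siteD1; lia.
have := ker_right KF k => /(congr1 (horner^~ c)); rewrite hornerM !hornerC => E1 E2 E3.
have -> : pt (k + 1) ^+ 2 / W (k + 1) c = - (p (b k + 1) * (F k (b k + 1)).[c]).
  apply: (mulIf W0); rewrite divfK//.
  transitivity (- (p (b k + 1) * (W (k + 1) c * (F k (b k + 1)).[c]))); last by ring.
  by rewrite E2 -E1; ring.
rewrite opprK; apply: (addIr (- W k c)); rewrite subrr [LHS]E3 /Wof; ring.
Qed.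

(** If it vanished then so would, going upwards by the recurrence, the whole
    column, in contradiction with its value at b_k. *)
Lemma good_size_neq0 k : L k m != 0.
Proof.
apply/eqP => L0.
have: forall j, (j <= m)%N -> L k (m - j) = 0 /\ L k (m - j).+1 = 0.
  elim=> [|j IH] jm.
    by rewrite subn0 L0 -siteB1 (ker_latm KF).
  have [E1 E2] := IH (ltnW jm).
  have e : (m - j = (m - j.+1).+1)%N by lia.
  split; last by rewrite -e.
  have hj : (0 < (m - j.+1).+1 < d)%N by lia.
  have pj : p (b k - (m - j.+1)%N%:Z) != 0 by apply/lt0r_neq0/(good_p GF); lia.
  have := ker_in KF k hj; rewrite /=.
  have -> : b k - (m - j.+1).+1%:Z + 1 = b k - (m - j.+1)%N%:Z by lia.
  have -> : b k - (m - j.+1).+1%:Z - 1 = b k - (m - j).+1%:Z by lia.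
  rewrite -e E1 E2 !mulr0 !add0r => /esym/eqP.
  by rewrite mulf_eq0 polyC_eq0 (negPf pj) => /eqP.
move=> /(_ m (leqnn m)) [+ _]; rewrite subnn subr0 (ker_lat KF) => /eqP.
by rewrite /dpoly scaler_eq0 (negPf (lt0r_neq0 (crit_lead CT))) (negPf (monic_neq0 (monic_nodal _))).
Qed.

(** Going upwards from b_k - d, where the column vanishes, every step of the
    recurrence raises the degree by one. *)
Lemma good_size_lead k i : (i <= m)%N ->
  size (L k i) = (d - i)%N /\
  ((0 < i)%N -> lead_coef (L k i) = p (b k - i.-1%:Z) * lead_coef (L k i.-1)).
Proof.
have step j : (j < m)%N -> (size (L k j.+2) < (size (L k j.+1)))%N ->
   size (L k j) = (size (L k j.+1)).+1 /\
   lead_coef (L k j.+1) = p (b k - j%:Z) * lead_coef (L k j).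
  move=> jm lt; have pj : 0 < p (b k - j%:Z) by apply: (good_p GF).
  have hj : (0 < j.+1 < d)%N by lia.
  have := ker_in KF k hj; rewrite /=.
  have -> : b k - j.+1%:Z + 1 = b k - j%:Z by lia.
  have -> : b k - j.+1%:Z - 1 = b k - j.+2%:Z by lia.
  rewrite !mul_polyC => E; have L0 : L k j.+1 != 0 by rewrite -size_poly_gt0; lia.
  have : p (b k - j%:Z) *: L k j = 'X * L k j.+1
     + (- q (b k - j.+1%:Z) *: L k j.+1 - p (b k - j.+1%:Z) *: L k j.+2).
    by rewrite E scaleNr; ring.
  have sX : size ('X * L k j.+1) = (size (L k j.+1)).+1 by rewrite mulrC size_mulX.
  have lt2 : (size (- q (b k - j.+1%:Z) *: L k j.+1 - p (b k - j.+1%:Z) *: L k j.+2)%R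
              < size ('X * L k j.+1)%R)%N.
    rewrite sX ltnS (leq_trans (size_polyD _ _))// geq_max size_polyN.
    rewrite size_scale_leq (leq_trans (size_scale_leq _ _))//; exact: ltnW.
  move=> E2; split.
    rewrite -(size_scale (L k j) (lt0r_neq0 pj)) E2 size_polyDl//.
  by rewrite -lead_coefZ E2 lead_coefDl// mulrC lead_coef_Mmonic ?monicX.
have sz j : (j <= m)%N -> size (L k (m - j)) = (size (L k m) + j)%N /\
     (size (L k (m - j).+1) < size (L k (m - j)))%N.
  elim: j => [|j IH] jm.
    by rewrite subn0 addn0 -siteB1 (ker_latm KF) size_poly0 size_poly_gt0 good_size_neq0.
  have [I1 I2] := IH (ltnW jm).
  have e : (m - j = (m - j.+1).+1)%N by lia.
  have lt1 : (m - j.+1 < m)%N by lia.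
  have := step _ lt1; rewrite -e => /(_ I2)[E _].
  by rewrite E I1; split; lia.
have sm : size (L k m) = 1%N.
  have [+ _] := sz m (leqnn m); rewrite subnn subr0 (ker_lat KF) /dpoly.
  rewrite size_scale ?size_nodal ?(lt0r_neq0 (crit_lead CT))//; lia.
move=> im; split; first by have [] := sz (m - i)%N (leq_subr _ _); rewrite subKn// sm => ->; lia.
case: i im => // j jm _ /=.
have [_] := sz (m - j.+1)%N (leq_subr _ _); rewrite subKn// => lt1.
by have [] := step j jm lt1.
Qed.

Lemma good_size k i : (i <= m)%N -> size (L k i) = (d - i)%N.
Proof. by move=> im; have [] := good_size_lead k im. Qed.

Lemma good_lead k i : (i < m)%N ->
  lead_coef (L k i.+1) = p (b k - i%:Z) * lead_coef (L k i).
Proof. by move=> im; have [_] := good_size_lead k im; apply. Qed.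

Lemma good_lead_gt0 k i : (i <= m)%N -> 0 < lead_coef (L k i).
Proof.
elim: i => [|i IH] im; last by rewrite good_lead// mulr_gt0 ?IH 1?ltnW// (good_p GF).
rewrite subr0 (ker_lat KF) /dpoly lead_coefZ; have /monicP -> := monic_nodal cs.
by rewrite mulr1 (crit_lead CT).
Qed.

Lemma good_rsize k i : (i <= m)%N -> (size (F (k - 1) (b k - i%:Z)) <= i)%N.
Proof.
have m0 := crit_nil CT.
suff: forall j, (j < m)%N -> (size (F (k - 1) (b k - j%:Z)) <= j)%N /\
    (size (F (k - 1) (b k - j.+1%:Z)) <= j.+1)%N.
  move=> H; rewrite leq_eqVlt => /orP[/eqP->|im]; last by have [] := H i im.
  by have [] := H m.-1; rewrite ?prednK.
elim=> [|j IH] jm.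
  split.
    by rewrite subr0; have := ker_latp KF (k - 1); rewrite subrK => ->; rewrite size_poly0.
  have pb : 0 < p (b k) by have := good_p GF k m0; rewrite subr0.
  have := ker_left KF k; rewrite mul_polyC => E.
  by rewrite -[b k - 1%:Z]/(b k - 1) -(size_scale _ (lt0r_neq0 pb)) E size_polyC_leq1.
have [I1 I2] := IH (ltnW jm); split => //.
have pj : 0 < p (b k - j.+1%:Z) by apply: (good_p GF).
have hj : (0 < j.+1 < d)%N by lia.
have := ker_inr KF k hj; rewrite /=.
have -> : b k - j.+1%:Z + 1 = b k - j%:Z by lia.
have -> : b k - j.+1%:Z - 1 = b k - j.+2%:Z by lia.
rewrite !mul_polyC => E.
rewrite -(size_scale _ (lt0r_neq0 pj)).
have -> : p (b k - j.+1%:Z) *: F (k - 1) (b k - j.+2%:Z) = 'X * F (k - 1) (b k - j.+1%:Z)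
  - q (b k - j.+1%:Z) *: F (k - 1) (b k - j.+1%:Z) - p (b k - j%:Z) *: F (k - 1) (b k - j%:Z).
  by rewrite E; ring.
rewrite (leq_trans (size_polyD _ _))// geq_max size_polyN; apply/andP; split.
  rewrite (leq_trans (size_polyD _ _))// geq_max size_polyN; apply/andP; split.
    by rewrite (leq_trans (size_polyMleq _ _))// size_polyX.
  by rewrite (leq_trans (size_scale_leq _ _))// ltnW.
by rewrite (leq_trans (size_scale_leq _ _)) ?(leq_trans I1)// -addn2 leq_addr.
Qed.

(** Lagrange interpolation: the degree is below the number of nodes. *)
Lemma good_rho k : p (b k) *: L k 1 = \sum_(c <- cs) (- W k c / (lpoly cs c).[c]) *: lpoly cs c.
Proof.
have m0 := crit_nil CT.
rewrite {1}(lagrange (crit_uniq CT) (f := p (b k) *: L k 1)).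
  by apply: eq_bigr => c _; rewrite hornerZ /Wof opprK.
by rewrite (leq_trans (size_scale_leq _ _))// good_size ?subSS ?subn0.
Qed.

End One.

(** Euclidean division: the column at b_k is T'/d and the one at b_k - 1 is
    determined up to p by the values W. The recurrence is then the Euclidean
    algorithm for these two polynomials, and degrees and leading coefficients
    determine p > 0 and q at each step. *)
Lemma good_unique p q F p' q' F' :
  good a T cs pt qt p q F -> good a T cs pt qt p' q' F' ->
  (forall k c, c \in cs -> Wof a d p F k c = Wof a d p' F' k c) ->
  p =1 p' /\ q =1 q'.
Proof.
move=> G G' WW; have m0 := crit_nil CT.
have K := good_ker G; have K' := good_ker G'.
have main k i : (i < m)%N ->
  [/\ F k (b k - i%:Z) = F' k (b k - i%:Z),
      F k (b k - i.+1%:Z) = F' k (b k - i.+1%:Z),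
      p (b k - i%:Z) = p' (b k - i%:Z),
      q (b k - i.+1%:Z) = q' (b k - i.+1%:Z) &
      p (b k - i.+1%:Z) *: F k (b k - i.+2%:Z) = p' (b k - i.+1%:Z) *: F' k (b k - i.+2%:Z)].
  have step j : (j < m)%N -> F k (b k - j%:Z) = F' k (b k - j%:Z) ->
    p (b k - j%:Z) *: F k (b k - j.+1%:Z) = p' (b k - j%:Z) *: F' k (b k - j.+1%:Z) ->
    [/\ F k (b k - j%:Z) = F' k (b k - j%:Z), F k (b k - j.+1%:Z) = F' k (b k - j.+1%:Z),
      p (b k - j%:Z) = p' (b k - j%:Z),
      q (b k - j.+1%:Z) = q' (b k - j.+1%:Z) &
      p (b k - j.+1%:Z) *: F k (b k - j.+2%:Z) = p' (b k - j.+1%:Z) *: F' k (b k - j.+2%:Z)].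
    move=> jm E0 E1.
    have pj := good_p G k jm; have pj' := good_p G' k jm.
    have l0 := good_lead_gt0 G k (ltnW jm).
    have Ep : p (b k - j%:Z) = p' (b k - j%:Z).
      have := congr1 lead_coef E1; rewrite !lead_coefZ (good_lead G)// (good_lead G')// -E0.
      rewrite !mulrA => /(mulIf (lt0r_neq0 l0))/eqP.
      by rewrite -!expr2 eqrXn2// ?ltW// => /eqP.
    have E2 : F k (b k - j.+1%:Z) = F' k (b k - j.+1%:Z).
      by move: E1; rewrite -Ep => /(scalerI (lt0r_neq0 pj)).
    have hj : (0 < j.+1 < d)%N by lia.
    have e2 : b k - j.+1%:Z + 1 = b k - j%:Z by lia.
    have e1 : b k - j.+1%:Z - 1 = b k - j.+2%:Z by lia.
    have := ker_in K k hj; rewrite /= e1 e2 !mul_polyC => R1.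
    have := ker_in K' k hj; rewrite /= e1 e2 !mul_polyC -E2 -E0 -Ep => R2.
    have R3 : p (b k - j.+1%:Z) *: F k (b k - j.+2%:Z) + q (b k - j.+1%:Z) *: F k (b k - j.+1%:Z) =
      p' (b k - j.+1%:Z) *: F' k (b k - j.+2%:Z) + q' (b k - j.+1%:Z) *: F k (b k - j.+1%:Z).
      by move: R1; rewrite R2 => /addIr ->.
    have small p1 q1 F1 : good a T cs pt qt p1 q1 F1 -> (F1 k (b k - j.+2%:Z))`_(m - j.+1) = 0.
      move=> G1; rewrite nth_default//.
      move: (jm); rewrite leq_eqVlt => /orP[/eqP e|jm1].
        have -> : j.+2 = d by rewrite e.
        by rewrite -siteB1 (ker_latm (good_ker G1)) size_poly0.
      by rewrite (good_size G1)//; lia.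
    have Eq : q (b k - j.+1%:Z) = q' (b k - j.+1%:Z).
      have := congr1 (fun f : {poly R} => f`_(m - j.+1)) R3.
      rewrite /= !coefD !coefZ (small _ _ _ G) (small _ _ _ G') !mulr0 !add0r.
      have := good_lead_gt0 G k jm; rewrite /lead_coef (good_size G)//.
      have -> : (d - j.+1).-1 = (m - j.+1)%N by lia.
      by move=> l1 /(mulIf (lt0r_neq0 l1)).
    by split => //; move: R3; rewrite Eq => /addIr.
  elim: i => [|i IH] im.
    apply: step => //; first by rewrite subr0 (ker_lat K) (ker_lat K').
    rewrite subr0 (good_rho G) (good_rho G') big_seq [RHS]big_seq.
    by apply: eq_bigr => c hc; rewrite WW.
  by have [_ h1 _ _ h2] := IH (ltnW im); apply: step.
have pq k i : (i < d)%N -> p (b k - i%:Z) = p' (b k - i%:Z) /\ q (b k - i%:Z) = q' (b k - i%:Z).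
  move=> id; split.
    move: id; rewrite ltnS leq_eqVlt => /orP[/eqP->|/(main k)[]//].
    have m1 : (m.-1 < m)%N by rewrite prednK.
    have [_ + _ _ _] := main k m.-1 m1; rewrite prednK// => E.
    have := ker_right K (k - 1); have := ker_right K' (k - 1); rewrite !subrK.
    have -> : b (k - 1) + 1 = b k - m%:Z by rewrite siteB1; lia.
    by rewrite -E => <- /(mulIf (good_size_neq0 G k))/polyC_inj ->.
  case: i id => [_|i im]; last by have [] := main k i.
  rewrite subr0.
  have qform p1 q1 F1 : good a T cs pt qt p1 q1 F1 ->
     q1 (b k) * (dpoly T cs)`_m = ('X * dpoly T cs)`_m - T`_m.
    move=> G1; have := ker_diag (good_ker G1) k; rewrite !mul_polyC => ->.
    rewrite !coefD coefN !coefZ coefC [(F1 k (b k - 1))`_m]nth_default; last first.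
      by rewrite -[b k - 1]/(b k - 1%:Z) (good_size G1) ?subSS ?subn0.
    have -> : (F1 k (b k + 1))`_m = 0.
      rewrite nth_default//.
      have := good_rsize G1 (k + 1) (leqnn m); rewrite addrK.
      by have -> : b (k + 1) - m%:Z = b k + 1 by rewrite siteD1; lia.
    by case: (m) m0 => // ? _ /=; ring.
  have dm : (dpoly T cs)`_m != 0.
    have := monic_nodal cs => /monicP; rewrite /lead_coef size_nodal /dpoly coefZ => ->.
    by rewrite mulr1 (lt0r_neq0 (crit_lead CT)).
  by apply: (mulIf dm); rewrite (qform _ _ _ G) (qform _ _ _ G').
by split=> n; have [k [i [id ->]]] := @siteP a d n isT; have [] := pq k i id.
Qed.

End Good.

(** * Large critical values and composition *)

Section Big.
Variable R : realType.
Implicit Types (p q pt qt : int -> R).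
Local Notation cst f := (fun n => (f n)%:P).

(** This selects the solution of the Weyl recursion along which that recursion
    contracts. *)
Definition bigW a (cs : seq R) p F :=
  forall k c, c \in cs -> 1 <= `|Wof a (size cs).+1 p F k c|.
Definition unitdata pt qt := forall k : int, `|pt k| <= 1 /\ `|qt k| <= 1.

Variables (T : {poly R}) (cs : seq R).
Hypothesis CT : critical T cs.
Local Notation m := (size cs).
Local Notation d := (size cs).+1.
Local Notation tau := (lead_coef T).
Hypothesis T4 : forall c, c \in cs -> 4 <= `|T.[c]|.
Variables (a : int) (pt qt : int -> R).
Local Notation b := (site a d).
Hypothesis ud : unitdata pt qt.

Section One.
Variables (p q : int -> R) (F : int -> int -> {poly R}).
Hypothesis GF : good a T cs pt qt p q F.
Hypothesis BF : bigW a cs p F.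
Local Notation W := (Wof a d p F).

Lemma bigW_neq0 k c : c \in cs -> W k c != 0.
Proof. by move=> hc; have := BF k hc; apply: contraTneq => ->; rewrite normr0 -ltNge ltr01. Qed.

Lemma bigWrec k c : c \in cs -> W k c = T.[c] - qt k - pt (k + 1) ^+ 2 / W (k + 1) c.
Proof. by move=> hc; apply: (good_Wrec CT GF hc); apply: bigW_neq0. Qed.

Lemma bigW_close k c : c \in cs -> `|W k c - T.[c]| <= 2.
Proof.
move=> hc; rewrite bigWrec//; have [p1 _] := ud (k + 1); have [_ q1] := ud k.
have -> : T.[c] - qt k - pt (k + 1) ^+ 2 / W (k + 1) c - T.[c]
  = - qt k - pt (k + 1) ^+ 2 / W (k + 1) c by ring.
rewrite (le_trans (ler_normB _ _))// normrN normrM normfV normrX.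
have w1 := BF (k + 1) hc.
have : `|pt (k + 1)| ^+ 2 / `|W (k + 1) c| <= 1.
  rewrite ler_pdivrMr ?(lt_le_trans ltr01)// mul1r (le_trans _ w1)//.
  by rewrite exprn_ile1.
move: q1; lra.
Qed.

Lemma bigW_ge k c : c \in cs -> `|T.[c]| - 2 <= `|W k c|.
Proof.
move=> hc; have := bigW_close k hc.
have := lerB_dist T.[c] (W k c); rewrite distrC; lra.
Qed.

Lemma bigW_le k c : c \in cs -> `|W k c| <= `|T.[c]| + 2.
Proof.
move=> hc; have := bigW_close k hc.
have := lerB_dist (W k c) T.[c]; lra.
Qed.

Lemma bigW_sgn k c : c \in cs -> 0 < W k c * T.[c].
Proof.
move=> hc; have := bigW_close k hc; have := T4 hc; rewrite ler_norml.
rewrite real_ler_normr ?num_real// => /orP[h|h] /andP[h1 h2].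
  by apply: mulr_gt0; lra.
by rewrite -mulrNN; apply: mulr_gt0; lra.
Qed.

Definition mu k c : R := - W k c / (lpoly cs c).[c].

Lemma mu_gt0 k c : c \in cs -> 0 < mu k c.
Proof.
move=> hc; have s1 := bigW_sgn k hc; have s2 := crit_sgn CT hc.
have l0 := lpoly_neq0 cs c.
have T0 : 0 < T.[c] ^+ 2.
  by rewrite exprn_even_gt0//=; apply/eqP => T0; move: s1; rewrite T0 mulr0 ltxx.
have l2 : 0 < (lpoly cs c).[c] ^+ 2 by rewrite exprn_even_gt0.
have -> : mu k c = (W k c * T.[c]) * (- (T.[c] * (lpoly cs c).[c]))
    / (T.[c] ^+ 2 * (lpoly cs c).[c] ^+ 2).
  have Tc0 : T.[c] != 0 by apply: contraTneq T0 => ->; rewrite expr0n ltxx.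
  by rewrite /mu; field; rewrite ?Tc0 ?l0.
apply: divr_gt0; last exact: mulr_gt0.
by apply: mulr_gt0 => //; rewrite oppr_gt0.
Qed.

(** Compare the coefficients of degree m - 1 in [good_rho]. *)
Lemma mu_sum k : \sum_(c <- cs) mu k c = p (b k) ^+ 2 * tau.
Proof.
have m0 := crit_nil CT.
have := congr1 (fun f : {poly R} => f`_m.-1) (good_rho CT GF k).
rewrite /= coef_lsum//; last exact: crit_uniq CT.
move=> <-; rewrite coefZ.
have := good_lead CT GF k m0; rewrite /lead_coef (good_size CT GF)//.
rewrite subSS subn0 subr0 => ->; rewrite (ker_lat (good_ker GF)).
have -> : (dpoly T cs)`_(size (dpoly T cs)).-1 = tau.
  rewrite -/(lead_coef _) /dpoly lead_coefZ; have /monicP-> := monic_nodal cs.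
  by rewrite mulr1.
by rewrite mulrA expr2.
Qed.

Hypothesis p1 : forall n, p n <= 1.

(** The mu_c have sum at most lead T because p <= 1, and mu_c >= 1 / |l_c(c)| because
    |W| >= 1. The coefficient 1 of X^(m-1) in its own Lagrange formula is at most
    the sum of the 1 / |l_c(c)|. *)
Lemma tau_ge1 : 1 <= tau.
Proof.
have m0 := crit_nil CT; have t0 := crit_lead CT.
have S1 : \sum_(c <- cs) mu 0 c <= tau.
  rewrite mu_sum ler_piMl ?(ltW t0)//; apply: exprn_ile1 => //; exact: (good_p0 GF).
apply: le_trans S1.
have := lagrange (crit_uniq CT) (f := 'X^(m.-1)); rewrite size_polyXn prednK// => /(_ (leqnn _)).
move/(congr1 (fun f : {poly R} => f`_m.-1)); rewrite coef_lsum//; last exact: crit_uniq CT.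
rewrite coefXn eqxx mulr1n => ->.
rewrite big_seq [leRHS]big_seq; apply: ler_sum => c hc.
rewrite -(ger0_norm (ltW (mu_gt0 0 hc))) (le_trans (ler_norm _))//.
rewrite hornerXn /mu !normrM normfV normrN ler_wpM2r ?invr_ge0//.
by apply: (le_trans _ (BF 0 hc)); rewrite normrX exprn_ile1// (crit_in CT).
Qed.

(** By [good_rho] the left side is the sum of mu_c * nodal(w) / (w - c), with positive
    mu_c of sum at most lead T, and |w - c| >= |w| - 1. *)
Lemma rho_bound k w : 1 < `|w| ->
  `|(p (b k) *: F k (b k - 1)).[w]| <= `|(dpoly T cs).[w]| / (`|w| - 1).
Proof.
move=> w1; rewrite -[b k - 1]/(b k - 1%:Z) (good_rho CT GF) horner_sum.
apply: (le_trans (ler_norm_sum _ _ _)).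
have S1 : \sum_(c <- cs) mu k c <= tau.
  rewrite mu_sum ler_piMl ?(ltW (crit_lead CT))//; apply: exprn_ile1 => //; exact: (good_p0 GF).
apply: (@le_trans _ _ (\sum_(c <- cs) mu k c * (`|(nodal cs).[w]| / (`|w| - 1)))).
  rewrite big_seq [leRHS]big_seq; apply: ler_sum => c hc.
  rewrite hornerZ normrM -/(mu k c) (ger0_norm (ltW (mu_gt0 k hc))).
  rewrite ler_wpM2l ?(ltW (mu_gt0 k hc))//.
  rewrite (nodal_lpoly (crit_uniq CT) hc) hornerM hornerXsubC normrM.
  rewrite ler_pdivlMr ?subr_gt0// mulrC ler_wpM2r//.
  have := crit_in CT hc; have := lerB_dist w c; lra.
rewrite -mulr_suml /dpoly hornerZ normrM (ger0_norm (ltW (crit_lead CT))) -mulrA.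
by apply: ler_wpM2r => //; rewrite mulr_ge0// invr_ge0 subr_ge0 ltW.
Qed.

Lemma dpoly_ge w : 4 <= `|w| -> 3 <= `|(dpoly T cs).[w]|.
Proof.
move=> w4; have t1 := tau_ge1; rewrite /dpoly hornerZ normrM.
rewrite (ger0_norm (ltW (crit_lead CT))) /nodal horner_prod normr_prod.
have m0 := crit_nil CT; have hin := crit_in CT.
have : 3 <= \prod_(c <- cs) `|('X - c%:P).[w]|.
  elim: cs m0 hin => // c s IH _ hin.
  rewrite big_cons; have c3 : 3 <= `|('X - c%:P).[w]|.
    rewrite hornerXsubC; have := hin c (mem_head _ _); have := lerB_dist w c; lra.
  case: s IH hin => [|e s] IH hin; first by rewrite big_nil mulr1.
  have := IH isT (fun x hx => hin x (mem_behead (s := c :: _) hx)) => H.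
  by apply: (le_trans c3); rewrite ler_peMr//; lra.
move=> h; rewrite (le_trans h)// ler_peMl//; lra.
Qed.

End One.

(** Differences of two solutions of the Weyl recursion contract from k + 1 to k,
    so the values W agree and [good_unique] applies. *)
Theorem good_unique_big p q F p' q' F' :
  good a T cs pt qt p q F -> good a T cs pt qt p' q' F' ->
  bigW a cs p F -> bigW a cs p' F' -> p =1 p' /\ q =1 q'.
Proof.
move=> G G' B B'; apply: (good_unique CT G G') => k c hc.
apply/eqP; rewrite -subr_eq0 -normr_eq0; apply/eqP.
pose X k := `|Wof a d p F k c - Wof a d p' F' k c|.
apply: (@contraction_eq0 R int (fun k => k + 1) X (1 / 4) (2 * (`|T.[c]| + 2))).
- by apply/andP; split; lra.
- move=> i; rewrite normr_ge0 /= (le_trans (ler_normB _ _))//.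
  have := bigW_le G B i hc; have := bigW_le G' B' i hc; lra.
move=> i; rewrite /X (bigWrec G B)// (bigWrec G' B')//.
set w := Wof a d p F _ c; set w' := Wof a d p' F' _ c.
have w0 : w != 0 by apply: bigW_neq0.
have w'0 : w' != 0 by apply: bigW_neq0.
have -> : T.[c] - qt i - pt (i + 1) ^+ 2 / w - (T.[c] - qt i - pt (i + 1) ^+ 2 / w')
  = pt (i + 1) ^+ 2 / (w * w') * (w - w') by field; rewrite w0 w'0.
rewrite normrM ler_wpM2r// normrM normfV [`|w * w'|]normrM normrX.
have w2 : 2 <= `|w| by have := bigW_ge G B (i + 1) hc; have := T4 hc; rewrite -/w; lra.
have w'2 : 2 <= `|w'| by have := bigW_ge G' B' (i + 1) hc; have := T4 hc; rewrite -/w'; lra.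
have [p1 _] := ud (i + 1).
have ww : 4 <= `|w| * `|w'| by nra.
rewrite ler_pdivrMr; last by lra.
have : `|pt (i + 1)| ^+ 2 <= 1 by apply: exprn_ile1.
by move=> h; apply: (le_trans h); lra.
Qed.

End Big.

Section Compose.
Variable R : realType.
Variables (T1 T2 : {poly R}) (cs1 cs2 cs : seq R).
Hypotheses (C1 : critical T1 cs1) (C2 : critical T2 cs2) (CT : critical (T2 \Po T1) cs).
Local Notation T := (T2 \Po T1).
Local Notation m := (size cs).
Local Notation d := (size cs).+1.
Local Notation d1 := (size cs1).+1.
Local Notation d2 := (size cs2).+1.

Lemma comp_deg : d = (d2 * d1)%N.
Proof.
have := size_comp_poly T2 T1; rewrite (crit_size CT) (crit_size C1) (crit_size C2) /=.
by move=> [->].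
Qed.

Lemma dpolyE (U : {poly R}) us : critical U us -> U^`() = (size us).+1%:R *: dpoly U us.
Proof. by move=> C; rewrite (crit_deriv C) /dpoly scalerA mulrC. Qed.

Lemma comp_dpoly : dpoly T cs = (dpoly T2 cs2 \Po T1) * dpoly T1 cs1.
Proof.
have d0 : d%:R != 0 :> R by rewrite pnatr_eq0.
apply: (scalerI d0); rewrite -(dpolyE CT) deriv_comp (dpolyE C1) (dpolyE C2).
rewrite comp_polyZ -scalerAr -scalerAl scalerA; congr (_ *: _).
by rewrite comp_deg natrM mulrC.
Qed.

Variables (a0 a1 : int) (pt qt p' q' p q : int -> R) (F1 F2 : int -> int -> {poly R}).
Hypothesis G1 : good a0 T1 cs1 p' q' p q F1.
Hypothesis G2 : good a1 T2 cs2 pt qt p' q' F2.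
Local Notation a := (a0 + d1%:Z * a1).
Local Notation b := (site a d).
Local Notation b1 := (site a0 d1).
Local Notation b2 := (site a1 d2).

(** (Phi1 applied to the column k of Phi2) with T1 substituted in Phi2. *)
Definition compF (k n : int) : {poly R} := kext a0 d1 F1 (fun j => F2 k j \Po T1) n.

Let K1 := good_ker G1.
Let K2 := good_ker G2.
Let d1_gt1 : (1 < d1)%N. Proof. by rewrite ltnS (crit_nil C1). Qed.

Lemma comp_site k : b k = b1 (b2 k).
Proof. by rewrite /site comp_deg PoszM; ring. Qed.

Lemma comp_siteB k i : b k - i%:Z = b1 (b2 k - (i %/ d1)%N%:Z) - (i %% d1)%N%:Z.
Proof.
rewrite comp_site {1}(divn_eq i d1) PoszD PoszM /site; ring.
Qed.

Lemma compF_left k k' : compF k (b k' - 1) =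
   F1 (b2 k') (b1 (b2 k') - 1) * (F2 k (b2 k') \Po T1)
   + F1 (b2 k' - 1) (b1 (b2 k') - 1) * (F2 k (b2 k' - 1) \Po T1).
Proof.
by rewrite /compF comp_site -[b1 _ - 1]/(b1 (b2 k') - 1%:Z) (kext_site d1_gt1 K1) 1?ltnW.
Qed.

Lemma compF_right k k' : compF k (b k' + 1) =
   F1 (b2 k' + 1) (b1 (b2 k') + 1) * (F2 k (b2 k' + 1) \Po T1)
   + F1 (b2 k') (b1 (b2 k') + 1) * (F2 k (b2 k') \Po T1).
Proof.
have e : b1 (b2 k') + 1 = b1 (b2 k' + 1) - (size cs1)%:Z by rewrite siteD1; lia.
by rewrite /compF comp_site e (kext_site d1_gt1 K1) 1?ltnW// addrK.
Qed.

Lemma comp_in k k' i : (0 < i < d)%N -> let n := b k' - i%:Z in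
   (k' = k \/ k' - 1 = k) ->
   'X * compF k n = (p n)%:P * compF k (n - 1) + (q n)%:P * compF k n
     + (p (n + 1))%:P * compF k (n + 1).
Proof.
move=> /andP[i0 id] n kk.
have jd : (i %/ d1 < d2)%N by rewrite ltn_divLR// -comp_deg.
have id1 : (i %% d1 < d1)%N by rewrite ltn_mod.
rewrite /n comp_siteB; case: (posnP (i %% d1)) => [i0'|i0']; last first.
  by apply: (kext_in d1_gt1 K1); rewrite i0'.
have j0 : (0 < i %/ d1)%N.
  by rewrite lt0n; apply: contraTneq i0 => j0; rewrite (divn_eq i d1) i0' j0.
rewrite i0' subr0; set l := b2 k' - _.
rewrite {1}/compF (kext_diag d1_gt1 K1) -/(compF _ _).
suff -> : T1 * (F2 k l \Po T1) - ((p' l)%:P * (F2 k (l - 1) \Po T1) +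
   (q' l)%:P * (F2 k l \Po T1) + (p' (l + 1))%:P * (F2 k (l + 1) \Po T1)) = 0.
  by rewrite addr0.
have hj : (0 < i %/ d1 < d2)%N by rewrite j0.
have E : 'X * F2 k l = (p' l)%:P * F2 k (l - 1) + (q' l)%:P * F2 k l + (p' (l + 1))%:P * F2 k (l + 1).
  by case: kk => <-; [exact: (ker_in K2 k' hj)|exact: (ker_inr K2 k' hj)].
move/(congr1 (comp_poly T1)): E.
rewrite !(rmorphM, rmorphD) /= comp_polyX !comp_polyC => ->.
by rewrite subrr.
Qed.

Lemma comp_kernel : kernel a d 'X T (dpoly T cs) (fun n => (p n)%:P) (fun n => (q n)%:P)
  (fun n => (pt n)%:P) (fun n => (qt n)%:P) compF.
Proof.
split => [k|k|k|k i hi|k i hi|k|k|k].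
- by rewrite /compF comp_site (kext_lat d1_gt1 K1) (ker_lat K2) comp_dpoly mulrC.
- by rewrite /compF comp_site (kext_lat d1_gt1 K1) (ker_latm K2) comp_poly0 mulr0.
- by rewrite /compF comp_site (kext_lat d1_gt1 K1) (ker_latp K2) comp_poly0 mulr0.
- by apply: comp_in => //; left.
- by apply: comp_in => //; right.
- have E0 : dpoly T cs = compF k (b k).
    by rewrite /compF comp_site (kext_lat d1_gt1 K1) (ker_lat K2) comp_dpoly mulrC.
  rewrite {1 2}E0 {1}/compF comp_site (kext_diag d1_gt1 K1) -/(compF _ _).
  congr (_ + _); have := ker_diag K2 k; rewrite -(ker_lat K2 k).
  move/(congr1 (comp_poly T1)).
  rewrite !(rmorphM, rmorphD, rmorphN) /= comp_polyX !comp_polyC => ->.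
  by ring.
- rewrite compF_left; have := ker_latp K2 (k - 1); rewrite subrK => ->.
  rewrite comp_poly0 mulr0 add0r comp_site mulrA (ker_left K1).
  have := ker_left K2 k => /(congr1 (comp_poly T1)).
  by rewrite rmorphM /= !comp_polyC.
rewrite compF_right; have := ker_latm K2 (k + 1); rewrite addrK => ->.
rewrite comp_poly0 mulr0 addr0 comp_site mulrA (ker_right K1).
have := ker_right K2 k => /(congr1 (comp_poly T1)).
by rewrite rmorphM /= !comp_polyC.
Qed.

(** Transport along two sublattices is transitive; the positive bonds of the
    composed block are those of the inner blocks and the bonds between them, the
    latter being positive by the compatibility with the middle matrix. *)
Lemma comp_good : good a T cs pt qt p q compF.
Proof.
split; [exact: comp_kernel|exact: good_p0 G1|].
move=> k i im; rewrite comp_siteB.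
have id1 : (i %% d1 < d1)%N by rewrite ltn_mod.
move: (id1); rewrite ltnS leq_eqVlt => /orP[/eqP e|]; last exact: (good_p G1).
rewrite e.
have jd : (i %/ d1 < size cs2)%N.
  have := divn_eq i d1; rewrite e; have := comp_deg.
  move: im; set j := (i %/ d1)%N; set x := size cs1; set y := size cs2 => im ed ei.
  nia.
set l := b2 k - _.
have pl : 0 < p' l by apply: (good_p G2).
have := ker_right K1 (l - 1); rewrite subrK.
have -> : b1 (l - 1) + 1 = b1 l - (size cs1)%:Z by rewrite siteB1; lia.
rewrite lt0r (good_p0 G1) andbT; move=> E; apply/eqP => p0.
by move: E; rewrite p0 mul0r => /esym/eqP; rewrite polyC_eq0 (negPf (lt0r_neq0 pl)).
Qed.

Hypothesis B1 : bigW a0 cs1 p F1.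
Hypothesis B2 : bigW a1 cs2 p' F2.
Hypothesis T14 : forall c, c \in cs1 -> 4 <= `|T1.[c]|.
Hypothesis T24 : forall c, c \in cs2 -> 4 <= `|T2.[c]|.
Hypotheses (ud : unitdata pt qt) (ud' : unitdata p' q').

(** A critical point c of T2 o T1 is either sent by T1 to a critical point of T2, and
    W is the Weyl value of T2 at T1(c), or critical for T1. In the second case
    |T1(c)| >= 4, W is W1 * D2(T1(c)) minus a correction, and [rho_bound] and
    |W1| >= 2 show that the product dominates. *)
Lemma comp_big : bigW a cs p compF.
Proof.
move=> k c hc; rewrite /Wof compF_left.
set l := b2 k.
have -> : - (p (b k) * (F1 l (b1 l - 1) * (F2 k l \Po T1) +
     F1 (l - 1) (b1 l - 1) * (F2 k (l - 1) \Po T1)).[c])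
  = Wof a0 d1 p F1 l c * (dpoly T2 cs2).[T1.[c]]
    - (p' l *: F2 k (l - 1)).[T1.[c]].
  rewrite !hornerD !hornerM !horner_comp /Wof /l (ker_lat K2) comp_site.
  have := ker_left K1 (b2 k) => /(congr1 (horner^~ c)); rewrite hornerM !hornerC => <-.
  by rewrite [X in _ = _ - X]hornerZ; ring.
have : (dpoly T cs).[c] = 0 by apply: (dpoly_root CT).
rewrite comp_dpoly hornerM horner_comp => /eqP; rewrite mulf_eq0.
have proot (U : {poly R}) us x : critical U us -> (dpoly U us).[x] == 0 -> x \in us.
  move=> CU; rewrite /dpoly hornerZ mulf_eq0 (negPf (lt0r_neq0 (crit_lead CU))) /=.
  by rewrite -/(root _ x) /nodal root_prod_XsubC.
have [h2 _|h2 /= h1] := eqVneq (dpoly T2 cs2).[T1.[c]] 0.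
  rewrite h2 mulr0 sub0r; have hc2 := proot _ _ _ C2 (introT eqP h2).
  by have := B2 k hc2; rewrite /Wof hornerZ.
have hc1 := proot _ _ _ C1 h1.
have p'1 n : p' n <= 1 by have [h _] := ud' n; apply: le_trans h; apply: ler_norm.
have w4 := T14 hc1.
have D3 := dpoly_ge C2 T24 ud G2 B2 p'1 w4.
have W2 : 2 <= `|Wof a0 d1 p F1 l c|.
  by have := bigW_ge C1 ud' G1 B1 l hc1; lra.
have := @rho_bound _ _ _ C2 T24 _ _ _ ud _ _ _ G2 B2 p'1 k T1.[c].
rewrite -/l => /(_ (lt_le_trans _ w4)) H.
have {}H : `|(p' l *: F2 k (l - 1)).[T1.[c]]| <= `|(dpoly T2 cs2).[T1.[c]]|.
  apply: (le_trans (H _)); first by rewrite ltr1n.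
  by rewrite ler_piMr// invf_le1; lra.
apply: le_trans (lerB_dist _ _); rewrite normrM.
have : 0 <= `|(dpoly T2 cs2).[T1.[c]]| * (`|Wof a0 d1 p F1 l c| - 2) by apply: mulr_ge0; lra.
lra.
Qed.

End Compose.

(** * Contraction *)

Section Perturb.
Variable R : realType.
Variable cs : seq R.
Hypothesis cs_uniq : uniq cs.
Local Notation m := (size cs).
Implicit Types (f g : {poly R}) (w : R -> R).

Lemma weighted_CS w f g : (forall c, c \in cs -> 0 < w c) ->
  (\sum_(c <- cs) w c * (`|f.[c]| * `|g.[c]|)) ^+ 2 <= ip cs w f f * ip cs w g g.
Proof.
move=> w0; set A := ip cs w f f; set C := ip cs w g g; set B := \sum_(c <- cs) _.
have Q t : 0 <= A - 2 * t * B + t ^+ 2 * C.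
  have -> : A - 2 * t * B + t ^+ 2 * C
    = \sum_(c <- cs) w c * (`|f.[c]| - t * `|g.[c]|) ^+ 2.
    rewrite /A /B /C /ip !mulr_sumr -sumrB -big_split /=; apply: eq_bigr => c _.
    have Ef := real_normK (num_real f.[c]); have Eg := real_normK (num_real g.[c]).
    by rewrite -!mulrA -!expr2 -Ef -Eg; ring.
  by rewrite big_seq; apply: sumr_ge0 => c hc; rewrite mulr_ge0 ?sqr_ge0// ltW// w0.
have C0 : 0 <= C by apply: ip_ge0.
move: C0; rewrite le_eqVlt => /orP[/eqP C0|C0]; last first.
  have := Q (B / C); rewrite -(ler_pM2r C0) mul0r.
  have -> : (A - 2 * (B / C) * B + (B / C) ^+ 2 * C) * C = A * C - B ^+ 2.
    by field; rewrite lt0r_neq0.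
  by rewrite subr_ge0.
have -> : B = 0; last by rewrite -C0 mulr0 expr0n.
have g0 := ip_eq0 cs_uniq w0 (esym C0).
by rewrite /B big_seq big1// => c hc; rewrite (g0 c hc) normr0 !mulr0.
Qed.

(** A monic polynomial of degree n is the orthogonal one plus a polynomial of
    smaller degree, to which the former is orthogonal. *)
Lemma hnorm_min w n f : (forall c, c \in cs -> 0 < w c) -> (n <= m)%N ->
  size f = n.+1 -> f \is monic -> hnorm cs w n <= ip cs w f f.
Proof.
move=> w0 nm sf mf; set p := opol cs w n.
have sr : (size (f - p)%R <= n)%N.
  have := opol_reduce cs w (n := n) (r := f); rewrite sf => /(_ (leqnn _)).
  have /monicP := mf; rewrite /lead_coef sf => ->.
  by rewrite scale1r.
rewrite (_ : f = p + (f - p)); last by ring.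
move: (f - p) sr => r sr.
rewrite ipDr !ipDl (ipC _ _ r p) !(opol_orth_low cs_uniq w0 nm sr) addr0 add0r lerDl.
exact: ip_ge0.
Qed.

Variables (w w' : R -> R) (eta : R).
Hypothesis eta_bd : 0 <= eta <= 1 / 10.
Hypothesis w0 : forall c, c \in cs -> 0 < w c.
Hypothesis w'0 : forall c, c \in cs -> 0 < w' c.
Hypothesis ww' : forall c, c \in cs -> `|w' c - w c| <= eta * w c.
Local Notation h := (hnorm cs w).
Local Notation h' := (hnorm cs w').

Lemma ip_le f : ip cs w' f f <= (1 + eta) * ip cs w f f.
Proof.
rewrite /ip mulr_sumr big_seq [leRHS]big_seq; apply: ler_sum => c hc.
rewrite !mulrA -!(mulrA _ f.[c]) -expr2 ler_wpM2r ?sqr_ge0//.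
have := ww' hc; rewrite ler_norml; lra.
Qed.

Lemma ip_ge f : (1 - eta) * ip cs w f f <= ip cs w' f f.
Proof.
rewrite /ip mulr_sumr big_seq [leRHS]big_seq; apply: ler_sum => c hc.
rewrite !mulrA -!(mulrA _ f.[c]) -expr2 ler_wpM2r ?sqr_ge0//.
have := ww' hc; rewrite ler_norml; lra.
Qed.

Lemma hnorm_le n : (n <= m)%N -> h' n <= (1 + eta) * h n.
Proof.
move=> nm; apply: le_trans (ip_le _).
by apply: hnorm_min; rewrite ?size_opol ?monic_opol.
Qed.

Lemma hnorm_ge n : (n <= m)%N -> (1 - eta) * h n <= h' n.
Proof.
move=> nm; apply: le_trans (ip_ge _).
rewrite ler_wpM2l//; first by case/andP: eta_bd => _ ?; lra.
by apply: hnorm_min; rewrite ?size_opol ?monic_opol.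
Qed.

(** The subleading coefficient, whose increments are the diagonal recurrence
    coefficients ([opQE]). *)
Definition opA (v : R -> R) n := if n is k.+1 then (opol cs v n)`_k else 0.

Lemma opQE v n : (forall c, c \in cs -> 0 < v c) -> opQ cs v n = opA v n - opA v n.+1.
Proof.
move=> v0; have := congr1 (fun f : {poly R} => f`_n) (opol_three cs v n).
rewrite /= coefXM !coefD coefZ coef_opol mulr1.
have -> : (opprev cs v n)`_n = 0.
  by case: n => [|n]; rewrite /opprev ?coef0// coefZ nth_default ?mulr0// size_opol.
rewrite addr0 /opA; case: n => [|n] /= E; last by rewrite E; ring.
by rewrite sub0r; apply/eqP; rewrite -addr_eq0 addrC -E.
Qed.

(** The difference D of the subleading coefficients, times h n, is the product of
    the old polynomial of degree n with the new one of degree n + 1; subtracting the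
    vanishing product for the new weight leaves w - w', which is small, and the
    Cauchy-Schwarz inequality concludes because h (n + 1) <= h n. *)
Lemma opA_lip n : (n < m)%N -> h n <= (if n is k.+1 then h k else h n) ->
  `|opA w' n - opA w n| <= 2 * eta.
Proof.
case: n => [|n] nm hn; first by rewrite subrr normr0; case/andP: eta_bd => ? _; lra.
have n1 : (n < m)%N by apply: ltnW.
have hn0 : 0 < h n by apply: hnorm_gt0.
set D := opA w' n.+1 - opA w n.+1.
have sr : (size (opol cs w' n.+1 - opol cs w n.+1)%R <= n.+1)%N.
  apply/leq_sizeP => i; rewrite leq_eqVlt => /orP[/eqP<-|ki].
    by rewrite coefB !coef_opol subrr.
  by rewrite coefB !nth_default ?subrr ?size_opol.
have E : D * h n = \sum_(c <- cs) (w c - w' c) * ((opol cs w n).[c] * (opol cs w' n.+1).[c]).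
  have := ip_opol_lead cs_uniq w0 (ltnW n1) sr.
  rewrite coefB -/D => <-.
  have e1 : ip cs w (opol cs w n) (opol cs w n.+1) = 0 by rewrite ipC opol_orth// ltnW.
  have e2 : ip cs w' (opol cs w n) (opol cs w' n.+1) = 0.
    by rewrite ipC opol_orth_low// ?size_opol// ltnW.
  rewrite ipBr e1 subr0 -[LHS]subr0 -[X in _ - X = _]e2.
  by rewrite /ip -sumrB; apply: eq_bigr => c _; ring.
have B : `|D * h n| <= eta * \sum_(c <- cs) w c * (`|(opol cs w n).[c]| * `|(opol cs w' n.+1).[c]|).
  rewrite E (le_trans (ler_norm_sum _ _ _))// mulr_sumr big_seq [leRHS]big_seq.
  apply: ler_sum => c hc; rewrite !normrM [eta * (_ * _)]mulrA ler_wpM2r// ?mulr_ge0//.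
  by rewrite distrC ww'.
have S0 : 0 <= \sum_(c <- cs) w c * (`|(opol cs w n).[c]| * `|(opol cs w' n.+1).[c]|).
  by rewrite big_seq; apply: sumr_ge0 => c hc; rewrite mulr_ge0 ?mulr_ge0// ltW// w0.
have CS := weighted_CS (opol cs w n) (opol cs w' n.+1) w0.
have [e0 e1] := andP eta_bd.
have G1 : ip cs w (opol cs w' n.+1) (opol cs w' n.+1) <= 2 * h n.
  have := ip_ge (opol cs w' n.+1); have := hnorm_le (ltnW nm).
  rewrite -/(h' n.+1); set I := ip _ _ _ _ => H1 H2.
  have I0 : 0 <= I by apply: ip_ge0.
  have hn1 := hnorm_gt0 cs_uniq w0 nm.
  nra.
rewrite -/(h n) in CS.
have : `|D * h n| ^+ 2 <= (2 * eta * h n) ^+ 2.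
  apply: (@le_trans _ _ ((eta * \sum_(c <- cs) w c * (`|(opol cs w n).[c]| * `|(opol cs w' n.+1).[c]|)) ^+ 2)).
    by rewrite ler_pXn2r ?nnegrE ?normr_ge0// mulr_ge0.
  rewrite !exprMn.
  have : h n * ip cs w (opol cs w' n.+1) (opol cs w' n.+1) <= h n * (2 * h n).
    by rewrite ler_wpM2l// ltW.
  have e2 : 0 <= eta ^+ 2 by apply: sqr_ge0.
  have hh : 0 <= h n ^+ 2 by apply: sqr_ge0.
  move=> H; have := ler_wpM2l e2 (le_trans CS H).
  have : 0 <= eta ^+ 2 * h n ^+ 2 by apply: mulr_ge0.
  by move=> ? ?; lra.
rewrite ler_pXn2r ?nnegrE ?normr_ge0//; last by rewrite !mulr_ge0// ltW.
by rewrite normrM (gtr0_norm hn0) ler_pM2r.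
Qed.

End Perturb.

Section Contraction.
Variable R : realType.
Variables (T : {poly R}) (cs : seq R).
Hypothesis CT : critical T cs.
Local Notation m := (size cs).
Local Notation d := (size cs).+1.
Local Notation tau := (lead_coef T).
Hypothesis TL : forall c, c \in cs -> 100 <= `|T.[c]|.
Let T4 : forall c, c \in cs -> 4 <= `|T.[c]|.
Proof. by move=> c hc; apply: le_trans (TL hc); lra. Qed.
Variable a : int.
Local Notation b := (site a d).
Let csU := crit_uniq CT.

(** The value at c of the interpolating polynomial with weight [wt]. *)
Lemma solL1_W pt W k c : c \in cs ->
  (forall k c, c \in cs -> 0 < W k c * T.[c]) ->
  Wof a d (solp T cs a pt W) (solF T cs a pt W) k c = W k c.
Proof.
move=> hc Wsgn; have m0 := crit_nil CT.
have p0 : solp T cs a pt W (b k) = solp_at T cs pt W k 0.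
  by have := @solpE _ T cs a pt W k 0 isT; rewrite subr0.
have L1 : solF T cs a pt W k (b k - 1) = solL T cs W k 1 by exact: (@solFE _ T cs a pt W k 1).
rewrite /Wof p0 L1 /= hornerZ horner_lsum// opol0 hornerC mulr1 mulrA mulrA.
have h0 : Num.sqrt (hnorm cs (wt T cs W k) 0) != 0 by exact: (hneq0 CT Wsgn).
have E := wtE CT W k hc; rewrite -[RHS]opprK -E.
by field.
Qed.

Lemma sol_good pt qt W : (forall k, 0 <= pt k) ->
  (forall k c, c \in cs -> W k c = T.[c] - qt k - pt (k + 1) ^+ 2 / W (k + 1) c) ->
  (forall k c, c \in cs -> 0 < W k c * T.[c]) ->
  good a T cs pt qt (solp T cs a pt W) (solq T cs a W) (solF T cs a pt W).
Proof.
move=> pt0 Wrec Wsgn; have m0 := crit_nil CT; have t0 := crit_lead CT.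
have pos k i : (i < m)%N -> 0 < solp_at T cs pt W k i.
  case: i => [|i] im; first exact: (sqrth_gt0 CT Wsgn).
  rewrite /= (ltn_eqF im) divr_gt0//; first exact: (sqrth_gt0 CT Wsgn).
  exact: (sqrth_gt0 CT Wsgn k (ltnW im)).
split; first exact: sol_kernel.
  move=> n; have [k [i [id ->]]] := @siteP a d n isT; rewrite solpE//.
  move: id; rewrite ltnS leq_eqVlt => /orP[/eqP->|im]; last exact/ltW/pos.
  rewrite solp_at_last// divr_ge0// mulr_ge0 ?sqrtr_ge0//; exact: ltW.
by move=> k i im; rewrite solpE ?pos// ltnW.
Qed.

Variables (pt qt : int -> R).
Hypothesis pt0 : forall k, 0 <= pt k.
Hypothesis ud : unitdata pt qt.

Lemma good_explicit p q F : good a T cs pt qt p q F -> bigW a cs p F ->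
  let W := Wof a d p F in
  p =1 solp T cs a pt W /\ q =1 solq T cs a W.
Proof.
move=> G B W.
have Wrec k c : c \in cs -> W k c = T.[c] - qt k - pt (k + 1) ^+ 2 / W (k + 1) c.
  by move=> hc; apply: (bigWrec CT G B).
have Wsgn k c : c \in cs -> 0 < W k c * T.[c].
  by move=> hc; apply: (bigW_sgn CT T4 ud G B).
apply: (good_unique CT G (sol_good pt0 Wrec Wsgn)) => k c hc.
by rewrite solL1_W.
Qed.

End Contraction.

Section Contraction2.
Variable R : realType.
Variables (T : {poly R}) (cs : seq R).
Hypothesis CT : critical T cs.
Local Notation m := (size cs).
Local Notation d := (size cs).+1.
Local Notation tau := (lead_coef T).
Hypothesis TL : forall c, c \in cs -> 100 <= `|T.[c]|.
Let T4 : forall c, c \in cs -> 4 <= `|T.[c]|.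
Proof. by move=> c hc; apply: le_trans (TL hc); lra. Qed.
Variable a : int.
Local Notation b := (site a d).
Let csU := crit_uniq CT.
Variables (pt qt pt' qt' p q p' q' : int -> R) (F F' : int -> int -> {poly R}) (delta : R).
Hypothesis pt0 : forall k, 0 <= pt k.
Hypothesis pt'0 : forall k, 0 <= pt' k.
Hypotheses (ud : unitdata pt qt) (ud' : unitdata pt' qt').
Hypotheses (G : good a T cs pt qt p q F) (B : bigW a cs p F).
Hypotheses (G' : good a T cs pt' qt' p' q' F') (B' : bigW a cs p' F').
Hypothesis dd : forall k, `|pt k - pt' k| <= delta /\ `|qt k - qt' k| <= delta.
Hypothesis delta2 : delta <= 2.
Hypothesis up : unitdata p q.
Local Notation W := (Wof a d p F).
Local Notation W' := (Wof a d p' F').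
Local Notation w k := (wt T cs W k).
Local Notation w' k := (wt T cs W' k).
Local Notation h k := (hnorm cs (w k)).
Local Notation h' k := (hnorm cs (w' k)).

Lemma delta_ge0 : 0 <= delta.
Proof. by have [h1 _] := dd 0; apply: le_trans h1. Qed.

Lemma W98 k c : c \in cs -> 98 <= `|W k c|.
Proof. by move=> hc; have := bigW_ge CT ud G B k hc; have := TL hc; lra. Qed.
Lemma W'98 k c : c \in cs -> 98 <= `|W' k c|.
Proof. by move=> hc; have := bigW_ge CT ud' G' B' k hc; have := TL hc; lra. Qed.

(** The recursion contracts, with factor 1/98, the part of the difference which
    comes from W. *)
Lemma W_lip k c : c \in cs -> `|W k c - W' k c| <= 2 * delta.
Proof.
move=> hc; have d0 := delta_ge0.
apply: (@le_trans _ _ (3 / 2 * delta / (1 - 1 / 98))).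
  2: by rewrite ler_pdivrMr; lra.
apply: (@sup_contraction R int (fun k => k + 1) (fun k => `|W k c - W' k c|) (1 / 98)
  (3 / 2 * delta) (2 * (`|T.[c]| + 2))).
- by apply/andP; split; lra.
- move=> i; rewrite (le_trans (ler_normB _ _))//.
  by have := bigW_le CT ud G B i hc; have := bigW_le CT ud' G' B' i hc; lra.
move=> i; rewrite (bigWrec CT G B)// (bigWrec CT G' B')//.
have w1 := W98 (i + 1) hc; have w1' := W'98 (i + 1) hc.
set x := W _ c in w1 *; set x' := W' _ c in w1' *.
have x0 : x != 0 by rewrite -normr_gt0; lra.
have x'0 : x' != 0 by rewrite -normr_gt0; lra.
have -> : T.[c] - qt i - pt (i + 1) ^+ 2 / x - (T.[c] - qt' i - pt' (i + 1) ^+ 2 / x')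
  = - (qt i - qt' i) - (pt (i + 1) - pt' (i + 1)) * (pt (i + 1) + pt' (i + 1)) / x
    + pt' (i + 1) ^+ 2 / (x * x') * (x - x') by field; rewrite x0 x'0.
have [dp _] := dd (i + 1); have [_ dq] := dd i.
have [u1 _] := ud (i + 1); have [u1' _] := ud' (i + 1).
have t1 : `|(pt (i + 1) - pt' (i + 1)) * (pt (i + 1) + pt' (i + 1)) / x| <= delta / 2.
  rewrite !normrM normfV ler_pdivrMr; last by lra.
  have : `|pt (i + 1) + pt' (i + 1)| <= 2 by rewrite (le_trans (ler_normD _ _))//; lra.
  move=> u2; apply: (@le_trans _ _ (delta * 2)); first by apply: ler_pM.
  by nra.
have t2 : `|pt' (i + 1) ^+ 2 / (x * x') * (x - x')| <= 1 / 98 * `|x - x'|.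
  rewrite normrM ler_wpM2r// normrM normfV [`|x * x'|]normrM normrX.
  have : `|pt' (i + 1)| ^+ 2 <= 1 by apply: exprn_ile1.
  by move=> h1; rewrite ler_pdivrMr; [apply: (le_trans h1); nra|nra].
rewrite (le_trans (ler_normD _ _))// (le_trans (lerD (ler_normB _ _) (lexx _)))//.
by rewrite normrN; lra.
Qed.

Lemma w_gt0 k c : c \in cs -> 0 < w k c.
Proof. by move=> hc; apply: (wt_gt0 CT) => // *; apply: (bigW_sgn CT T4 ud G B). Qed.
Lemma w'_gt0 k c : c \in cs -> 0 < w' k c.
Proof. by move=> hc; apply: (wt_gt0 CT) => // *; apply: (bigW_sgn CT T4 ud' G' B'). Qed.

Local Notation eta := (delta / 49).
Lemma w_lip k c : c \in cs -> `|w' k c - w k c| <= eta * w k c.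
Proof.
move=> hc; have l0 := lpoly_neq0 cs c; have t0 := lt0r_neq0 (crit_lead CT).
have W0 : W k c != 0 by rewrite -normr_gt0; have := W98 k hc; lra.
have -> : w' k c - w k c = w k c * ((W' k c - W k c) / W k c).
  by rewrite /wt; field; rewrite W0 l0 t0.
rewrite normrM (gtr0_norm (w_gt0 k hc)) mulrC ler_wpM2r ?(ltW (w_gt0 k hc))//.
rewrite normrM normfV distrC ler_pdivrMr ?normr_gt0//.
have := W_lip k hc; have := W98 k hc; have := delta_ge0; nra.
Qed.

Lemma eta_bd : 0 <= eta <= 1 / 10.
Proof.
have d0 := delta_ge0; apply/andP; split; first by rewrite divr_ge0.
by rewrite ler_pdivrMr//; move: delta2; lra.
Qed.

Lemma pE k i : (i < d)%N -> p (b k - i%:Z) = solp_at T cs pt W k i.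
Proof. by move=> id; have [-> _] := good_explicit CT TL pt0 ud G B; rewrite solpE. Qed.
Lemma p'E k i : (i < d)%N -> p' (b k - i%:Z) = solp_at T cs pt' W' k i.
Proof. by move=> id; have [-> _] := good_explicit CT TL pt'0 ud' G' B'; rewrite solpE. Qed.
Lemma qE k i : (i < d)%N -> q (b k - i%:Z) = solq_at T cs W k i.
Proof. by move=> id; have [_ ->] := good_explicit CT TL pt0 ud G B; rewrite solqE. Qed.
Lemma q'E k i : (i < d)%N -> q' (b k - i%:Z) = solq_at T cs W' k i.
Proof. by move=> id; have [_ ->] := good_explicit CT TL pt'0 ud' G' B'; rewrite solqE. Qed.

Lemma sqrt_lip (x y eps : R) : 0 < x <= 1 -> 0 <= y -> 0 <= eps ->
  `|y ^+ 2 - x ^+ 2| <= eps * x ^+ 2 -> `|x - y| <= eps.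
Proof.
move=> /andP[x0 x1] y0 e0; have -> : y ^+ 2 - x ^+ 2 = (y - x) * (y + x) by ring.
rewrite normrM (ger0_norm (addr_ge0 y0 (ltW x0))) => H; rewrite distrC.
have N0 := normr_ge0 (y - x).
have : `|y - x| * x <= eps * x.
  apply: (@le_trans _ _ (`|y - x| * (y + x))); first by apply: ler_wpM2l => //; lra.
  by apply: (le_trans H); rewrite ler_wpM2l// expr2 ler_piMl// ltW.
by rewrite ler_pM2r.
Qed.

Lemma h_pos k i : (i < m)%N -> 0 < h k i.
Proof. by move=> im; apply: hnorm_gt0 => // c hc; apply: w_gt0. Qed.
Lemma h'_pos k i : (i < m)%N -> 0 < h' k i.
Proof. by move=> im; apply: hnorm_gt0 => // c hc; apply: w'_gt0. Qed.

Lemma h_lip k i : (i < m)%N -> (1 - eta) * h k i <= h' k i <= (1 + eta) * h k i.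
Proof.
move=> im; apply/andP; split.
  by apply: (hnorm_ge csU eta_bd (@w_gt0 k) (@w_lip k)); apply: ltnW.
by apply: (hnorm_le csU (@w'_gt0 k) (@w_lip k)); apply: ltnW.
Qed.

Lemma p_le1 n : p n <= 1.
Proof. by have [h1 _] := up n; apply: le_trans h1; apply: ler_norm. Qed.

Lemma p_lip_in k i : (i < m)%N -> `|p (b k - i%:Z) - p' (b k - i%:Z)| <= delta / 10.
Proof.
move=> im; have d0 := delta_ge0; have /andP[e0 e1] := eta_bd.
apply: (@le_trans _ _ (3 * eta)); last by lra.
apply: sqrt_lip.
- by rewrite (good_p G)// p_le1.
- by rewrite ltW// (good_p G').
- by lra.
have id : (i < d)%N by apply: ltnW.
rewrite (pE k id) (p'E k id) {id}; case: i im => [|i] im /=.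
  rewrite !sqr_sqrtr ?(ltW (h_pos _ _)) ?(ltW (h'_pos _ _))//.
  have := h_lip k im; have := h_pos k im; set x := h k 0; set y := h' k 0.
  by move=> x0 /andP[h1 h2]; rewrite ler_norml; apply/andP; split; nra.
rewrite (ltn_eqF im) !expr_div_n !sqr_sqrtr ?(ltW (h_pos _ _)) ?(ltW (h'_pos _ _)) ?(ltnW im)//.
have := h_lip k im; have := h_pos k im; have := h'_pos k im.
have := h_lip k (ltnW im); have := h_pos k (ltnW im); have := h'_pos k (ltnW im).
set x := h k i.+1; set y := h' k i.+1; set u := h k i; set v := h' k i.
move=> v0 u0 /andP[h1 h2] y0 x0 /andP[h3 h4].
have -> : y / v - x / u = (y * u - x * v) / (v * u) by field; rewrite ?lt0r_neq0.
rewrite normrM normfV (gtr0_norm (mulr_gt0 v0 u0)) ler_pdivrMr ?mulr_gt0//.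
have -> : 3 * eta * (x / u) * (v * u) = 3 * eta * (x * v) by field; rewrite lt0r_neq0.
have xv : 0 < x * v by apply: mulr_gt0.
have yu1 : y * u <= (1 + eta) * (x * u) by rewrite mulrA ler_wpM2r// ltW.
have yu2 : (1 - eta) * (x * u) <= y * u by rewrite mulrA ler_wpM2r// ltW.
have xu1 : (1 - eta) * (x * u) <= x * v by rewrite mulrCA ler_wpM2l// ltW.
have xu2 : x * v <= (1 + eta) * (x * u) by rewrite [leRHS]mulrCA ler_wpM2l// ltW.
have xu0 : 0 < x * u by apply: mulr_gt0.
move: yu1 yu2 xu1 xu2 xu0 xv; set s := x * u; set t := x * v; set r := y * u.
move=> a1 a2 a3 a4 a5 a6; rewrite ler_norml; apply/andP; split; nra.
Qed.

(** By [hnorm_lastV] the square of this quantity is the sum of the w_c / W_c^2, and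
    the sum of the w_c is p_(b_k)^2 <= 1. *)
Lemma last_small k : (tau * Num.sqrt (h k m.-1))^-1 <= 1 / 98.
Proof.
have m0 := crit_nil CT; have t0 := crit_lead CT.
have m1 : (m.-1 < m)%N by rewrite prednK.
have s0 : 0 < tau * Num.sqrt (h k m.-1) by rewrite mulr_gt0// sqrtr_gt0 h_pos.
rewrite -(ler_pXn2r (n := 2)) ?nnegrE ?invr_ge0 ?(ltW s0)//.
rewrite exprVn exprMn sqr_sqrtr ?(ltW (h_pos _ _))// invfM.
rewrite (hnorm_lastV csU (@w_gt0 k) m0) mulr_sumr.
have pb : p (b k) ^+ 2 = h k 0.
  have := pE k (isT : (0 < d)%N); rewrite subr0 => -> /=.
  by rewrite sqr_sqrtr// ltW// h_pos.
have hb : h k 0 <= 1.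
  by rewrite -pb exprn_ile1 ?p_le1//; apply: (good_p0 G).
apply: (@le_trans _ _ (\sum_(c <- cs) w k c * (1 / 98) ^+ 2)); last first.
  by rewrite -mulr_suml -hnorm0 ler_piMl// sqr_ge0.
rewrite big_seq [leRHS]big_seq; apply: ler_sum => c hc.
have wc := w_gt0 k hc; have l0 := lpoly_neq0 cs c.
have W0 : W k c != 0 by rewrite -normr_gt0; have := W98 k hc; lra.
have -> : (tau ^+ 2)^-1 * (w k c * (lpoly cs c).[c] ^+ 2)^-1 = w k c * (W k c ^+ 2)^-1.
  rewrite /wt; field; rewrite W0 l0 (lt0r_neq0 t0)//=.
rewrite ler_wpM2l ?(ltW wc)// -exprVn -real_normK ?num_real// ler_pXn2r ?nnegrE//.
by rewrite normfV mul1r lef_pV2 ?posrE ?normr_gt0// W98.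
Qed.

Lemma p_lip_last k : `|p (b k - m%:Z) - p' (b k - m%:Z)| <= delta / 10.
Proof.
have m0 := crit_nil CT; have t0 := crit_lead CT.
have m1 : (m.-1 < m)%N by rewrite prednK.
have d0 := delta_ge0; have /andP[e0 e1] := eta_bd.
rewrite pE// p'E// !solp_at_last//.
have s0 : 0 < tau * Num.sqrt (h k m.-1) by rewrite mulr_gt0// sqrtr_gt0 h_pos.
have s'0 : 0 < tau * Num.sqrt (h' k m.-1) by rewrite mulr_gt0// sqrtr_gt0 h'_pos.
have g1 := last_small k.
set g := _^-1 in g1 *; set g' := (tau * _)^-1.
have g0 : 0 < g by rewrite invr_gt0.
have g'0 : 0 < g' by rewrite invr_gt0.
have gg : `|g - g'| <= 3 * eta.
  apply: sqrt_lip; first by rewrite g0 /=; lra.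
  - exact: ltW.
  - by lra.
  rewrite /g /g' !exprVn !exprMn !sqr_sqrtr ?(ltW (h_pos _ _)) ?(ltW (h'_pos _ _))//.
  have := h_lip k m1; have := h_pos k m1; have := h'_pos k m1.
  set x := h k _; set y := h' k _ => y0 x0 /andP[h1 h2].
  have -> : (tau ^+ 2 * y)^-1 - (tau ^+ 2 * x)^-1 = (tau ^+ 2 * x)^-1 * ((x - y) / y).
    by field; rewrite ?lt0r_neq0.
  have tx : 0 < (tau ^+ 2 * x)^-1 by rewrite invr_gt0 mulr_gt0// exprn_gt0.
  rewrite normrM (gtr0_norm tx) mulrC ler_wpM2r ?(ltW tx)//.
  rewrite normrM normfV (gtr0_norm y0) ler_pdivrMr//.
  by rewrite ler_norml; apply/andP; split; nra.
have [dp _] := dd k; have [_ _] := dd k; have [u1' _] := ud' k.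
have -> : pt k * g - pt' k * g' = (pt k - pt' k) * g + pt' k * (g - g') by ring.
rewrite (le_trans (ler_normD _ _))// !normrM (gtr0_norm g0).
have : `|pt k - pt' k| * g <= delta * (1 / 98) by apply: ler_pM => //; apply: ltW.
have : `|pt' k| * `|g - g'| <= 1 * (3 * eta) by apply: ler_pM.
by lra.
Qed.

Lemma q_lip k i : (i < d)%N -> `|q (b k - i%:Z) - q' (b k - i%:Z)| <= delta / 10.
Proof.
move=> id; have d0 := delta_ge0; have /andP[e0 e1] := eta_bd.
rewrite qE// q'E//; case: i id => [|i] im /=; first by rewrite subrr normr0; lra.
rewrite ltnS in im.
have A n : (n < m)%N -> `|opA cs (w' k) n - opA cs (w k) n| <= 2 * eta.
  move=> nm; apply: (opA_lip csU eta_bd (@w_gt0 k) (@w'_gt0 k) (@w_lip k) nm).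
  case: n nm => // n nm.
  have := p_le1 (b k - n.+1%:Z); rewrite (pE k (ltnW nm : n.+1 < d)%N) /=.
  rewrite (ltn_eqF nm).
  rewrite ler_pdivrMr ?sqrtr_gt0 ?h_pos ?(ltnW nm)// mul1r ler_sqrt//.
  exact/ltW/h_pos/ltnW.
have A' n : (n <= m)%N -> `|opA cs (w' k) n - opA cs (w k) n| <= 2 * eta.
  rewrite leq_eqVlt => /orP[/eqP->|]; last exact: A.
  rewrite /opA; case: (m) (opol_nodal csU (@w_gt0 k)) (opol_nodal csU (@w'_gt0 k)) => [|j].
    by rewrite subrr normr0; lra.
  by move=> -> ->; rewrite subrr normr0; lra.
rewrite !opQE//; [|exact: w'_gt0|exact: w_gt0].
have -> : opA cs (w k) i - opA cs (w k) i.+1 - (opA cs (w' k) i - opA cs (w' k) i.+1)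
  = (opA cs (w' k) i.+1 - opA cs (w k) i.+1) - (opA cs (w' k) i - opA cs (w k) i) by ring.
rewrite (le_trans (ler_normB _ _))//.
have := A' i (ltnW im); have := A' i.+1 im; lra.
Qed.

(** By their extremal characterization the norms h vary with the same relative error
    as the weight, and with them the bonds inside a block; the bond between two
    blocks is pt times a factor at most 1/98, and the diagonal entries are
    differences of [opA]. *)
Theorem good_lip n : `|p n - p' n| <= delta / 10 /\ `|q n - q' n| <= delta / 10.
Proof.
have [k [i [id ->]]] := @siteP a d n isT; split; last exact: q_lip.
move: id; rewrite ltnS leq_eqVlt => /orP[/eqP->|im]; first exact: p_lip_last.
exact: p_lip_in.
Qed.

End Contraction2.

(** * Near-periods *)

Lemma exists_ge_avg (R : realType) (s : seq R) (f : R -> R) : (0 < size s)%N ->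
  exists2 c, c \in s & (\sum_(c <- s) f c) / (size s)%:R <= f c.
Proof.
move=> s0; set A := _ / _; apply: contrapT => N.
have lt c : c \in s -> f c < A.
  by move=> hc; rewrite ltNge; apply/negP => H; apply: N; exists c.
have AE : \sum_(c <- s) f c = (size s)%:R * A by rewrite /A mulrC divfK// pnatr_eq0 -lt0n.
clearbody A; suff : \sum_(c <- s) f c < (size s)%:R * A by rewrite AE ltxx.
elim: s s0 lt {N AE} => // e s IH _ lt; rewrite big_cons /= -natr1 mulrDl mul1r addrC.
have le : \sum_(j <- s) f j <= (size s)%:R * A.
  case: s IH lt => [|e' s] IH lt; first by rewrite big_nil mul0r.
  by apply/ltW/IH => // c hc; apply: lt; rewrite inE hc orbT.
by apply: ler_ltD => //; apply: lt; rewrite mem_head.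
Qed.

Section Separation.
Variable R : realType.
Variables (T : {poly R}) (cs : seq R).
Hypothesis CT : critical T cs.
Local Notation m := (size cs).
Local Notation d := (size cs).+1.
Local Notation tau := (lead_coef T).
Hypothesis TL : forall c, c \in cs -> 100 <= `|T.[c]|.
Let T4 : forall c, c \in cs -> 4 <= `|T.[c]|.
Proof. by move=> c hc; apply: le_trans (TL hc); lra. Qed.
Variable a : int.
Local Notation b := (site a d).
Let csU := crit_uniq CT.
Variables (pt qt : int -> R) (W : int -> R -> R).
Hypothesis pt0 : forall k, 0 <= pt k.
Hypothesis ud : unitdata pt qt.
Hypothesis Wrec : forall k c, c \in cs ->
  W k c = T.[c] - qt k - pt (k + 1) ^+ 2 / W (k + 1) c.
Hypothesis Wsgn : forall k c, c \in cs -> 0 < W k c * T.[c].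
Hypothesis Wbig : forall k c, c \in cs -> 2 <= `|W k c| <= `|T.[c]| + 2.
Local Notation p := (solp T cs a pt W).
Local Notation q := (solq T cs a W).
Local Notation F := (solF T cs a pt W).
Hypothesis up : unitdata p q.
Local Notation w k := (wt T cs W k).
Local Notation h k := (hnorm cs (w k)).

Let K := sol_kernel CT a Wrec Wsgn.
Let wp k : forall c, c \in cs -> 0 < w k c.
Proof. by move=> c hc; apply: (wt_gt0 CT Wsgn). Qed.

Lemma sep_h k j : (j < m)%N -> 0 < h k j.
Proof. by move=> jm; exact: (hnorm_gt0 csU (@wp k) jm). Qed.

Lemma sep_FE k i : (i <= m)%N -> F k (b k - i%:Z) = solL T cs W k i.
Proof. by move=> im; rewrite solFE. Qed.

Lemma sep_Lc k j c : c \in cs -> (j < m)%N ->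
  (F k (b k - j.+1%:Z)).[c] = - W k c * (opol cs (w k) j).[c] / Num.sqrt (h k j).
Proof.
move=> hc jm; rewrite sep_FE//= hornerZ horner_lsum// -(wtE CT W k hc); ring.
Qed.

Lemma sep_L2 k j c : c \in cs -> (j < m)%N ->
  (F k (b k - j.+1%:Z)).[c] ^+ 2 = W k c ^+ 2 * ((opol cs (w k) j).[c] ^+ 2 / h k j).
Proof.
move=> hc jm; rewrite sep_Lc// !exprMn exprVn sqrrN sqr_sqrtr ?mulrA//.
exact/ltW/sep_h.
Qed.

Definition sepC : R := 1 + \sum_(c <- cs) (`|T.[c]| + 2) * (tau * `|(lpoly cs c).[c]|).

Lemma sepC_term c : c \in cs -> 1 + (`|T.[c]| + 2) * (tau * `|(lpoly cs c).[c]|) <= sepC.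
Proof.
move=> hc; rewrite /sepC lerD2l (bigD1_seq c)//= lerDl; apply: sumr_ge0 => e _.
by rewrite mulr_ge0 ?addr_ge0 ?mulr_ge0 ?(ltW (crit_lead CT)).
Qed.

Lemma sepC_ge1 : 1 <= sepC.
Proof.
rewrite /sepC lerDl; apply: sumr_ge0 => e _.
by rewrite mulr_ge0 ?addr_ge0 ?mulr_ge0 ?(ltW (crit_lead CT)).
Qed.

Lemma sep_bound k i c : c \in cs -> (i <= m)%N -> `|(F k (b k - i%:Z)).[c]| <= sepC.
Proof.
move=> hc; case: i => [_|j jm].
  by rewrite subr0 (ker_lat K) (dpoly_root CT)// normr0 (le_trans ler01)// sepC_ge1.
have hj : 0 < h k j by apply: sep_h.
have wc := wp k hc; have l0 := lpoly_neq0 cs c.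
have /andP[W2 WT] := Wbig k hc.
set x := _.[c]; set y := (`|T.[c]| + 2) * (tau * `|(lpoly cs c).[c]|).
have y0 : 0 <= y by rewrite mulr_ge0 ?addr_ge0 ?mulr_ge0 ?(ltW (crit_lead CT)).
have x2 : `|x| ^+ 2 <= y.
  rewrite real_normK ?num_real// /x sep_L2//.
  have o2 : (opol cs (w k) j).[c] ^+ 2 / h k j <= (w k c)^-1.
    rewrite ler_pdivrMr// mulrC ler_pdivlMr// mulrC.
    exact: (opol_bound csU (@wp k)).
  apply: (@le_trans _ _ (W k c ^+ 2 * (w k c)^-1)); first by rewrite ler_wpM2l ?sqr_ge0.
  have -> : W k c ^+ 2 / w k c = `|W k c| * (tau * `|(lpoly cs c).[c]|).
    rewrite -[LHS]ger0_norm; last by rewrite divr_ge0 ?sqr_ge0// ltW.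
    have W0 : W k c != 0 by rewrite -normr_gt0; lra.
    have -> : W k c ^+ 2 / w k c = - (W k c * (tau * (lpoly cs c).[c])).
      by rewrite /wt; field; rewrite W0 l0 (lt0r_neq0 (crit_lead CT)).
    by rewrite normrN !normrM (gtr0_norm (crit_lead CT)).
  by rewrite ler_wpM2r// mulr_ge0// ltW// (crit_lead CT).
apply: le_trans (sepC_term hc); rewrite -/y.
have := normr_ge0 x; nra.
Qed.

(** The normalized orthogonal polynomial of a site has norm 1, so one of the m nodes
    carries at least the fraction 1/m of it. *)
Lemma sep_lower k s : (0 < s <= m)%N ->
  exists2 c, c \in cs & d%:R^-1 <= `|(F k (b k - s%:Z)).[c]|.
Proof.
case: s => // j; rewrite /= => jm.
have m0 := crit_nil CT.
have hj : 0 < h k j by apply: sep_h.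
have mR : 0 < m%:R :> R by rewrite ltr0n.
have [c hc H] : exists2 c, c \in cs & h k j / m%:R <= w k c * (opol cs (w k) j).[c] ^+ 2.
  have [c hc H] := exists_ge_avg (fun c => w k c * (opol cs (w k) j).[c] ^+ 2) m0.
  exists c => //; apply: le_trans H; rewrite ler_wpM2r ?invr_ge0 ?(ltW mR)//.
  by rewrite /hnorm /ip; apply: ler_sum => e _; rewrite -mulrA -expr2.
exists c => //.
have wc := wp k hc; have /andP[W2 WT] := Wbig k hc.
have wle : w k c <= 1.
  have : h k 0 <= 1.
    have p0 : p (b k) = Num.sqrt (h k 0).
      by have := @solpE _ T cs a pt W k 0 isT; rewrite subr0 => ->.
    have h0 : 0 < h k 0 by apply: sep_h.
    have [+ _] := up (b k); rewrite p0 ger0_norm ?sqrtr_ge0// => s1.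
    by rewrite -(sqr_sqrtr (ltW h0)) exprn_ile1 ?sqrtr_ge0.
  apply: le_trans; rewrite hnorm0 (bigD1_seq c)//= lerDl big_seq_cond.
  by apply: sumr_ge0 => e /andP[he _]; apply/ltW/wp.
rewrite -(ler_pXn2r (n := 2)) ?nnegrE ?invr_ge0//.
rewrite [leRHS]real_normK ?num_real// sep_L2// -[W k c ^+ 2]real_normK ?num_real//.
have o2 : m%:R^-1 <= (opol cs (w k) j).[c] ^+ 2 / h k j.
  by rewrite ler_pdivlMr// mulrC (le_trans H)// ler_piMl// sqr_ge0.
apply: (@le_trans _ _ m%:R^-1).
  rewrite exprVn lef_pV2 ?posrE ?exprn_gt0 ?ltr0n//.
  by rewrite -natrX ler_nat; nia.
apply: (le_trans o2); rewrite ler_peMl ?divr_ge0 ?sqr_ge0 ?(ltW hj)//.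
by rewrite exprn_ege1//; lra.
Qed.

Section Solution.
Variable c : R.
Hypothesis hc : c \in cs.

(** The amplitudes that make the pieces of [sepv] fit together across the lattice
    sites; they decay because |pt| <= 1 and |W| >= 2. *)
Fixpoint sepY (J : int) (j : nat) : R :=
  if j is i.+1 then sepY J i * (pt (J - i%:Z) / W (J - i.+1%:Z) c) else 1.

(** A solution of (c - J) v = 0 below the site b_J which vanishes on the lattice
    and decays at minus infinity. *)
Definition sepv (J n : int) : R :=
  sepY J `|J - blk a d n|%N * (F (blk a d n) n).[c].

Lemma sepY_le J j : `|sepY J j| <= 2 ^- j.
Proof.
elim: j => [|j IH] /=; first by rewrite normr1 invr1.
rewrite normrM exprS invfM mulrC ler_pM// normrM normfV.
have [p1 _] := ud (J - j%:Z); have /andP[w2 _] := Wbig (J - j.+1%:Z) hc.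
rewrite -[leRHS]mul1r ler_pM ?invr_ge0// lef_pV2 ?posrE//; lra.
Qed.

Lemma sepv_site J j i : (i <= d)%N ->
  sepv J (b (J - j%:Z) - i%:Z) = sepY J j * (F (J - j%:Z) (b (J - j%:Z) - i%:Z)).[c].
Proof.
rewrite leq_eqVlt => /orP[/eqP->|id].
  rewrite -siteB1 (ker_latm K) horner0 mulr0 /sepv blk_site0// (ker_lat K).
  by rewrite (dpoly_root CT)// mulr0.
by rewrite /sepv blk_site//; congr (sepY _ _ * _); lia.
Qed.

Lemma sepv_lat J j : sepv J (b (J - j%:Z)) = 0.
Proof.
by rewrite -[b _]subr0 (sepv_site J j (leq0n d)) subr0 (ker_lat K) (dpoly_root CT)// mulr0.
Qed.

Lemma sepv_top J i : (i <= d)%N -> sepv J (b J - i%:Z) = (F J (b J - i%:Z)).[c].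
Proof. by move=> id; have := sepv_site J 0 id; rewrite subr0 mul1r. Qed.

Lemma sepv_eq J n : n < b J ->
  c * sepv J n = p n * sepv J (n - 1) + q n * sepv J n + p (n + 1) * sepv J (n + 1).
Proof.
have [k [i [id ->]]] := @siteP a d n isT => nb.
have kJ : k <= J by move: nb; rewrite /site; nia.
pose j := `|J - k|%N; have kE : k = J - j%:Z by rewrite /j; lia.
case: (posnP i) => [i0|i0]; last first.
  have e2 : b k - i%:Z + 1 = b k - i.-1%:Z by lia.
  have e1 : b k - i%:Z - 1 = b k - i.+1%:Z by lia.
  rewrite e1 e2 kE !sepv_site ?(ltnW id)//; last by lia.
  have hi : (0 < i < d)%N by rewrite i0.
  have := ker_in K k hi; rewrite /= e1 e2 -kE => /(congr1 (horner^~ c)).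
  rewrite !(hornerD, hornerM, hornerX, hornerC) => E.
  by rewrite mulrCA E; ring.
rewrite i0 subr0 in nb *.
have j0 : (0 < j)%N by move: nb; rewrite kE /site; nia.
have k1 : k + 1 = J - j.-1%:Z by lia.
have e2 : b k + 1 = b (k + 1) - m%:Z by rewrite siteD1; lia.
have v0 : sepv J (b k) = 0 by rewrite kE sepv_lat.
have vm : sepv J (b k - 1) = sepY J j * (F k (b k - 1)).[c].
  by have := @sepv_site J j 1 isT; rewrite -kE.
have vp : sepv J (b k + 1) = sepY J j.-1 * (F (k + 1) (b k + 1)).[c].
  by have := @sepv_site J j.-1 m (leqnSn m); rewrite -k1 -e2.
rewrite v0 vm vp !mulr0 addr0.
have -> : sepY J j = sepY J j.-1 * (pt (k + 1) / W k c).
  by rewrite -{1}(prednK j0) /= prednK// -kE -k1.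
have := ker_right K k => /(congr1 (horner^~ c)); rewrite hornerM !hornerC.
move=> E; have := solL1_W CT a pt k hc Wsgn; rewrite /Wof => E2.
have W0 : W k c != 0 by rewrite -normr_gt0; have := Wbig k hc; lra.
rewrite [p (b k + 1) * _]mulrCA E.
have -> : p (b k) * (sepY J j.-1 * (pt (k + 1) / W k c) * (F k (b k - 1)).[c])
  = sepY J j.-1 * (pt (k + 1) / W k c) * (p (b k) * (F k (b k - 1)).[c]) by ring.
by rewrite -[p (b k) * _]opprK E2; field.
Qed.

Lemma sepv_bound J j i : (i <= m)%N -> `|sepv J (b (J - j%:Z) - i%:Z)| <= 2 ^- j * sepC.
Proof.
move=> im; rewrite sepv_site; last exact: leqW.
by rewrite normrM ler_pM// ?sepY_le// sep_bound.
Qed.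

Lemma sepv_bound1 J n : n <= b J -> `|sepv J n| <= sepC.
Proof.
have [k [i [id ->]]] := @siteP a d n isT => nb.
have kJ : k <= J by move: nb; rewrite /site; nia.
have -> : k = J - `|J - k|%N%:Z by lia.
apply: (le_trans (sepv_bound _ _ _)); first by rewrite -ltnS.
rewrite ler_piMl ?(le_trans ler01 sepC_ge1)// invf_le1 ?exprn_gt0//.
by rewrite exprn_ege1//; lra.
Qed.

Variables (k : int) (r : R) (s : nat) (J' : int).
Hypothesis hr : forall n, `|p (n + k) - p n| <= r /\ `|q (n + k) - q n| <= r.
Hypothesis hs : (0 < s <= m)%N.
Hypothesis hk : b J' - s%:Z = b 0 + k.

Local Notation u := (sepv 0).
Let v n := sepv J' (n + k).
Let om n := p n * (u n * v (n - 1) - u (n - 1) * v n).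

Lemma r_ge0 : 0 <= r. Proof. by have [h1 _] := hr 0; apply: le_trans h1. Qed.

(** The Wronskian of two solutions of the same equation would be constant; here
    the second one solves the equation with coefficients translated by k. *)
Lemma om_step n : n < b 0 -> `|om (n + 1)| <= `|om n| + 3 * r * sepC ^+ 2.
Proof.
move=> nb; have hs' : (0 < s)%N by case/andP: hs.
have Eu := sepv_eq nb.
have nb' : n + k < b J' by have := hk; lia.
have Ev := sepv_eq nb'.
have u0 : `|u n| <= sepC by apply: sepv_bound1; apply: ltW.
have vb x : x <= b 0 -> `|v x| <= sepC by move=> xb; apply: sepv_bound1; have := hk; lia.
have v1 := vb (n - 1) ltac:(lia); have v2 := vb n (ltW nb); have v3 := vb (n + 1) ltac:(lia).
have -> : om (n + 1) = om n + u n * ((p (n + k) - p n) * v (n - 1) + (q (n + k) - q n) * v n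
    + (p (n + 1 + k) - p (n + 1)) * v (n + 1)).
  have -> : (p (n + k) - p n) * v (n - 1) + (q (n + k) - q n) * v n
    + (p (n + 1 + k) - p (n + 1)) * v (n + 1)
    = c * v n - (p n * v (n - 1) + q n * v n + p (n + 1) * v (n + 1)).
    rewrite /v Ev (addrAC n (- 1) k) (addrAC n 1 k); ring.
  rewrite mulrBr [u n * (c * _)]mulrCA.
  have -> : u n * v n = v n * u n by rewrite mulrC.
  rewrite mulrCA Eu /om addrK; ring.
have [h1 h2] := hr n; have [h3 _] := hr (n + 1).
have C0 : 0 <= sepC by apply: (le_trans ler01 sepC_ge1).
have r0 := r_ge0.
rewrite (le_trans (ler_normD _ _))// lerD2l normrM.
have -> : 3 * r * sepC ^+ 2 = sepC * (r * sepC + r * sepC + r * sepC) by ring.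
apply: ler_pM => //; rewrite (le_trans (ler_normD _ _))//; apply: lerD.
  by rewrite (le_trans (ler_normD _ _))//; apply: lerD; rewrite normrM; apply: ler_pM.
by rewrite normrM; apply: ler_pM.
Qed.

Lemma om_tele (x : nat) : `|om (b 0)| <= `|om (b 0 - x%:Z)| + x%:R * (3 * r * sepC ^+ 2).
Proof.
elim: x => [|x IH]; first by rewrite subr0 mul0r addr0.
apply: (le_trans IH).
have lt : b 0 - x.+1%:Z < b 0 by lia.
have := om_step lt; have -> : b 0 - x.+1%:Z + 1 = b 0 - x%:Z by lia.
by move=> h1; rewrite -natr1; lra.
Qed.

(** At b_0 the Wronskian is W_0(c) times an entry of the kernel, and N blocks below
    it is small because both solutions decay. *)
Lemma om_final (N : nat) : `|(F J' (b J' - s%:Z)).[c]| <=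
  sepC ^+ 2 * 2 ^- N + (N * d)%N%:R * (3 * r * sepC ^+ 2).
Proof.
have C0 : 0 <= sepC by apply: (le_trans ler01 sepC_ge1).
have [s0 sm] := andP hs.
have omb : om (b 0) = W 0 c * (F J' (b J' - s%:Z)).[c].
  have u0 : u (b 0) = 0 by have := sepv_lat 0 0; rewrite subr0.
  rewrite /om u0 mul0r sub0r -[b 0 - 1]/(b 0 - 1%:Z) sepv_top//.
  rewrite /v -hk sepv_top; last exact: leqW.
  rewrite mulrN -mulNr mulrA mulNr; congr (_ * _).
  have := solL1_W CT a pt 0 hc Wsgn; by rewrite /Wof => <-.
have W1 : 1 <= `|W 0 c| by have := Wbig 0 hc; lra.
apply: (@le_trans _ _ `|om (b 0)|); first by rewrite omb normrM ler_peMl.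
apply: (le_trans (om_tele (N * d))); rewrite lerD2r.
have -> : b 0 - (N * d)%N%:Z = b (0 - N%:Z) by rewrite /site PoszM; ring.
have := sepv_lat 0 N; set n := b (0 - N%:Z) => uN.
rewrite /om uN mul0r sub0r normrM normrN.
have [p1 _] := up n.
rewrite -[leRHS]mul1r; apply: ler_pM => //; rewrite normrM.
have -> : sepC ^+ 2 / 2 ^+ N = (2 ^- N * sepC) * sepC by ring.
apply: ler_pM => //.
  by apply: (sepv_bound 0 N (i := 1)); apply: crit_nil CT.
apply: sepv_bound1; have := hk; have : n <= b 0 by rewrite /n /site; nia.
by lia.
Qed.

End Solution.

(** If k is not in d Z, the translate by k puts a lattice site on an inner site,
    where by [sep_lower] some entry of the kernel is at least 1/d, while
    [om_final] bounds it by 1/(2d) once N is large and then r is small. *)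
Theorem shift_separation : exists2 r : R, 0 < r &
  forall k : int, (forall n, `|p (n + k) - p n| <= r /\ `|q (n + k) - q n| <= r) ->
    (d%:Z %| k)%Z.
Proof.
have C1 := sepC_ge1.
(* N is chosen so that sepC^2 / 2^N <= 1/(4d), then r so that the other term is 1/(4d) *)
pose x : R := sepC ^+ 2 * (4 * d%:R).
pose N := (Num.bound x).+1.
have x0 : 0 <= x by rewrite mulr_ge0 ?sqr_ge0// mulr_ge0.
have dR : 0 < d%:R :> R by rewrite ltr0n.
have N2 : x <= 2 ^+ N.
  apply: (le_trans (ltW (archi_boundP x0))).
  by rewrite -natrX ler_nat (leq_trans (leqnSn _))// ltnW// ltn_expl.
have Nd : 0 < (N * d)%N%:R :> R by rewrite ltr0n muln_gt0.
exists (d%:R^-1 / (12 * sepC ^+ 2 * (N * d)%N%:R)).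
  have C0 : 0 < sepC by apply: lt_le_trans C1.
  by rewrite divr_gt0 ?invr_gt0// !mulr_gt0// exprn_gt0.
move=> k hr; apply: contrapT => /negP kd.
have [J' [s [sd E]]] := @siteP 0 d k isT.
have s0 : (0 < s)%N.
  case: s E sd => // E _; case/negP: kd.
  by rewrite E subr0 /site add0r dvdz_mulr.
have hs : (0 < s <= m)%N by rewrite s0.
have hk : b J' - s%:Z = b 0 + k by rewrite E /site; ring.
have [c hc L] := sep_lower J' hs.
have := om_final hc hr hs hk N => H.
have {H} := le_trans L H.
have -> : sepC ^+ 2 * 2 ^- N + (N * d)%N%:R * (3 * (d%:R^-1 / (12 * sepC ^+ 2 * (N * d)%N%:R)) * sepC ^+ 2)
  = sepC ^+ 2 / 2 ^+ N + d%:R^-1 / 4.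
  have C0 : 0 < sepC by apply: lt_le_trans C1.
  have P2 : 0 < 2 ^+ N :> R by rewrite exprn_gt0.
  move: Nd P2 C0 dR; move: (N * d)%N%:R (2 ^+ N) sepC (d%:R) => y z C e y0 z0 C0 e0.
  by field; rewrite !lt0r_neq0.
have : sepC ^+ 2 / 2 ^+ N <= d%:R^-1 / 4.
  rewrite ler_pdivrMr ?exprn_gt0//.
  apply: (@le_trans _ _ (d%:R^-1 / 4 * x)).
    have -> : d%:R^-1 / 4 * x = sepC ^+ 2.
      by rewrite /x; move: (d%:R) dR => e e0; field; rewrite lt0r_neq0.
    exact: lexx.
  by rewrite ler_wpM2l// divr_ge0// invr_ge0.
have : 0 < d%:R^-1 :> R by rewrite invr_gt0.
move: (d%:R^-1) (sepC ^+ 2 / 2 ^+ N) => e y e0 y1 y2; lra.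
Qed.

End Separation.

Local Open Scope classical_set_scope.
Local Open Scope ring_scope.

(** * Bounded quadratic forms and Weyl functions *)

Section Weyl.
Variable R : realType.

(** The quadratic form of the matrix on the vector with entries f 0, ..., f n at
    the sites k, ..., k + n. *)
Fixpoint qform (p q : int -> R) (n : nat) (k : int) (f : nat -> R) : R :=
  q k * f 0%N ^+ 2 + (if n is n'.+1 then
    2 * p (k + 1) * f 0%N * f 1%N + qform p q n' (k + 1) (fun i => f i.+1) else 0).

Fixpoint sqsum (n : nat) (f : nat -> R) : R :=
  f 0%N ^+ 2 + (if n is n'.+1 then sqsum n' (fun i => f i.+1) else 0).

Definition form_bd (p q : int -> R) : Prop :=
  forall n k f, `|qform p q n k f| <= sqsum n f.

Lemma sqsumZ n f x : sqsum n (fun i => x * f i) = x ^+ 2 * sqsum n f.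
Proof. by elim: n f => [|n IH] f /=; rewrite ?IH; ring. Qed.

Lemma sqsum_ge n f : f 0%N ^+ 2 <= sqsum n f.
Proof.
case: n => [|n] /=; rewrite ?addr0// lerDl.
by elim: n (fun i => f i.+1) => [|n IH] g /=; rewrite ?addr0 ?sqr_ge0// addr_ge0 ?sqr_ge0.
Qed.

Lemma qformZ p q n k f x : qform p q n k (fun i => x * f i) = x ^+ 2 * qform p q n k f.
Proof. by elim: n k f => [|n IH] k f /=; rewrite ?IH; ring. Qed.

(** Alternating signs conjugate the matrix with diagonal - q to minus the
    original one. *)
Lemma qform_alt p q n k f :
  qform p (fun j => - q j) n k f = - qform p q n k (fun i => (-1) ^+ i * f i).
Proof.
elim: n k f => [|n IH] k f /=; first by ring.
rewrite IH.
have -> : qform p q n (k + 1) (fun i => (-1) ^+ i.+1 * f i.+1)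
   = qform p q n (k + 1) (fun i => (-1) ^+ i * f i.+1).
  have -> : (fun i => (-1) ^+ i.+1 * f i.+1) = (fun i => (-1) * ((-1) ^+ i * f i.+1)).
    by apply/funext => i; rewrite exprS mulrA.
  by rewrite qformZ sqrrN expr1n mul1r.
by ring.
Qed.

Lemma sqsum_alt n f : sqsum n (fun i => (-1) ^+ i * f i) = sqsum n f.
Proof.
elim: n f => [|n IH] f /=; first by ring.
have -> : (fun i => (-1) ^+ i.+1 * f i.+1) = (fun i => (-1) * ((-1) ^+ i * f i.+1)).
  by apply/funext => i; rewrite exprS mulrA.
by rewrite sqsumZ IH; ring.
Qed.

Lemma form_bd_opp p q : form_bd p q -> form_bd p (fun j => - q j).
Proof. by move=> h n k f; rewrite qform_alt normrN -(sqsum_alt n f). Qed.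

Lemma form_bd_entries p q : form_bd p q -> forall k, `|p k| <= 1 /\ `|q k| <= 1.
Proof.
move=> h k; split; last first.
  by have := h 0%N k (fun=> 1) => /=; rewrite !addr0 expr1n mulr1.
have := h 1%N (k - 1) (fun=> 1) => /=; rewrite subrK !addr0 expr1n !mulr1 => h1.
have := h 1%N (k - 1) (fun i => (-1) ^+ i) => /=.
rewrite subrK !addr0 expr0 expr1 expr1n sqrrN expr1n !mulr1 => h2.
by move: h1 h2; rewrite !ler_norml => /andP[? ?] /andP[? ?]; apply/andP; split; lra.
Qed.

Section Pos.
Variables (p q : int -> R).
Hypothesis fb : form_bd p q.

(** The truncated continued fraction. *)
Fixpoint Wn (t : R) (n : nat) (k : int) : R :=
  t - q k - (if n is n'.+1 then p (k + 1) ^+ 2 / Wn t n' (k + 1) else 0).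

Lemma WnS t n k : Wn t n.+1 k = t - q k - p (k + 1) ^+ 2 / Wn t n (k + 1).
Proof. by []. Qed.

(** Wn is the value of the form t - J at a finitely supported vector with first
    entry 1. *)
Lemma Wn_ge t n k : 1 < t -> t - 1 <= Wn t n k.
Proof.
move=> t1; suff [f [f0 E]] : exists f, f 0%N = 1 /\ t * sqsum n f - qform p q n k f = Wn t n k.
  rewrite -E; have := fb n k f; rewrite ler_norml => /andP[_ h].
  by have := sqsum_ge n f; rewrite f0 expr1n; nra.
elim: n k => [|n IH] k.
  by exists (fun=> 1); split=> //=; ring.
have [f [f0 E]] := IH (k + 1).
have W0 : 0 < Wn t n (k + 1).
  rewrite -E; have := fb n (k + 1) f; rewrite ler_norml => /andP[_ h].
  by have := sqsum_ge n f; rewrite f0 expr1n; nra.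
pose x := p (k + 1) / Wn t n (k + 1).
exists (fun i => if i is j.+1 then x * f j else 1); split => //=.
rewrite sqsumZ qformZ f0.
have -> : qform p q n (k + 1) f = t * sqsum n f - Wn t n (k + 1) by rewrite -E; ring.
by rewrite /x; field; rewrite lt0r_neq0.
Qed.

Lemma Wn_gt0 t n k : 1 < t -> 0 < Wn t n k.
Proof. by move=> t1; apply: lt_le_trans (Wn_ge n k t1); rewrite subr_gt0. Qed.

Lemma Wn_dec t n k : 1 < t -> Wn t n.+1 k <= Wn t n k.
Proof.
move=> t1; elim: n k => [|n IH] k.
  rewrite [leLHS]/= [leRHS]/= lerD2l lerN2 divr_ge0 ?sqr_ge0//.
  exact: ltW (Wn_gt0 0 (k + 1) t1).
rewrite (WnS t n.+1 k) (WnS t n k) lerD2l lerN2 ler_wpM2l ?sqr_ge0// lef_pV2 ?posrE ?Wn_gt0//.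
Qed.

Lemma Wn_mono t t' n k : 1 < t' -> t' <= t -> Wn t' n k <= Wn t n k.
Proof.
move=> t1 tt; have t1' : 1 < t by apply: lt_le_trans tt.
elim: n k => [|n IH] k /=; first by rewrite !subr0 lerD2r.
by rewrite lerB// ?lerD2r// ler_wpM2l ?sqr_ge0// lef_pV2 ?posrE ?Wn_gt0.
Qed.

Lemma Wn_cvg t k : 1 < t -> exists l : R, (fun n => Wn t n k) @ \oo --> l.
Proof.
move=> t1; exists (limn (fun n => Wn t n k)).
apply: nonincreasing_is_cvgn; first by apply/nonincreasing_seqP => n; apply: Wn_dec.
by exists (t - 1) => _ [n _ <-]; apply: Wn_ge.
Qed.

(** W is the limit of the decreasing truncations, at the energy t. For N take the
    difference quotient of W between t and a smaller energy t', still > 1: the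
    recursion at both energies gives an equality for N with W_t W_t' in place of
    W_t^2, and W_t' <= W_t. *)
Lemma weyl_pos t : 1 < t -> exists W N : int -> R, exists M : R,
  [/\ forall k, W k = t - q k - p (k + 1) ^+ 2 / W (k + 1),
      forall k, t - 1 <= W k,
      forall k, 1 <= N k <= M &
      forall k, 1 + (p k / W k) ^+ 2 * N k <= N (k - 1)].
Proof.
move=> t1; pose t' := (1 + t) / 2.
have t'1 : 1 < t' by rewrite /t'; lra.
have tt : t' < t by rewrite /t'; lra.
pose Wl s k := limn (fun n => Wn s n k).
have cv s k : 1 < s -> (fun n => Wn s n k) @ \oo --> Wl s k.
  by move=> s1; have [l hl] := Wn_cvg k s1; rewrite /Wl (cvg_lim _ hl).
have Wge s k : 1 < s -> s - 1 <= Wl s k.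
  move=> s1; apply: limr_ge; first by apply/cvg_ex; exists (Wl s k); apply: cv.
  by near=> n; apply: Wn_ge.
have W0 s k : 1 < s -> 0 < Wl s k.
  by move=> s1; apply: lt_le_trans (Wge s k s1); rewrite subr_gt0.
have rec s k : 1 < s -> Wl s k = s - q k - p (k + 1) ^+ 2 / Wl s (k + 1).
  move=> s1; have c1 : (fun n => Wn s n.+1 k) @ \oo --> Wl s k.
    by have := cv s k s1; rewrite -cvg_shiftS.
  apply: (cvg_unique _ c1) => //=.
  apply: cvgB; first exact: cvg_cst.
  apply: cvgM; first exact: cvg_cst.
  apply: cvgV; last exact: cv.
  exact/lt0r_neq0/W0.
have mono k : Wl t' k <= Wl t k.
  apply: ler_lim; [by apply/cvg_ex; eexists; apply: cv|by apply/cvg_ex; eexists; apply: cv|].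
  by near=> n; apply: Wn_mono => //; apply: ltW.
pose N k := (Wl t k - Wl t' k) / (t - t').
have tt0 : 0 < t - t' by rewrite subr_gt0.
have N0 k : 0 <= N k by rewrite divr_ge0 ?subr_ge0// ltW.
have NE k : N (k - 1) = 1 + p k ^+ 2 / (Wl t k * Wl t' k) * N k.
  rewrite /N (rec t)// (rec t')// subrK; field.
  by rewrite !lt0r_neq0 ?W0.
have NS k : 1 + (p k / Wl t k) ^+ 2 * N k <= N (k - 1).
  rewrite NE lerD2l ler_wpM2r// expr_div_n ler_wpM2l ?sqr_ge0//.
  rewrite lef_pV2 ?posrE ?mulr_gt0 ?exprn_gt0 ?W0//.
  by rewrite expr2 ler_pM2l ?W0.
exists (Wl t), N, ((t + 1) / (t - t')); split => //.
- by move=> k; apply: rec.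
- by move=> k; apply: Wge.
move=> k; apply/andP; split.
  have := NS (k + 1); rewrite addrK; apply: le_trans.
  by rewrite lerDl mulr_ge0 ?sqr_ge0.
rewrite ler_wpM2r ?invr_ge0 ?(ltW tt0)//.
have h1 : Wl t k <= t - q k.
  by rewrite {1}rec// gerBl divr_ge0 ?sqr_ge0// ltW// W0.
have [_ qk] := form_bd_entries fb k; move: qk; rewrite ler_norml => /andP[qk _].
have := W0 t' k t'1; lra.
Unshelve. all: by end_near.
Qed.
End Pos.

(** For t < -1 change the sign of q. *)
Theorem weyl p q t : form_bd p q -> 1 < `|t| -> exists W N : int -> R, exists M : R,
  [/\ forall k, W k = t - q k - p (k + 1) ^+ 2 / W (k + 1),
      forall k, 0 < W k * t /\ `|t| - 1 <= `|W k|,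
      forall k, 1 <= N k <= M &
      forall k, 1 + (p k / W k) ^+ 2 * N k <= N (k - 1)].
Proof.
move=> fb; rewrite real_ltr_normr ?num_real// => /orP[t1|t1].
  have [W [N [M [h1 h2 h3 h4]]]] := weyl_pos fb t1.
  exists W, N, M; split => // k; have := h2 k => wk.
  have w0 : 0 < W k by lra.
  split; first by rewrite mulr_gt0//; lra.
  by rewrite !gtr0_norm//; lra.
have [W [N [M [h1 h2 h3 h4]]]] := weyl_pos (form_bd_opp fb) t1.
exists (fun k => - W k), N, M; split => // [k|k|k].
- by rewrite h1 invrN mulrN !opprD !opprK; ring.
- have wk := h2 k; have w0 : 0 < W k by lra.
  split; first by rewrite mulNr -mulrN mulr_gt0//; lra.
  by rewrite normrN (gtr0_norm w0) ltr0_norm; lra.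
by have := h4 k; rewrite invrN mulrN sqrrN.
Qed.

End Weyl.

(** * Expanding polynomials *)

Lemma dvdp_prod_count (F : fieldType) (zs : seq F) (z : F) :
  ('X - z%:P) ^+ count_mem z zs %| \prod_(y <- zs) ('X - y%:P).
Proof.
elim: zs => [|y s IH]; first by rewrite big_nil dvdpp.
rewrite big_cons /= exprD; apply: dvdp_mul => //.
by case: eqP => [->|_]; [rewrite expr1 dvdpp|rewrite expr0 dvd1p].
Qed.

Section LogDerivative.
Local Open Scope complex_scope.
Variable R : realType.

Lemma size_deriv (T : {poly R}) : (1 < size T)%N -> size T^`() = (size T).-1.
Proof.
move=> sT; have T0 : T != 0 by rewrite -size_poly_gt0 ltnW.
apply/eqP; rewrite eqn_leq; apply/andP; split; first by rewrite -ltnS prednK ?lt_size_deriv// ltnW.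
rewrite leqNgt; apply/negP => h.
have : T^`()`_(size T).-2 = 0.
  by apply: nth_default; move: h; case: (size T) sT => [|[|n]].
rewrite coef_deriv; have : T`_(size T).-1 != 0 by rewrite -lead_coefE lead_coef_eq0.
case: (size T) sT => [|[|n]] // _ /= /negPf l0 /eqP.
by rewrite mulrn_eq0 l0.
Qed.

(** Logarithmic derivatives. *)
Lemma prod_derivs (xs : seq R) (c : R) : (forall x, x \in xs -> c - x != 0) ->
  let P := \prod_(x <- xs) ('X - x%:P) in
  let S1 := \sum_(x <- xs) (c - x)^-1 in let S2 := \sum_(x <- xs) (c - x)^-1 ^+ 2 in
  P^`().[c] = P.[c] * S1 /\ P^`()^`().[c] = P.[c] * (S1 ^+ 2 - S2).
Proof.
elim: xs => [|x s IH] h /=; first by rewrite !big_nil derivC deriv0 !horner0 !hornerC expr0n /= subr0 !mulr0.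
have [IH1 IH2] : _ /\ _ := IH (fun y hy => h y (mem_behead (s := x :: s) hy)).
rewrite !big_cons; set P := \prod_(y <- s) _ in IH1 IH2 *.
have cx : c - x != 0 by apply: h; rewrite mem_head.
rewrite derivM derivXsubC mul1r derivD derivM derivXsubC mul1r.
rewrite !(hornerD, hornerM, hornerXsubC, hornerX, hornerC, hornerN) IH1 IH2.
by split; field.
Qed.

(** T T'' - T'^2 = - T^2 * sum 1 / (c - x)^2 for a polynomial with real roots. *)
Lemma sgn_crit (T : {poly R}) (xs : seq R) (c : R) : T != 0 ->
  T = lead_coef T *: \prod_(x <- xs) ('X - x%:P) -> (0 < size xs)%N ->
  T.[c] != 0 -> T^`().[c] = 0 -> T.[c] * T^`()^`().[c] < 0.
Proof.
move=> T0 E xs0 Tc; set t := lead_coef T in E.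
have cx x : x \in xs -> c - x != 0.
  move=> hx; apply: contra Tc => /eqP cx; rewrite E hornerZ mulf_eq0; apply/orP; right.
  by rewrite horner_prod prodf_seq_eq0; apply/hasP; exists x; rewrite // hornerXsubC cx eqxx.
have [D1 D2] := prod_derivs cx; move: Tc; rewrite E !derivZ !hornerZ D1 D2.
set P := (\prod_(x <- xs) _).[c]; set S1 := \sum_(x <- xs) _; set S2 := \sum_(x <- xs) _.
rewrite mulf_eq0 negb_or => /andP[t0 P0] /eqP; rewrite !mulf_eq0 (negPf t0) (negPf P0) /= => /eqP->.
rewrite expr0n /= sub0r.
have S20 : 0 < S2.
  rewrite /S2; case: (xs) xs0 cx => // x s _ cx; rewrite big_cons.
  apply: ltr_pwDl; first by rewrite exprn_even_gt0//= invr_eq0 cx// mem_head.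
  by apply: sumr_ge0 => y _; apply: sqr_ge0.
have -> : t * P * (t * (P * - S2)) = - ((t * P) ^+ 2 * S2) by ring.
rewrite oppr_lt0 mulr_gt0// exprn_even_gt0//= mulf_neq0//.
Qed.

(** T'/T is a sum of terms of the same sign outside the convex hull of the roots. *)
Lemma crit_in_hull (T : {poly R}) (xs : seq R) (c : R) : T != 0 ->
  T = lead_coef T *: \prod_(x <- xs) ('X - x%:P) -> (0 < size xs)%N ->
  (forall x, x \in xs -> `|x| <= 1) ->
  T^`().[c] = 0 -> `|c| <= 1.
Proof.
move=> T0 E xs0 hx Tc; rewrite leNgt; apply/negP => c1.
have cx x : x \in xs -> c - x != 0.
  move=> hx'; rewrite subr_eq0; apply: contraTneq c1 => ->.
  by rewrite -leNgt hx.
have [D1 _] := prod_derivs cx; move: Tc; rewrite E derivZ hornerZ D1 => /eqP.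
have P0 : (\prod_(x <- xs) ('X - x%:P)).[c] != 0.
  rewrite horner_prod prodf_seq_neq0; apply/allP => x hx' /=.
  by rewrite hornerXsubC cx.
rewrite !mulf_eq0 lead_coef_eq0 (negPf T0) (negPf P0) /= => /eqP S0.
move: c1; rewrite real_ltr_normr ?num_real// => /orP[c1|c1].
  suff : 0 < \sum_(x <- xs) (c - x)^-1 by rewrite S0 ltxx.
  case: (xs) xs0 hx => // x s _ hx; rewrite big_cons; apply: ltr_pwDl.
    rewrite invr_gt0; have := hx x (mem_head _ _); rewrite ler_norml; lra.
  rewrite big_seq; apply: sumr_ge0 => y hy; rewrite invr_ge0.
  have := hx y (mem_behead (s := x :: s) hy); rewrite ler_norml; lra.
suff : \sum_(x <- xs) (c - x)^-1 < 0 by rewrite S0 ltxx.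
case: (xs) xs0 hx => // x s _ hx; rewrite big_cons -oppr_gt0 opprD; apply: ltr_pwDl.
  rewrite oppr_gt0 invr_lt0; have := hx x (mem_head _ _); rewrite ler_norml; lra.
rewrite oppr_ge0 big_seq; apply: sumr_le0 => y hy; rewrite invr_le0.
have := hx y (mem_behead (s := x :: s) hy); rewrite ler_norml; lra.
Qed.

End LogDerivative.

Section Expanding.
Local Open Scope complex_scope.
Variable R : realType.
Local Notation C := R[i].
Implicit Types (T : {poly R}).

Lemma normcR (x : R) : normc x%:C = `|x|.
Proof. by rewrite /normc /= expr0n /= addr0 sqrtr_sqr. Qed.

Lemma complexifyE T (x : R) : (complexify T).[x%:C] = (T.[x])%:C.
Proof. by rewrite /complexify horner_map. Qed.

Lemma complexify_deriv T : (complexify T)^`() = complexify (T^`()).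
Proof. by rewrite /complexify deriv_map. Qed.

Lemma size_complexify T : size (complexify T) = size T.
Proof. by rewrite /complexify size_map_poly. Qed.

Lemma complexify_comp T1 T2 : complexify (T2 \Po T1) = complexify T2 \Po complexify T1.
Proof. by rewrite /complexify map_comp_poly. Qed.

Lemma unit_segmentP (z : C) : unit_segment R z <-> exists2 x : R, z = x%:C & `|x| <= 1.
Proof.
split=> [[x /=]|[x -> hx]].
  by rewrite in_itv /= => hx <-; exists x => //; rewrite ler_norml.
by exists x => //=; rewrite in_itv /= -ler_norml.
Qed.

(** Simple roots, in a form stable under products and compositions. *)
Lemma mup1P (f : {poly C}) (z : C) : f != 0 ->
  mup z f = 1%N <-> exists2 g, f = ('X - z%:P) * g & g.[z] != 0.
Proof.
move=> f0; split=> [m1|[g fE gz]].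
  have /dvdpP[g fE] : 'X - z%:P %| f by rewrite XsubC_dvd// m1.
  exists g; first by rewrite fE mulrC.
  apply/negP => gz; have /dvdpP[h gE] : 'X - z%:P %| g by rewrite dvdp_XsubCl.
  have : (2 <= mup z f)%N by rewrite mup_geq// fE gE -mulrA -expr2 dvdp_mulIr.
  by rewrite m1.
by rewrite fE mupMl ?(mup_XsubCX 1) ?eqxx// -['X - _]expr1 mup_XsubCX eqxx.
Qed.

(** The roots of T are in the preimage of [-1, 1], hence real and in [-1, 1]; the
    critical points are real, simple and in the hull of the roots. *)
Lemma expanding_critical T : expanding T -> exists cs, critical T cs /\
   forall z, critical_point T z <-> exists2 c, c \in cs & z = c%:C.
Proof.
case=> sT lT crit val pre.
have T0 : T != 0 by rewrite -lead_coef_eq0 lt0r_neq0.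
have dT0 : T^`() != 0.
  by rewrite -size_poly_gt0 size_deriv//; lia.
have sD : size T^`() = (size T).-1.
  by rewrite size_deriv//; lia.
have lD : lead_coef T^`() = lead_coef T * (size T).-1%:R.
  by rewrite mulr_natr /lead_coef sD coef_deriv; case: (size T) sT => [|[|[|n]]].
have [zs Ezs] := closed_field_poly_normal (complexify T)^`().
have zcrit z : critical_point T z <-> z \in zs.
  rewrite /critical_point Ezs rootZ ?root_prod_XsubC//.
  by rewrite lead_coef_eq0 complexify_deriv /complexify map_poly_eq0.
have zreal z : z \in zs -> z = (complex.Re z)%:C.
  by move=> /zcrit /crit[/RRe_real ->].
pose cs := [seq complex.Re z | z <- zs].
have zsE : zs = [seq c%:C | c <- cs].
  rewrite /cs -map_comp -[LHS]map_id; apply/eq_in_map => z hz /=; exact: zreal.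
have leadC : lead_coef (complexify T)^`() = (lead_coef T^`())%:C.
  by rewrite complexify_deriv /complexify lead_coef_map.
have DE : T^`() = lead_coef T^`() *: nodal cs.
  apply: (@map_poly_inj _ _ (real_complex R)).
  rewrite -/(complexify _) -complexify_deriv Ezs leadC zsE /nodal.
  rewrite map_polyZ rmorph_prod big_map; congr (_ *: _); apply: eq_bigr => c _.
  by rewrite rmorphB /= map_polyX map_polyC.
have sc : size T = (size cs).+2.
  move: sD; rewrite DE size_scale ?size_nodal; last by rewrite lead_coef_eq0.
  by move=> E; rewrite E prednK// (leq_trans _ sT).
have cs0 : (0 < size cs)%N by move: sT; rewrite sc.
have mem c : c \in cs -> c%:C \in zs by rewrite zsE mem_map//; apply: complexI.
have root_c c : c \in cs -> T^`().[c] = 0.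
  move=> /mem /zcrit; rewrite /critical_point complexify_deriv /root complexifyE => /eqP h.
  by apply: complexI.
have csu : uniq cs.
  rewrite -(map_inj_uniq (@complexI R)) -zsE; apply: count_mem_uniq => z.
  have [hz|hz] := boolP (z \in zs); last by apply/count_memPn.
  have [_ mz] := crit z ((zcrit z).2 hz).
  have dC0 : (complexify T)^`() != 0 by rewrite complexify_deriv /complexify map_poly_eq0.
  apply/eqP; rewrite eqn_leq -has_count has_pred1 hz andbT leqNgt; apply/negP => c2.
  have : (2 <= mup z (complexify T)^`())%N.
    rewrite mup_geq// Ezs dvdpZr ?lead_coef_eq0//.
    apply: dvdp_trans (dvdp_prod_count zs z).
    by rewrite -[X in _ %| _ ^+ X](subnK c2) exprD dvdp_mulIr.
  by rewrite mz.
have [ws Ews] := closed_field_poly_normal (complexify T).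
have wreal z : z \in ws -> exists2 x : R, z = x%:C & `|x| <= 1.
  move=> hz; apply/unit_segmentP/pre; rewrite /preimage_segment /=; apply/unit_segmentP.
  exists 0; last by rewrite normr0 ler01.
  by apply/eqP; rewrite Ews -/(root _ _) rootZ ?root_prod_XsubC// lead_coef_eq0 /complexify map_poly_eq0.
pose xs := [seq complex.Re z | z <- ws].
have wsE : ws = [seq c%:C | c <- xs].
  rewrite /xs -map_comp -[LHS]map_id; apply/eq_in_map => z hz /=.
  by have [x ->] := wreal z hz.
have TE : T = lead_coef T *: \prod_(x <- xs) ('X - x%:P).
  apply: (@map_poly_inj _ _ (real_complex R)).
  rewrite -/(complexify _) Ews wsE /complexify lead_coef_map.
  rewrite map_polyZ rmorph_prod big_map; congr (_ *: _); apply: eq_bigr => c _.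
  by rewrite rmorphB /= map_polyX map_polyC.
have xs1 x : x \in xs -> `|x| <= 1.
  by move=> /mapP[z hz ->]; have [y ->] := wreal z hz.
have sxs : (0 < size xs)%N.
  have := congr1 (fun p : {poly R} => size p) TE; rewrite size_scale ?lead_coef_eq0//.
  by rewrite size_prod_XsubC => E; move: sT; rewrite E ltnS => /ltnW.
have cval c : c \in cs -> 1 < `|T.[c]|.
  by move=> /mem /zcrit /val; rewrite complexifyE normcR.
exists cs; split; last first.
  move=> z; rewrite zcrit zsE; split=> [/mapP[c hc ->]|[c hc ->]]; first by exists c.
  by apply/mapP; exists c.
split => //.
- by rewrite {1}DE lD sc.
- by move=> c hc; apply: (crit_in_hull T0 TE sxs xs1); apply: root_c.
- move=> c hc; have Tc0 : T.[c] != 0.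
    by rewrite -normr_gt0 (lt_trans ltr01)// cval.
  have := sgn_crit T0 TE sxs Tc0 (root_c c hc).
  rewrite DE derivZ hornerZ (nodal_deriv csu hc) lD mulrCA pmulr_rlt0// mulr_gt0//.
  by rewrite ltr0n sc.
- by exists xs; split.
Qed.

(** A critical point of the composition is critical for T1 or is sent by T1 to one of
    T2, and never both: the critical points of T2 are in [-1, 1] and the critical
    values of T1 are not. *)
Lemma expanding_comp T1 T2 : expanding T1 -> expanding T2 -> expanding (T2 \Po T1).
Proof.
move=> E1 E2; have [cs1 [C1 P1]] := expanding_critical E1.
have [cs2 [C2 P2]] := expanding_critical E2.
case: E1 => s1 l1 crit1 val1 pre1; case: E2 => s2 l2 crit2 val2 pre2.
have T10 : T1 != 0 by rewrite -lead_coef_eq0 lt0r_neq0.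
have T20 : T2 != 0 by rewrite -lead_coef_eq0 lt0r_neq0.
have sT : (2 < size (T2 \Po T1))%N.
  have := size_comp_poly T2 T1; rewrite (crit_size C1) (crit_size C2) /=.
  have h4 : (2 * 2 <= (size cs2).+1 * (size cs1).+1)%N.
    by apply: leq_mul; rewrite ltnS ?(crit_nil C1) ?(crit_nil C2).
  by move=> E; move: h4; rewrite -E; case: (size _) => [|[|[|n]]].
have dE : (complexify (T2 \Po T1))^`() =
   ((complexify T2)^`() \Po complexify T1) * (complexify T1)^`().
  by rewrite complexify_comp deriv_comp.
have seg2 (x : R) : `|T2.[x]| <= 1 -> `|x| <= 1.
  move=> h; have : unit_segment R x%:C.
    by apply: pre2; apply/unit_segmentP; exists T2.[x]; rewrite // complexifyE.
  by case/unit_segmentP => y /complexI ->.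
have crit_real2 z : critical_point T2 z -> exists2 c, c \in cs2 & z = c%:C.
  by move=> /P2.
have d0 : (complexify (T2 \Po T1))^`() != 0.
  rewrite complexify_deriv /complexify map_poly_eq0 -size_poly_eq0.
  by rewrite -lead_coef_eq0 in T10; rewrite size_deriv//; lia.
have dn i (T : {poly R}) (cs : seq R) : critical T cs -> ((complexify T)^`() != 0) && (i == i :> nat).
  move=> CT; rewrite eqxx andbT complexify_deriv /complexify map_poly_eq0 -size_poly_eq0.
  by rewrite size_deriv// (crit_size CT).
have d10 : (complexify T1)^`() != 0 by have := dn 0%N _ _ C1; rewrite eqxx andbT.
have d20 : (complexify T2)^`() != 0 by have := dn 0%N _ _ C2; rewrite eqxx andbT.
split => //.
- by rewrite lead_coef_comp ?mulr_gt0 ?exprn_gt0// (crit_size C1).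
- move=> z hz; rewrite /critical_point dE /root hornerM horner_comp mulf_eq0 in hz.
  move: hz; have [h1 _|h1 /= h2] := eqVneq ((complexify T1)^`().[z]) 0.
    have cz : critical_point T1 z by apply/eqP.
    have [zr m1] := crit1 z cz; split => //; apply/(mup1P _ d0).
    have [g gE gz] := (mup1P _ d10).1 m1.
    exists (g * ((complexify T2)^`() \Po complexify T1)); first by rewrite dE gE; ring.
    rewrite hornerM mulf_neq0// horner_comp; apply/negP => h2.
    have [c hc zE] := (P1 z).1 cz; have [y hy] := (P2 _).1 h2.
    rewrite zE complexifyE => /complexI yE.
    by have := crit_in C2 hy; rewrite -yE leNgt (crit_val C1 hc).
  rewrite orbF in h2; have [y hy yE] := (P2 _).1 h2.
  have zr : unit_segment R z.
    by apply: pre1; apply/unit_segmentP; exists y => //; apply: (crit_in C2).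
  have [x zE _] := (unit_segmentP _).1 zr.
  split; first by apply/complex_realP; exists x.
  apply/(mup1P _ d0).
  have [_ m2] := crit2 _ h2; have [g gE gz] := (mup1P _ d20).1 m2.
  have /factor_theorem[f fE] : root (complexify T1 - (complexify T1).[z]%:P) z.
    by rewrite /root hornerD hornerN hornerC subrr.
  have fz : f.[z] = (complexify T1)^`().[z].
    have := congr1 (fun p : {poly C} => p^`().[z]) fE.
    rewrite /= derivD derivN derivC subr0 derivM derivXsubC mulr1 hornerD hornerM.
    by rewrite hornerXsubC subrr mulr0 add0r => ->.
  exists (f * (g \Po complexify T1) * (complexify T1)^`()).
    rewrite dE gE comp_polyM comp_polyB comp_polyX comp_polyC fE; ring.
  by rewrite !hornerM horner_comp !mulf_neq0// fz.
- move=> z; rewrite {1}/critical_point dE /root hornerM horner_comp mulf_eq0.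
  rewrite complexify_comp horner_comp => /orP[h2|h1]; first exact: val2.
  have [c hc zE] := (P1 z).1 h1.
  rewrite zE !complexifyE normcR ltNge; apply/negP => /seg2.
  by rewrite leNgt (crit_val C1 hc).
move=> z; rewrite /preimage_segment /= complexify_comp horner_comp => h.
by apply: pre1; apply: pre2.
Qed.

(** T is its leading coefficient times at least two factors of modulus >= |x| - 1,
    the others being at least 1. *)
Lemma critical_growth T cs (x : R) : critical T cs -> 1 <= lead_coef T -> 4 <= `|x| ->
  `|x| <= `|T.[x]|.
Proof.
move=> CT t1 x4; have [xs [TE xs1]] := crit_roots CT.
have sxs : (2 <= size xs)%N.
  have := congr1 (fun p : {poly R} => size p) TE; rewrite /= size_scale ?lt0r_neq0 ?(crit_lead CT)//.
  by rewrite size_prod_XsubC (crit_size CT) => -[<-]; rewrite ltnS (crit_nil CT).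
rewrite TE hornerZ normrM horner_prod normr_prod.
have prodge ys : (forall y, y \in ys -> `|y| <= 1) -> 1 <= \prod_(y <- ys) `|('X - y%:P).[x]|.
  elim: ys => [|y s IH] h; first by rewrite big_nil.
  rewrite big_cons -[leLHS]mulr1 ler_pM// ?IH//.
    rewrite hornerXsubC; have := lerB_dist x y; have := h y (mem_head _ _); lra.
  by move=> u hu; apply: h; rewrite inE hu orbT.
case: xs sxs xs1 {TE} => [//|y1 [//|y2 s]] _ h; rewrite !big_cons.
have hs := prodge s (fun y hy => h y (mem_behead (s := y1 :: _) (mem_behead (s := y2 :: _) hy))).
have a1 : `|x| - 1 <= `|('X - y1%:P).[x]|.
  rewrite hornerXsubC; have := lerB_dist x y1; have := h y1 (mem_head _ _); lra.
have a2 : `|x| - 1 <= `|('X - y2%:P).[x]|.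
  rewrite hornerXsubC; have := lerB_dist x y2.
  have := h y2; rewrite !inE eqxx orbT => /(_ isT); lra.
rewrite (ger0_norm (le_trans ler01 t1)).
set A := `|_.[x]| in a1 *; set B := `|_.[x]| in a2 *; set P := \prod_(_ <- s) _ in hs *.
have AB : `|x| <= A * B by nra.
apply: (le_trans AB); rewrite -[leLHS]mul1r ler_pM//; first by nra.
by rewrite mulrA ler_peMr//; nra.
Qed.

End Expanding.

(** * Summation over the integers *)

Section Sums.
Local Open Scope complex_scope.
Variable R : realType.
Implicit Types x y z : int -> R.

Definition nsum x : R := fine (\esum_(k in [set: int]) (x k)%:E).
Definition nfin x : Prop :=
  (forall k, 0 <= x k) /\ (\esum_(k in [set: int]) (x k)%:E < +oo)%E.

Lemma nfinE x : nfin x -> (\esum_(k in [set: int]) (x k)%:E)%E = (nsum x)%:E.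
Proof.
move=> [x0 xf]; rewrite fineK// ge0_fin_numE//.
by apply: esum_ge0 => k _; rewrite lee_fin.
Qed.

Lemma nfin_le x y : (forall k, 0 <= x k <= y k) -> nfin y -> nfin x /\ nsum x <= nsum y.
Proof.
move=> xy yf; have le : (\esum_(k in [set: int]) (x k)%:E <= \esum_(k in [set: int]) (y k)%:E)%E.
  by apply: le_esum => k _; rewrite lee_fin; case/andP: (xy k).
have xf : nfin x.
  split; first by move=> k; case/andP: (xy k).
  by apply: le_lt_trans le yf.2.
by split => //; rewrite -lee_fin -!nfinE.
Qed.

Lemma nsumD x y : nfin x -> nfin y ->
  nfin (fun k => x k + y k) /\ nsum (fun k => x k + y k) = nsum x + nsum y.
Proof.
move=> xf yf.
have E : (\esum_(k in [set: int]) (x k + y k)%:E = (nsum x + nsum y)%:E)%E.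
  rewrite EFinD -!nfinE// -esumD.
  - by apply: eq_esum => k _; rewrite EFinD.
  - by move=> k _; rewrite lee_fin xf.1.
  - by move=> k _; rewrite lee_fin yf.1.
split; last by rewrite /nsum E.
by split; [move=> k; rewrite addr_ge0 ?xf.1 ?yf.1|rewrite E ltry].
Qed.

Lemma nfin0 : nfin (fun=> 0) /\ nsum (fun=> 0) = 0.
Proof.
have E : (\esum_(k in [set: int]) (0 : R)%:E = 0)%E by apply: esum1.
by split; [split=> //; rewrite E|rewrite /nsum E].
Qed.

Lemma nsumZ c x : 0 <= c -> nfin x ->
  nfin (fun k => c * x k) /\ nsum (fun k => c * x k) = c * nsum x.
Proof.
move=> c0 xf.
have ge0 : 0 <= c by [].
have le c' y : 0 <= c' -> nfin y -> nfin (fun k => c' * y k) /\ nsum (fun k => c' * y k) <= c' * nsum y.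
  move=> c'0 yf; have H := esumZ c'0 yf.1; rewrite nfinE// -EFinM in H.
  have f : nfin (fun k => c' * y k).
    by split; [move=> k; rewrite mulr_ge0 ?yf.1|apply: le_lt_trans H _; rewrite ltry].
  by split=> //; rewrite -lee_fin -nfinE.
have [f1 l1] := le c x c0 xf; split => //.
apply/eqP; rewrite eq_le l1 /=.
have [->|cn] := eqVneq c 0; first by rewrite mul0r fine_ge0// esum_ge0// => k _; rewrite lee_fin mul0r.
have cp : 0 < c by rewrite lt0r cn.
have ci : 0 <= c^-1 by rewrite invr_ge0.
have [_ l2] := le c^-1 _ ci f1.
rewrite mulrC -ler_pdivlMr// mulrC; apply: le_trans l2.
rewrite le_eqVlt; apply/orP; left; apply/eqP; congr nsum; apply/funext => k.
by rewrite mulKf.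
Qed.

Lemma eq_nsum x y : x =1 y -> nsum x = nsum y.
Proof. by move=> e; congr nsum; apply/funext. Qed.
Lemma eq_nfin x y : x =1 y -> nfin x -> nfin y.
Proof. by move=> e; have -> : x = y by apply/funext. Qed.

(** The positive and negative parts may be replaced by any decomposition into
    summable nonnegative families, which makes [zsum] additive. *)
Lemma zsum_diff x y z : nfin y -> nfin z -> (forall k, x k = y k - z k) ->
  zsum x = nsum y - nsum z.
Proof.
move=> yf zf xE.
have pf : nfin (fun k => Num.max (x k) 0).
  apply: (nfin_le _ yf).1 => k; rewrite le_max lexx orbT /=.
  by rewrite xE ge_max yf.1 andbT lerBlDr lerDl zf.1.
have nf : nfin (fun k => Num.max (- x k) 0).
  apply: (nfin_le _ zf).1 => k; rewrite le_max lexx orbT /=.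
  by rewrite xE opprB ge_max zf.1 andbT lerBlDr lerDl yf.1.
have [_ E1] := nsumD pf zf; have [_ E2] := nsumD nf yf.
have E3 : nsum (fun k => Num.max (x k) 0 + z k) = nsum (fun k => Num.max (- x k) 0 + y k).
  apply: eq_nsum => k; rewrite xE; case: (leP (y k - z k) 0) => h.
    by rewrite max_l ?oppr_ge0//; ring.
  by rewrite max_r ?oppr_le0 ?ltW//; ring.
rewrite /zsum -/(nsum _) -/(nsum (fun k => Num.max (- x k) 0)).
by move: E3; rewrite E1 E2; lra.
Qed.

Definition summ x := nfin (fun k => `|x k|).

Lemma summ_le x y : (forall k, `|x k| <= y k) -> nfin y -> summ x.
Proof. by move=> h yf; apply: (nfin_le _ yf).1 => k; rewrite normr_ge0 h. Qed.

Lemma summ_parts x : summ x ->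
  nfin (fun k => Num.max (x k) 0) /\ nfin (fun k => Num.max (- x k) 0).
Proof.
move=> xf; split; apply: (nfin_le _ xf).1 => k; rewrite le_max lexx orbT /= ge_max normr_ge0 andbT.
  exact: ler_norm.
by rewrite -normrN; exact: ler_norm.
Qed.

Lemma parts_diff x k : x k = Num.max (x k) 0 - Num.max (- x k) 0.
Proof.
case: (leP (x k) 0) => h; first by rewrite max_l ?oppr_ge0//; ring.
by rewrite max_r ?oppr_le0 ?ltW//; ring.
Qed.

Lemma zsumD x y : summ x -> summ y -> zsum (fun k => x k + y k) = zsum x + zsum y.
Proof.
move=> /summ_parts[xp xn] /summ_parts[yp yn].
have [f1 e1] := nsumD xp yp; have [f2 e2] := nsumD xn yn.
rewrite (zsum_diff f1 f2); last first.
  by move=> k; rewrite {1}(parts_diff x) {1}(parts_diff y); ring.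
rewrite e1 e2 (zsum_diff xp xn); last exact: parts_diff.
rewrite (zsum_diff yp yn); last exact: parts_diff.
ring.
Qed.

Lemma zsumZ c x : summ x -> zsum (fun k => c * x k) = c * zsum x.
Proof.
move=> /summ_parts[xp xn]; rewrite [in RHS](zsum_diff xp xn); last exact: parts_diff.
have [c0|c0] := leP 0 c.
  have [f1 e1] := nsumZ c0 xp; have [f2 e2] := nsumZ c0 xn.
  rewrite (zsum_diff f1 f2) ?e1 ?e2; first by ring.
  by move=> k; rewrite {1}(parts_diff x); ring.
have c0' : 0 <= - c by rewrite oppr_ge0 ltW.
have [f1 e1] := nsumZ c0' xp; have [f2 e2] := nsumZ c0' xn.
rewrite (zsum_diff f2 f1) ?e1 ?e2; first by ring.
by move=> k; rewrite {1}(parts_diff x); ring.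
Qed.

Lemma zsum_nonneg x : nfin x -> zsum x = nsum x.
Proof.
move=> xf; have [f0 e0] := nfin0; rewrite (zsum_diff xf f0) ?e0 ?subr0//.
by move=> k; rewrite subr0.
Qed.

Lemma eq_zsum x y : x =1 y -> zsum x = zsum y.
Proof. by move=> e; have -> : x = y by apply/funext. Qed.

Lemma nsum_single j x : 0 <= x j -> (forall k, k != j -> x k = 0) ->
  nfin x /\ nsum x = x j.
Proof.
move=> xj h.
have E : (\esum_(k in [set: int]) (x k)%:E = (x j)%:E)%E.
  rewrite -(@esum_set1 R int j (fun k => (x k)%:E)) ?lee_fin//.
  rewrite [RHS]esum_mkcond; apply: eq_esum => k _.
  case: (eqVneq k j) => [->|kj]; first by rewrite mem_set.
  by rewrite memNset ?h//; apply/eqP.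
split; last by rewrite /nsum E.
split; last by rewrite E ltry.
by move=> k; case: (eqVneq k j) => [->//|kj]; rewrite h.
Qed.

Lemma zsum_single j x : (forall k, k != j -> x k = 0) -> zsum x = x j.
Proof.
move=> h.
have h1 : 0 <= Num.max (x j) 0 by rewrite le_max lexx orbT.
have h2 : 0 <= Num.max (- x j) 0 by rewrite le_max lexx orbT.
have h3 k : k != j -> Num.max (x k) 0 = 0 by move=> /h ->; rewrite maxxx.
have h4 k : k != j -> Num.max (- x k) 0 = 0 by move=> /h ->; rewrite oppr0 maxxx.
have [f1 e1] := @nsum_single j (fun k => Num.max (x k) 0) h1 h3.
have [f2 e2] := @nsum_single j (fun k => Num.max (- x k) 0) h2 h4.
by rewrite (zsum_diff f1 f2 (parts_diff x)) e1 e2 -parts_diff.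
Qed.

Section Reindex.
Local Open Scope complex_scope.
Variables (a b : int).
Hypothesis b0 : b != 0.

Lemma nsum_emb x : (forall j, 0 <= x j) ->
  (\esum_(k in [set: int]) (x (a + b * k))%:E <= \esum_(j in [set: int]) (x j)%:E)%E /\
  ((forall j, ~~ (b %| j - a)%Z -> x j = 0) ->
   (\esum_(k in [set: int]) (x (a + b * k))%:E = \esum_(j in [set: int]) (x j)%:E)%E).
Proof.
move=> x0; pose e (k : int) := a + b * k.
pose D := [set j : int | (b %| j - a)%Z].
have bij : set_bij [set: int] D e.
  split.
  - by move=> k _; rewrite /D /e /= addrC addKr dvdz_mulr.
  - by move=> k l _ _ /addrI /(mulfI b0).
  - move=> j /dvdzP[q jq]; exists q => //; rewrite /e mulrC -jq; ring.
have E : (\esum_(j in D) (x j)%:E = \esum_(k in [set: int]) (x (a + b * k))%:E)%E.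
  by rewrite (reindex_esum _ _ _ _ bij).
rewrite -E [X in (X <= _)%E]esum_mkcond; split.
  by apply: le_esum => j _; case: ifP => // _; rewrite lee_fin.
move=> h; rewrite esum_mkcond; apply: eq_esum => j _.
by case: ifPn => // /negP jD; rewrite h//; apply/negP => jb; apply: jD; rewrite inE.
Qed.

Lemma nfin_emb x : nfin x -> nfin (fun k => x (a + b * k)).
Proof.
move=> [x0 xf]; split; first by move=> k.
by apply: le_lt_trans xf; have [] := nsum_emb x0.
Qed.

Lemma zsum_emb x : summ x -> (forall j, ~~ (b %| j - a)%Z -> x j = 0) ->
  zsum x = zsum (fun k => x (a + b * k)).
Proof.
move=> /summ_parts[xp xn] h.
rewrite (zsum_diff xp xn (parts_diff x)).
rewrite (zsum_diff (nfin_emb xp) (nfin_emb xn)); last by move=> k; exact: parts_diff.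
have [_ E1] := nsum_emb xp.1; have [_ E2] := nsum_emb xn.1.
by rewrite /nsum E1 ?E2// => j /h ->; rewrite ?oppr0 maxxx.
Qed.

End Reindex.
End Sums.

(** * The Hilbert space structure *)

Section Inner.
Local Open Scope complex_scope.
Variable R : realType.
Local Notation C := R[i].
Local Notation l2 := (l2 R).
Implicit Types f g h : l2.
Local Notation "''n' f" := (l2norm f) (at level 8, format "''n' f").

Lemma nfin_sq f : nfin (fun k => normc (f k) ^+ 2).
Proof.
split; first by move=> k; apply: sqr_ge0.
exact/asboolP/(l2valP f).
Qed.

Lemma l2norm2 f : l2norm f ^+ 2 = nsum (fun k => normc (f k) ^+ 2).
Proof. by rewrite l2norm_sq. Qed.

Lemma l2D f g k : l2val (f + g) k = f k + g k. Proof. by []. Qed.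
Lemma l2Z (a : C) f k : l2val (a *: f) k = a * f k. Proof. by []. Qed.
Lemma l2N f k : l2val (- f) k = - f k. Proof. by []. Qed.
Lemma l2B f g k : l2val (f - g) k = f k - g k. Proof. by []. Qed.
Lemma l20 k : l2val (0 : l2) k = 0. Proof. by []. Qed.

Lemma l2P f g : (forall k, f k = g k) -> f = g.
Proof. by move=> e; apply: val_inj; apply/funext. Qed.

Lemma Re_le_normc (z : C) : `|complex.Re z| <= normc z.
Proof. by case: z => x y /=; rewrite -sqrtr_sqr ler_wsqrtr// lerDl sqr_ge0. Qed.
Lemma Im_le_normc (z : C) : `|complex.Im z| <= normc z.
Proof. by case: z => x y /=; rewrite -sqrtr_sqr ler_wsqrtr// lerDr sqr_ge0. Qed.
Lemma normcJ' (z : C) : normc z^* = normc z.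
Proof. by case: z => x y /=; rewrite sqrrN. Qed.

Lemma dot_normc f g k : normc ((f k)^* * g k) <= normc (f k) ^+ 2 + normc (g k) ^+ 2.
Proof.
rewrite normcM normcJ'; have := sqr_ge0 (normc (f k) - normc (g k)).
have := normc_nneg (f k); have := normc_nneg (g k).
set x := normc _; set y := normc _ => x0 y0; nra.
Qed.

Lemma dot_sq_nfin f g : nfin (fun k => normc (f k) ^+ 2 + normc (g k) ^+ 2).
Proof. exact: (nsumD (nfin_sq f) (nfin_sq g)).1. Qed.

Lemma summ_Re f g : summ (fun k => complex.Re ((f k)^* * g k)).
Proof.
apply: (summ_le _ (dot_sq_nfin f g)) => k.
exact: le_trans (Re_le_normc _) (dot_normc f g k).
Qed.
Lemma summ_Im f g : summ (fun k => complex.Im ((f k)^* * g k)).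
Proof.
apply: (summ_le _ (dot_sq_nfin f g)) => k.
exact: le_trans (Im_le_normc _) (dot_normc f g k).
Qed.

Lemma dotDr f g h : l2dot f (g + h) = l2dot f g + l2dot f h.
Proof.
apply/eqP; rewrite eq_complex; apply/andP; split; apply/eqP => /=.
  rewrite -(zsumD (summ_Re f g) (summ_Re f h)); apply: eq_zsum => k.
  transitivity (complex.Re ((f k)^* * (g k + h k))); first by [].
  by rewrite mulrDr; case: (_ * _) => ? ?; case: (_ * _).
rewrite -(zsumD (summ_Im f g) (summ_Im f h)); apply: eq_zsum => k.
transitivity (complex.Im ((f k)^* * (g k + h k))); first by [].
by rewrite mulrDr; case: (_ * _) => ? ?; case: (_ * _).
Qed.

Lemma summZ c (x : int -> R) : summ x -> summ (fun k => c * x k).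
Proof.
move=> xf; apply: (eq_nfin (x := fun k => `|c| * `|x k|)).
  by move=> k; rewrite normrM.
by apply: (nsumZ _ xf).1.
Qed.

Lemma dotZr (a : C) f g : l2dot f (a *: g) = a * l2dot f g.
Proof.
case: a => ar ai; apply/eqP; rewrite eq_complex; apply/andP; split; apply/eqP => /=.
  rewrite -(zsumZ _ (summ_Re f g)) -(zsumZ _ (summ_Im f g)).
  rewrite -mulN1r -(zsumZ _ (summZ _ (summ_Im f g))).
  rewrite -(zsumD (summZ _ (summ_Re f g)) (summZ _ (summZ _ (summ_Im f g)))).
  apply: eq_zsum => k; transitivity (complex.Re ((f k)^* * ((ar +i* ai) * g k))); first by [].
  by case: (f k) => ? ?; case: (g k) => ? ? /=; ring.
rewrite -(zsumZ _ (summ_Im f g)) -(zsumZ _ (summ_Re f g)).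
rewrite -(zsumD (summZ _ (summ_Im f g)) (summZ _ (summ_Re f g))).
apply: eq_zsum => k; transitivity (complex.Im ((f k)^* * ((ar +i* ai) * g k))); first by [].
by case: (f k) => ? ?; case: (g k) => ? ? /=; ring.
Qed.

Lemma dotC f g : l2dot g f = (l2dot f g)^*.
Proof.
apply/eqP; rewrite eq_complex; apply/andP; split; apply/eqP => /=.
  by apply: eq_zsum => k; case: (f k) => ? ?; case: (g k) => ? ? /=; ring.
rewrite -mulN1r -(zsumZ _ (summ_Im f g)); apply: eq_zsum => k.
by case: (f k) => ? ?; case: (g k) => ? ? /=; ring.
Qed.

Lemma dotDl f g h : l2dot (f + g) h = l2dot f h + l2dot g h.
Proof. by rewrite (dotC h) dotDr rmorphD (dotC h f) (dotC h g). Qed.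
Lemma dotZl (a : C) f g : l2dot (a *: f) g = a^* * l2dot f g.
Proof. by rewrite (dotC g) dotZr rmorphM (dotC g f). Qed.
Lemma dotNr f g : l2dot f (- g) = - l2dot f g.
Proof. by rewrite -scaleN1r dotZr mulN1r. Qed.
Lemma dotNl f g : l2dot (- f) g = - l2dot f g.
Proof. by rewrite (dotC g) dotNr rmorphN (dotC g f). Qed.
Lemma dotBr f g h : l2dot f (g - h) = l2dot f g - l2dot f h.
Proof. by rewrite dotDr dotNr. Qed.
Lemma dotBl f g h : l2dot (f - g) h = l2dot f h - l2dot g h.
Proof. by rewrite dotDl dotNl. Qed.
Lemma dot0r f : l2dot f 0 = 0.
Proof. by rewrite -(scale0r (0 : l2)) dotZr mul0r. Qed.

Lemma dotff f : l2dot f f = (l2norm f ^+ 2)%:C.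
Proof.
apply/eqP; rewrite eq_complex; apply/andP; split; apply/eqP => /=.
  rewrite l2norm2 -zsum_nonneg; last exact: nfin_sq.
  apply: eq_zsum => k; case: (f k) => x y /=.
  by rewrite sqr_sqrtr ?addr_ge0 ?sqr_ge0//; ring.
have [f0 e0] := nfin0 R; rewrite -[RHS]e0 -(zsum_nonneg f0); apply: eq_zsum => k.
by case: (f k) => x y /=; ring.
Qed.

Lemma dot_ketl j g : l2dot (ket R j) g = g j.
Proof.
apply/eqP; rewrite eq_complex; apply/andP; split; apply/eqP => /=.
  rewrite (@zsum_single R j) ?eqxx /=; first by case: (g j) => x y /=; ring.
  by move=> k /negPf -> /=; case: (g k) => x y /=; ring.
rewrite (@zsum_single R j) ?eqxx /=; first by case: (g j) => x y /=; ring.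
by move=> k /negPf -> /=; case: (g k) => x y /=; ring.
Qed.

Definition rdot f g : R := complex.Re (l2dot f g).

Lemma rdotC f g : rdot g f = rdot f g.
Proof. by rewrite /rdot dotC; case: (l2dot f g). Qed.
Lemma rdotDr f g h : rdot f (g + h) = rdot f g + rdot f h.
Proof. by rewrite /rdot dotDr; case: (l2dot f g) => ? ?; case: (l2dot f h). Qed.
Lemma rdotNr f g : rdot f (- g) = - rdot f g.
Proof. by rewrite /rdot dotNr; case: (l2dot f g). Qed.
Lemma rdotDl f g h : rdot (f + g) h = rdot f h + rdot g h.
Proof. by rewrite rdotC rdotDr !(rdotC h). Qed.
Lemma rdotNl f g : rdot (- f) g = - rdot f g.
Proof. by rewrite rdotC rdotNr rdotC. Qed.
Lemma rdotZr (a : R) f g : rdot f (a%:C *: g) = a * rdot f g.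
Proof. by rewrite /rdot dotZr; case: (l2dot f g) => ? ? /=; ring. Qed.
Lemma rdotZl (a : R) f g : rdot (a%:C *: f) g = a * rdot f g.
Proof. by rewrite rdotC rdotZr rdotC. Qed.
Lemma rdotff f : rdot f f = l2norm f ^+ 2.
Proof. by rewrite /rdot dotff. Qed.

Lemma norm2D f g : l2norm (f + g) ^+ 2 = l2norm f ^+ 2 + 2 * rdot f g + l2norm g ^+ 2.
Proof. by rewrite -!rdotff rdotDr !rdotDl (rdotC g f); ring. Qed.

(** Choose t to make the norm of f + t g small. *)
Lemma rdot_CS f g : rdot f g <= l2norm f * l2norm g.
Proof.
have Q (t : R) : 0 <= l2norm f ^+ 2 + 2 * t * rdot f g + t ^+ 2 * l2norm g ^+ 2.
  have := sqr_ge0 (l2norm (f + t%:C *: g)).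
  by rewrite norm2D rdotZr -[X in _ + X]rdotff rdotZr rdotZl rdotff; lra.
have nf := l2norm_ge0 f; have ng := l2norm_ge0 g.
have [g0|gp] := eqVneq (l2norm g) 0.
  rewrite g0 mulr0 leNgt; apply/negP => r0.
  have := Q (- (l2norm f ^+ 2 + 1) / (2 * rdot f g)); rewrite g0 expr0n /= mulr0 addr0.
  have -> : 2 * (- (l2norm f ^+ 2 + 1) / (2 * rdot f g)) * rdot f g = - (l2norm f ^+ 2 + 1).
    by field; rewrite lt0r_neq0.
  by lra.
have g0 : 0 < l2norm g by rewrite lt0r gp.
have := Q (- l2norm f / l2norm g).
have -> : l2norm f ^+ 2 + 2 * (- l2norm f / l2norm g) * rdot f g
  + (- l2norm f / l2norm g) ^+ 2 * l2norm g ^+ 2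
  = 2 * (l2norm f / l2norm g) * (l2norm f * l2norm g - rdot f g) by field.
have [f0|fp] := eqVneq (l2norm f) 0.
  move=> _; rewrite f0 mul0r leNgt; apply/negP => r0.
  have := Q (- rdot f g / l2norm g ^+ 2); rewrite f0.
  have -> : 0 ^+ 2 + 2 * (- rdot f g / l2norm g ^+ 2) * rdot f g
     + (- rdot f g / l2norm g ^+ 2) ^+ 2 * l2norm g ^+ 2 = - (rdot f g ^+ 2 / l2norm g ^+ 2) by field.
  by rewrite oppr_ge0 leNgt divr_gt0// exprn_gt0.
have f0 : 0 < l2norm f by rewrite lt0r fp.
by rewrite pmulr_rge0 ?subr_ge0// mulr_gt0// divr_gt0.
Qed.

Lemma l2norm_triangle f g : l2norm (f + g) <= l2norm f + l2norm g.
Proof.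
rewrite -(ler_pXn2r (n := 2)) ?nnegrE ?addr_ge0 ?l2norm_ge0// norm2D.
by have := rdot_CS f g; lra.
Qed.

Lemma l2normN f : l2norm (- f) = l2norm f.
Proof. by apply: (@pexpIrn _ 2); rewrite ?nnegrE ?l2norm_ge0// -!rdotff rdotNr rdotNl opprK. Qed.

Lemma l2norm_sub f g : l2norm (f - g) <= l2norm f + l2norm g.
Proof. by rewrite -(l2normN g) l2norm_triangle. Qed.

Lemma normc_le_l2norm f k : normc (f k) <= l2norm f.
Proof.
rewrite -(ler_pXn2r (n := 2)) ?nnegrE ?l2norm_ge0 ?normc_nneg// l2norm2.
pose x j := if j == k then normc (f k) ^+ 2 else 0.
have [xf xE] := @nsum_single R k x ltac:(by rewrite /x eqxx sqr_ge0)
   ltac:(by move=> j /negPf jk; rewrite /x jk).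
have := (nfin_le (x := x) _ (nfin_sq f)).2; rewrite xE /x eqxx; apply=> j.
by case: eqP => [->|_]; rewrite ?lexx ?sqr_ge0.
Qed.

Lemma l2norm_mono f g : (forall k, normc (f k) <= normc (g k)) -> l2norm f <= l2norm g.
Proof.
move=> h; rewrite -(ler_pXn2r (n := 2)) ?nnegrE ?l2norm_ge0// !l2norm2.
apply: (nfin_le _ (nfin_sq g)).2 => k; rewrite sqr_ge0 /=.
by rewrite ler_pXn2r ?nnegrE ?normc_nneg.
Qed.

Lemma l2norm_eq0 f : l2norm f = 0 -> f = 0.
Proof.
move=> f0; apply: l2P => k; apply: eq0_normc; apply/eqP.
by rewrite eq_le normc_nneg andbT -f0 normc_le_l2norm.
Qed.

Lemma l2normZE (a : C) f : l2norm (a *: f) = normc a * l2norm f.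
Proof.
apply/eqP; rewrite eq_le l2normZ /=.
have [->|a0] := eqVneq a 0; first by rewrite normc0 mul0r l2norm_ge0.
have n0 : 0 < normc a.
  by rewrite lt0r normc_nneg andbT; apply: contra a0 => /eqP/eq0_normc ->.
have := l2normZ a^-1 (a *: f); rewrite scalerA mulVf// scale1r normcV.
by rewrite [X in _ <= X]mulrC ler_pdivlMr// mulrC.
Qed.

Lemma l2norm_ket k : l2norm (ket R k) = 1.
Proof.
apply: (@pexpIrn _ 2); rewrite ?nnegrE ?l2norm_ge0// expr1n -rdotff /rdot dot_ketl /=.
by rewrite eqxx.
Qed.

End Inner.

(** * Invertibility of bounded operators *)

Section Operators.
Local Open Scope complex_scope.
Variable R : realType.
Local Notation C := R[i].
Local Notation l2 := (l2 R).
Local Notation bop := (bop R).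
Implicit Types (f g h : l2) (A B D : bop).

Lemma bopME A B f : (A * B : bop) f = A (B f). Proof. by []. Qed.
Lemma bopDE A B f : (A + B : bop) f = A f + B f. Proof. by []. Qed.
Lemma bopNE A f : (- A : bop) f = - A f. Proof. by []. Qed.
Lemma bopBE A B f : (A - B : bop) f = A f - B f. Proof. by []. Qed.
Lemma bopZE (a : C) A f : (a *: A : bop) f = a *: A f. Proof. by []. Qed.
Lemma bop1E f : (1 : bop) f = f. Proof. by []. Qed.
Lemma bop0E f : (0 : bop) f = 0. Proof. by []. Qed.

Lemma bop_bound A : exists2 M : R, 0 < M & forall f, l2norm (A f) <= M * l2norm f.
Proof.
have /asboolP[_ [M hM]] := bopvalP A; exists (`|M| + 1); first by rewrite ltr_wpDl.
move=> f; apply: (le_trans (hM f)); rewrite ler_wpM2r ?l2norm_ge0//.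
by have := ler_norm M; lra.
Qed.

Lemma bopC A (a : C) f : A (a *: f) = a *: A f.
Proof. exact: linearZ. Qed.
Lemma bopAdd A f g : A (f + g) = A f + A g.
Proof. exact: linearD. Qed.
Lemma bopSub A f g : A (f - g) = A f - A g.
Proof. exact: linearB. Qed.
Lemma bopA0 A : A 0 = 0.
Proof. exact: linear0. Qed.

Lemma mk_bop (F : l2 -> l2) (M : R) : linear F -> (forall f, l2norm (F f) <= M * l2norm f) ->
  exists A : bop, forall f, A f = F f.
Proof.
move=> lF bF; have H : F \in @bop_pred R by apply/asboolP; split => //; exists M.
by exists (Bop H).
Qed.

Lemma unit_of_bij A (c : R) : (forall f, l2norm f <= c * l2norm (A f)) ->
  (forall g, exists f, A f = g) -> A \is a GRing.unit.
Proof.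
move=> inj surj.
have injA f g : A f = A g -> f = g.
  move=> e; apply/eqP; rewrite -subr_eq0; apply/eqP/l2norm_eq0/eqP.
  rewrite eq_le l2norm_ge0 andbT; have := inj (f - g).
  by rewrite bopSub e subrr l2norm0 mulr0.
pose G g := sval (cid (surj g)).
have GE g : A (G g) = g by rewrite /G; case: cid.
have [B BE] : exists B : bop, forall f, B f = G f.
  apply: (mk_bop (M := c)); last by move=> f; have := inj (G f); rewrite GE.
  by move=> a f g; apply: injA; rewrite bopAdd bopC !GE.
apply/unitrP; exists B; split; apply: bopP => f; rewrite bopME bop1E BE ?GE//.
by apply: injA; rewrite GE.
Qed.

Lemma bop_unitr_inv A : A \is a GRing.unit -> exists B, B * A = 1 /\ A * B = 1 /\ B = A^-1.
Proof. by move=> u; exists A^-1; rewrite mulVr// divrr. Qed.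

(** Fatou: every finite sum of squares is a limit of sums at most c^2. *)
Lemma l2_limit (u : nat -> l2) (gr gi : int -> R) (c : R) : 0 <= c ->
  (forall k, (fun m => complex.Re (u m k)) @ \oo --> gr k) ->
  (forall k, (fun m => complex.Im (u m k)) @ \oo --> gi k) ->
  (forall m, l2norm (u m) <= c) ->
  exists2 G : l2, (forall k, G k = gr k +i* gi k) & l2norm G <= c.
Proof.
move=> c0 cr ci ub.
have key : (esqnorm (fun k => gr k +i* gi k) <= (c ^+ 2)%:E)%E.
  apply: ge_ereal_sup => _ [A [finA _] <-].
  rewrite fsbig_finite//= sumEFin lee_fin.
  set s := finmap.enum_fset _.
  have cs : (fun m => \sum_(k <- s) normc (u m k) ^+ 2) @ \oo -->
      \sum_(k <- s) normc (gr k +i* gi k) ^+ 2.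
    elim: s => [|k s IH].
      under eq_fun do rewrite big_nil.
      by rewrite big_nil; apply: cvg_cst.
    under eq_fun do rewrite big_cons.
    rewrite big_cons; apply: cvgD IH.
    have nE (z : C) : normc z ^+ 2 = complex.Re z ^+ 2 + complex.Im z ^+ 2.
      by case: z => x y /=; rewrite sqr_sqrtr ?addr_ge0 ?sqr_ge0.
    under eq_fun do rewrite nE.
    rewrite nE /=; under eq_fun do rewrite !expr2.
    by rewrite !expr2; apply: cvgD; apply: cvgM.
  have cl := cvg_lim (@Rhausdorff R) cs.
  rewrite -[X in X <= _]cl; apply: limr_le; first by apply/cvg_ex; eexists; exact: cs.
  near=> m; apply: (@le_trans _ _ (l2norm (u m) ^+ 2)); last first.
    by rewrite ler_pXn2r ?nnegrE ?l2norm_ge0.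
  rewrite -lee_fin l2norm2 -(nfinE (nfin_sq (u m))) -sumEFin /s.
  rewrite -(fsbig_finite _ (fun k => (normc (u m k) ^+ 2)%:E) finA).
  by apply: ereal_sup_ubound; exists A.
have mem : (fun k => gr k +i* gi k) \in @l2_pred R.
  by apply/asboolP; apply: le_lt_trans key _; rewrite ltry.
by exists (L2 mem) => //; apply: l2norm_le.
Unshelve. all: by end_near.
Qed.

(** The geometric series of K applied to f converges entrywise, with bounds for
    its tails that pass to the limit by [l2_limit]. *)
Lemma neumann (K : bop) (kappa : R) : 0 <= kappa < 1 -> (forall f, l2norm (K f) <= kappa * l2norm f) ->
  (1 - K : bop) \is a GRing.unit.
Proof.
move=> /andP[k0 k1] hK.
have kp : 0 < 1 - kappa by rewrite subr_gt0.
apply: (@unit_of_bij _ (1 - kappa)^-1) => [f|f].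
  rewrite mulrC ler_pdivlMr// mulrC mulrBl mul1r lerBlDr bopBE bop1E.
  apply: le_trans (lerD (lexx _) (hK f)).
  by rewrite -{1}(subrK (K f) f) l2norm_triangle.
pose t (i : nat) : l2 := iter i K f.
have tb i : l2norm (t i) <= kappa ^+ i * l2norm f.
  elim: i => [|i IH]; first by rewrite expr0 mul1r.
  by rewrite /t iterS exprS -mulrA (le_trans (hK _))// ler_wpM2l.
pose S (n m : nat) : l2 := \sum_(n <= i < n + m) t i.
have geo n m : \sum_(n <= i < n + m) kappa ^+ i <= kappa ^+ n / (1 - kappa).
  rewrite ler_pdivlMr//.
  suff -> : (\sum_(n <= i < n + m) kappa ^+ i) * (1 - kappa) = kappa ^+ n - kappa ^+ (n + m).
    by rewrite gerBl exprn_ge0.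
  elim: m => [|j IHj]; first by rewrite addn0 big_geq// mul0r subrr.
  by rewrite addnS big_nat_recr ?leq_addr//= mulrDl IHj exprS; ring.
have Sb n m : l2norm (S n m) <= kappa ^+ n / (1 - kappa) * l2norm f.
  apply: (@le_trans _ _ (\sum_(n <= i < n + m) kappa ^+ i * l2norm f)).
    rewrite /S; elim: m => [|m IH].
      by rewrite addn0 !big_geq// l2norm0.
    rewrite addnS !big_nat_recr ?leq_addr//=.
    by apply: (le_trans (l2norm_triangle _ _)); apply: lerD.
  by rewrite -mulr_suml ler_wpM2r ?l2norm_ge0.
have val_sum n m j : (S n m) j = \sum_(n <= i < n + m) t i j.
  rewrite /S; elim: m => [|m IH]; first by rewrite addn0 !big_geq.
  by rewrite addnS !big_nat_recr ?leq_addr//= -IH.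
have sr (pr : C -> R) : (forall z, `|pr z| <= normc z) -> (forall y z, pr (y + z) = pr y + pr z) ->
    pr 0 = 0 -> forall j, exists l : R, forall n : nat,
     (fun m => pr (S n m j)) @ \oo --> l - pr (S 0 n j).
  move=> prn prD pr0 j.
  have prS n m : pr (S n m j) = \sum_(n <= i < n + m) pr (t i j).
    rewrite val_sum; elim: m => [|m IH]; first by rewrite addn0 !big_geq.
    by rewrite addnS !big_nat_recr ?leq_addr//= prD IH.
  have : cvgn (series (fun i => pr (t i j))).
    apply: normed_cvg; apply: (series_le_cvg _ _ _ (is_cvg_geometric_series (a := l2norm f) (z := kappa) _)).
    - by move=> n /=; exact: normr_ge0.
    - by move=> n; rewrite /geometric /= mulr_ge0 ?l2norm_ge0 ?exprn_ge0.
    - move=> n; rewrite /geometric /= mulrC; apply: le_trans (tb n).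
      by apply: le_trans (prn _) (normc_le_l2norm _ _).
    - by rewrite ger0_norm.
  move=> /cvg_ex[l hl]; exists l => n.
  have -> : (fun m => pr (S n m j)) = (fun m => series (fun i => pr (t i j)) (m + n)%N - pr (S 0 n j)).
    apply/funext => m; rewrite !prS /series /= add0n addnC.
    rewrite (big_cat_nat (n := n) (leq0n n) (leq_addl m n)) /=; ring.
  apply: cvgB; last exact: cvg_cst.
  by have := hl; rewrite -(cvg_shiftn n).
have [lr hr] : exists lr : int -> R, forall j n,
   (fun m => complex.Re (S n m j)) @ \oo --> lr j - complex.Re (S 0 n j).
  have H j := sr (@complex.Re R) (@Re_le_normc R) (fun y z => raddfD (@complex.Re R : Rcomplex R -> R) y z) erefl j.
  by exists (fun j => sval (cid (H j))) => j; case: cid.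
have [li hi] : exists li : int -> R, forall j n,
   (fun m => complex.Im (S n m j)) @ \oo --> li j - complex.Im (S 0 n j).
  have H j := sr (@complex.Im R) (@Im_le_normc R) (fun y z => raddfD (@complex.Im R : Rcomplex R -> R) y z) erefl j.
  by exists (fun j => sval (cid (H j))) => j; case: cid.
have lim n : exists2 G : l2, (forall j, G j = (lr j - complex.Re (S 0 n j)) +i* (li j - complex.Im (S 0 n j)))
     & l2norm G <= kappa ^+ n / (1 - kappa) * l2norm f.
  apply: (l2_limit (u := S n)) => //.
  by rewrite mulr_ge0 ?l2norm_ge0// divr_ge0 ?exprn_ge0// ltW.
have [g gE _] := lim 0%N.
have gS n : l2norm (g - S 0 n) <= kappa ^+ n / (1 - kappa) * l2norm f.
  have [G GE Gn] := lim n; suff -> : g - S 0 n = G by [].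
  apply: l2P => j; rewrite GE.
  transitivity (g j - S 0 n j); first by [].
  rewrite gE /S addn0 big_geq//; case: (\sum_(_ <= _ < _) _ : l2) => v ?.
  by rewrite /= !subr0; case: (v j).
exists g.
have fixS n : (1 - K : bop) (S 0 n) = f - t n.
  rewrite bopBE bop1E /S add0n; elim: n => [|n IH]; first by rewrite big_geq// bopA0 subrr subrr.
  rewrite big_nat_recr//= bopAdd; move: IH; set s := \sum_(_ <= _ < _) _ => IH.
  by rewrite opprD addrACA IH addrA subrK.
have bnd n : l2norm ((1 - K : bop) g - f) <= kappa ^+ n * ((1 + kappa) / (1 - kappa) * l2norm f + l2norm f).
  have -> : (1 - K : bop) g - f = (1 - K : bop) (g - S 0 n) - t n.
    by rewrite bopSub fixS opprB (addrC (t n) (- f)) addrA addrK.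
  rewrite (le_trans (l2norm_sub _ _))// mulrDr lerD//.
  rewrite bopBE bop1E (le_trans (l2norm_sub _ _))//.
  apply: (@le_trans _ _ ((1 + kappa) * l2norm (g - S 0 n))).
    by rewrite mulrDl mul1r lerD2l.
  rewrite mulrA [kappa ^+ n * _]mulrC -!mulrA ler_wpM2l ?addr_ge0//.
  by apply: (le_trans (gS n)); rewrite mulrCA mulrA.
apply/eqP; rewrite -subr_eq0; apply/eqP/l2norm_eq0/eqP; rewrite eq_le l2norm_ge0 andbT.
set X := (1 + kappa) / (1 - kappa) * l2norm f + l2norm f in bnd.
have cX : (fun n => kappa ^+ n * X) @ \oo --> (0 * X : R).
  by apply: cvgM; [apply: cvg_expr; rewrite ger0_norm|apply: cvg_cst].
rewrite mul0r in cX; have cl := cvg_lim (@Rhausdorff R) cX.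
rewrite -cl; apply: limr_ge; first by apply/cvg_ex; eexists; exact: cX.
by near=> n; exact: bnd.
Unshelve. all: by end_near.
Qed.

Lemma unit_scale A (s : C) : s != 0 -> (s *: A : bop) \is a GRing.unit -> A \is a GRing.unit.
Proof.
move=> s0 /unitrP[B [h1 h2]]; apply/unitrP; exists (s *: B).
by split; [rewrite -scalerAl scalerAr h1|rewrite -scalerAr scalerAl h2].
Qed.

Lemma normc_real (x : R) : normc x%:C = `|x|.
Proof. by rewrite /normc /= expr0n /= addr0 sqrtr_sqr. Qed.

(** Lax-Milgram: 1 - s A is a contraction for s = e / M^2. *)
Lemma coercive_unit A (e : R) : 0 < e -> (forall f, e * l2norm f ^+ 2 <= rdot f (A f)) ->
  A \is a GRing.unit.
Proof.
move=> e0 hA; have [M0 M00 hM0] := bop_bound A.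
pose M := M0 + e; have M0' : 0 < M by rewrite addr_gt0.
have hM f : l2norm (A f) <= M * l2norm f.
  by apply: (le_trans (hM0 f)); rewrite ler_wpM2r ?l2norm_ge0// lerDl ltW.
(* the minimizer of 1 - 2 s e + (s M)^2 *)
pose s := e / M ^+ 2; pose k2 := 1 - (e / M) ^+ 2.
have k20 : 0 <= k2.
  rewrite subr_ge0 exprn_ile1//; first by rewrite divr_ge0// ltW.
  by rewrite ler_pdivrMr// mul1r lerDr ltW.
have k21 : k2 < 1 by rewrite gtrBl exprn_gt0// divr_gt0.
have s0 : 0 < s by rewrite divr_gt0// exprn_gt0.
apply: (@unit_scale A s%:C); first by rewrite -(rmorph0 (real_complex R)) (inj_eq (@complexI R)) lt0r_neq0.
have -> : (s%:C *: A : bop) = 1 - (1 - s%:C *: A) by rewrite opprB addrC subrK.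
apply: (@neumann _ (Num.sqrt k2)).
  by rewrite sqrtr_ge0 /= -sqrtr1 ltr_sqrt.
move=> f; rewrite -(ler_pXn2r (n := 2)) ?nnegrE ?mulr_ge0 ?sqrtr_ge0 ?l2norm_ge0//.
rewrite [leRHS]exprMn.
rewrite (sqr_sqrtr k20).
rewrite bopBE.
rewrite bop1E.
rewrite bopZE.
rewrite norm2D.
rewrite rdotNr.
rewrite rdotZr.
rewrite l2normN.
rewrite l2normZE.
rewrite normc_real.
rewrite (gtr0_norm s0).
rewrite [(s * _) ^+ 2]exprMn.
have h1 := hA f.
have h2 : l2norm (A f) ^+ 2 <= M ^+ 2 * l2norm f ^+ 2.
  by rewrite -exprMn ler_pXn2r ?nnegrE ?mulr_ge0 ?l2norm_ge0 ?(ltW M0').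
have h3 := ler_wpM2l (ltW s0) h1; have h4 := ler_wpM2l (sqr_ge0 s) h2.
have -> : k2 * l2norm f ^+ 2 = l2norm f ^+ 2 - 2 * (s * (e * l2norm f ^+ 2))
   + s ^+ 2 * (M ^+ 2 * l2norm f ^+ 2).
  by rewrite /k2 /s; field; rewrite lt0r_neq0.
lra.
Qed.

End Operators.

(** * Adjoints, multiplication, sampling and shift operators *)

Section Operators2.
Local Open Scope complex_scope.
Variable R : realType.
Local Notation C := R[i].
Local Notation l2 := (l2 R).
Local Notation bop := (bop R).
Implicit Types (f g h : l2) (A B D : bop).

Lemma adj_uniq A B B' : is_adjoint A B -> is_adjoint A B' -> B = B'.
Proof.
move=> h h'; apply: bopP => g; apply: l2P => k.
by rewrite -!dot_ketl -h -h'.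
Qed.

(** The choice in the definition of the adjoint is determined by [adj_uniq]. *)
Lemma adjE A B : is_adjoint A B -> adjoint A = B.
Proof.
move=> h; rewrite /adjoint; case: xgetP => [B' _ h'|/(_ B)//].
exact: (adj_uniq h' h).
Qed.

Lemma adjM A A' B B' : is_adjoint A A' -> is_adjoint B B' -> is_adjoint (A * B) (B' * A').
Proof. by move=> h h' f g; rewrite !bopME h h'. Qed.

Lemma adjD A A' B B' : is_adjoint A A' -> is_adjoint B B' -> is_adjoint (A + B) (A' + B').
Proof. by move=> h h' f g; rewrite !bopDE dotDl dotDr h h'. Qed.

Lemma adjZ (a : C) A A' : is_adjoint A A' -> is_adjoint (a *: A) (a^* *: A').
Proof. by move=> h f g; rewrite !bopZE dotZl dotZr h. Qed.

Lemma adj1 : is_adjoint (1 : bop) 1.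
Proof. by []. Qed.

Lemma adj0 : is_adjoint (0 : bop) 0.
Proof. by move=> f g; rewrite !bop0E dot0r dotC dot0r conjc0. Qed.

Lemma adjB A A' B B' : is_adjoint A A' -> is_adjoint B B' -> is_adjoint (A - B) (A' - B').
Proof. by move=> h h' f g; rewrite !bopBE dotBl dotBr h h'. Qed.

Definition bddseq (s : int -> C) := exists M : R, forall k, normc (s k) <= M.

Lemma diag_exists (s : int -> C) : bddseq s -> exists A : bop, forall f k, A f k = s k * f k.
Proof.
move=> [M hM].
have M0 : 0 <= M by apply: le_trans (hM 0); exact: normc_nneg.
pose F f : int -> C := fun k => s k * f k.
have bound f : (esqnorm (F f) <= (M ^+ 2)%:E * esqnorm f)%E.
  apply: le_trans (esumZ (sqr_ge0 M) _); last by move=> k; apply: sqr_ge0.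
  apply: le_esum => k _; rewrite lee_fin normcZsq ler_wpM2r ?sqr_ge0//.
  by rewrite ler_pXn2r ?nnegrE ?normc_nneg.
have mem f : F f \in @l2_pred R.
  apply/asboolP; apply: (le_lt_trans (bound f)).
  by apply: lte_mul_pinfty; rewrite ?lee_fin ?sqr_ge0//; apply/asboolP/(l2valP f).
have [||A AE] := @mk_bop R (fun f => L2 (mem f)) M; last by exists A => f k; rewrite AE.
  move=> c f g; apply: l2P => k.
  transitivity (s k * (c * f k + g k)); first by [].
  transitivity (c * (s k * f k) + s k * g k); last by [].
  by ring.
move=> f; apply: l2norm_le; first by rewrite mulr_ge0 ?l2norm_ge0.
by rewrite exprMn EFinM l2norm_sq fineK ?l2_fin//; apply: bound.
Qed.

Definition diag (s : int -> C) : bop := xget 0 [set A : bop | forall f k, A f k = s k * f k].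

Lemma diagE s f k : bddseq s -> diag s f k = s k * f k.
Proof.
move=> /diag_exists[A AE]; rewrite /diag; case: xgetP => [B _ ->//|/(_ A)].
by case.
Qed.

Lemma diag_adj s : bddseq s -> is_adjoint (diag s) (diag (fun k => (s k)^*)).
Proof.
move=> sb f g; have sb' : bddseq (fun k => (s k)^*).
  by case: sb => M hM; exists M => k; rewrite normcJ'.
by congr (_ +i* _); apply: eq_zsum => k; rewrite !diagE// rmorphM mulrCA mulrA.
Qed.

Section Proj.
Variables (a b : int).
Hypothesis b0 : b != 0.

Lemma proj_exists : exists A : bop, forall f k, A f k = f (a + b * k).
Proof.
pose F f : int -> C := fun k => f (a + b * k).
have mem f : F f \in @l2_pred R.
  by apply/asboolP; have [] := nfin_emb a b0 (nfin_sq f).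
have bd f : l2norm (L2 (mem f)) <= l2norm f.
  apply: l2norm_le; first exact: l2norm_ge0.
  rewrite l2norm_sq fineK ?l2_fin//.
  by have [] := @nsum_emb R a b b0 (fun j => normc (f j) ^+ 2) (fun j => sqr_ge0 _).
have [||A AE] := @mk_bop R (fun f => L2 (mem f)) 1.
- by move=> c f g; apply: l2P => k.
- by move=> f; rewrite mul1r.
by exists A => f k; rewrite AE.
Qed.

Definition proj : bop := sval (cid proj_exists).
Lemma projE f k : proj f k = f (a + b * k).
Proof. exact: (svalP (cid proj_exists)). Qed.
Lemma embE f k : emb R a b f (a + b * k) = f k.
Proof. by rewrite /= /emb_fun addrC addKr dvdz_mulr// mulKz. Qed.

Lemma emb_out f j : ~~ (b %| j - a)%Z -> emb R a b f j = 0.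
Proof. by move=> h; rewrite /= /emb_fun (negPf h). Qed.

Lemma emb_norm f : l2norm (emb R a b f) <= l2norm f.
Proof.
apply: l2norm_le; first exact: l2norm_ge0.
by rewrite l2norm_sq fineK ?l2_fin//; apply: esqnorm_emb.
Qed.

Lemma emb_adj : is_adjoint (emb R a b) proj.
Proof.
move=> f g; congr (_ +i* _).
  rewrite (zsum_emb (a := a) b0 (summ_Re _ _)); last first.
    by move=> j jb; have -> := emb_out f jb; rewrite conjC0 mul0r.
  by apply: eq_zsum => k; rewrite embE projE.
rewrite (zsum_emb (a := a) b0 (summ_Im _ _)); last first.
  by move=> j jb; have -> := emb_out f jb; rewrite conjC0 mul0r.
by apply: eq_zsum => k; rewrite embE projE.
Qed.

End Proj.

Definition sh (k : int) : bop := emb R k 1.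
Lemma shE k f n : sh k f n = f (n - k).
Proof. by rewrite /sh /= /emb_fun dvd1z divz1. Qed.

Lemma sh_norm k f : l2norm (sh k f) = l2norm f.
Proof.
apply/eqP; rewrite eq_le emb_norm /=.
have e : sh (- k) (sh k f) = f by apply: l2P => n; rewrite !shE opprK addrK.
by rewrite -{1}e; exact: emb_norm.
Qed.

Lemma sh_adj k : is_adjoint (sh k) (sh (- k)).
Proof.
have -> : sh (- k) = proj k (oner_neq0 int).
  by apply: bopP => f; apply: l2P => n; rewrite shE projE opprK mul1r addrC.
exact: emb_adj.
Qed.

Lemma shD k l : sh k * sh l = sh (k + l).
Proof. by apply: bopP => f; apply: l2P => n; rewrite bopME !shE; congr (f _); ring. Qed.
Lemma sh0 : sh 0 = 1.
Proof. by apply: bopP => f; apply: l2P => n; rewrite shE subr0. Qed.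
Lemma sh_unit k : sh k \is a GRing.unit.
Proof. by apply/unitrP; exists (sh (- k)); rewrite !shD addNr addrN sh0. Qed.
Lemma shV k : (sh k)^-1 = sh (- k).
Proof. by apply: (mulrI (sh_unit k)); rewrite divrr ?sh_unit// shD addrN sh0. Qed.

Lemma shiftX (k : int) : shiftZ R ^ k = sh k.
Proof.
have N (n : nat) : shiftZ R ^+ n = sh n%:Z.
  elim: n => [|n IH]; first by rewrite expr0 sh0.
  by rewrite exprSr IH /shiftZ -/(sh 1) shD -addn1 PoszD.
case: k => n; first exact: N.
by change ((shiftZ R ^+ n.+1)^-1 = sh (- n.+1%:Z)); rewrite N shV.
Qed.

Lemma opnorm_has_sup A : has_sup [set l2norm (A f) | f in [set f | l2norm f <= 1]].
Proof.
split; first by exists (l2norm (A 0)); exists 0 => //=; rewrite l2norm0 ler01.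
have [M M0 hM] := bop_bound A; exists M => _ [f /= f1 <-].
by apply: (le_trans (hM f)); rewrite -[leRHS]mulr1 ler_wpM2l// ltW.
Qed.

Lemma opnorm_le A (c : R) : 0 <= c -> (forall f, l2norm (A f) <= c * l2norm f) -> opnorm A <= c.
Proof.
move=> c0 h; apply: ge_sup; first by case: (opnorm_has_sup A).
move=> _ [f /= f1 <-]; apply: (le_trans (h f)).
by rewrite -[leRHS]mulr1 ler_wpM2l.
Qed.

Lemma opnorm_ub A f : l2norm f <= 1 -> l2norm (A f) <= opnorm A.
Proof. by move=> f1; apply: ub_le_sup; [case: (opnorm_has_sup A)|exists f]. Qed.

Lemma opnorm_ge0 A : 0 <= opnorm A.
Proof. by apply: le_trans (opnorm_ub A (f := 0) _); rewrite ?l2norm_ge0// l2norm0. Qed.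

Lemma opnorm_entry A j k : normc (A (ket R k) j) <= opnorm A.
Proof.
by apply: (le_trans (normc_le_l2norm _ _)); apply: opnorm_ub; rewrite l2norm_ket.
Qed.

End Operators2.

(** * Boundedness of the constructed coefficients *)

Section BoundedSequences.
Variable R : realType.
Implicit Types (s t : int -> R) (f g : int -> {poly R}).

Definition bddr s := exists M : R, forall k, `|s k| <= M.

Lemma bddr_le s t : (forall k, `|s k| <= `|t k|) -> bddr t -> bddr s.
Proof. by move=> h [M hM]; exists M => k; apply: le_trans (h k) (hM k). Qed.

Lemma eq_bddr s t : s =1 t -> bddr t -> bddr s.
Proof. by move=> h; apply: bddr_le => k; rewrite h. Qed.

Lemma bddr_cst (x : R) : bddr (fun=> x).
Proof. by exists `|x|. Qed.

Lemma bddrD s t : bddr s -> bddr t -> bddr (fun k => s k + t k).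
Proof. by move=> [M h] [N g]; exists (M + N) => k; rewrite (le_trans (ler_normD _ _))// lerD. Qed.

Lemma bddrN s : bddr s -> bddr (fun k => - s k).
Proof. by move=> [M h]; exists M => k; rewrite normrN. Qed.

Lemma bddrM s t : bddr s -> bddr t -> bddr (fun k => s k * t k).
Proof. by move=> [M h] [N g]; exists (M * N) => k; rewrite normrM ler_pM. Qed.

Lemma bddr_sum (I : eqType) (r : seq I) (F : I -> int -> R) :
  (forall i, i \in r -> bddr (F i)) -> bddr (fun k => \sum_(i <- r) F i k).
Proof.
elim: r => [|i r IH] h.
  by apply: (@eq_bddr _ (fun=> 0)); [move=> k; rewrite big_nil|exact: bddr_cst].
apply: (@eq_bddr _ (fun k => F i k + \sum_(j <- r) F j k)).
  by move=> k; rewrite big_cons.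
by apply: bddrD; [apply: h; rewrite inE eqxx|apply: IH => j jr; apply: h; rewrite inE jr orbT].
Qed.

Lemma bddr_sqrt s : bddr s -> bddr (fun k => Num.sqrt (s k)).
Proof.
move=> [M h]; exists (Num.sqrt M) => k; rewrite ger0_norm ?sqrtr_ge0//.
by rewrite ler_wsqrtr// (le_trans (ler_norm _)).
Qed.

(** A sequence over Z is finitely many sequences over the blocks. *)
Lemma bddr_sites (a : int) (d : nat) s : (0 < d)%N ->
  (forall i, (i < d)%N -> bddr (fun k => s (site a d k - i%:Z))) -> bddr s.
Proof.
move=> d0 h.
have {}h : forall i, exists M : R, (i < d)%N -> forall k, `|s (site a d k - i%:Z)| <= M.
  move=> i; case: (ltnP i d) => id; last by exists 0.
  by have [M hM] := h i id; exists M.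
have [F hF] := choice h.
exists (\sum_(i < d) `|F i|) => n; have [k [i [id ->]]] := siteP a n d0.
apply: (le_trans (hF i id k)); apply: (le_trans (ler_norm _)).
by rewrite (bigD1 (Ordinal id))//= lerDl sumr_ge0.
Qed.

(** Bounded degree and bounded coefficients: this bounds the values at real and at
    complex points. *)
Definition bddp f := exists N : nat, (forall k, (size (f k) <= N)%N) /\
  forall j, bddr (fun k => (f k)`_j).

Lemma bddp_cst (x : {poly R}) : bddp (fun=> x).
Proof. by exists (size x); split => // j; apply: bddr_cst. Qed.

Lemma eq_bddp f g : f =1 g -> bddp g -> bddp f.
Proof.
move=> h [N [sN b]]; exists N; split => [k|j]; first by rewrite h.
by apply: eq_bddr (b j) => k; rewrite h.
Qed.

Lemma bddpD f g : bddp f -> bddp g -> bddp (fun k => f k + g k).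
Proof.
move=> [N [sN bN]] [M [sM bM]]; exists (maxn N M); split => [k|j].
  by rewrite (leq_trans (size_polyD _ _))// geq_max !leq_max sN sM orbT.
by apply: eq_bddr (bddrD (bN j) (bM j)) => k; rewrite coefD.
Qed.

Lemma bddpZ s f : bddr s -> bddp f -> bddp (fun k => s k *: f k).
Proof.
move=> bs [N [sN bN]]; exists N; split => [k|j].
  by rewrite (leq_trans (size_scale_leq _ _)).
by apply: eq_bddr (bddrM bs (bN j)) => k; rewrite coefZ.
Qed.

Lemma bddpX f : bddp f -> bddp (fun k => 'X * f k).
Proof.
move=> [N [sN bN]]; exists N.+1; split => [k|j].
  by rewrite (leq_trans (size_polyMleq _ _))// size_polyX addSn /= add1n ltnS.
apply: (@eq_bddr _ (fun k => if j is i.+1 then (f k)`_i else 0)).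
  by move=> k; rewrite coefXM; case: j.
by case: j => [|i]; [exact: bddr_cst|exact: bN].
Qed.

Lemma bddp_sum (I : eqType) (r : seq I) (F : I -> int -> {poly R}) :
  (forall i, i \in r -> bddp (F i)) -> bddp (fun k => \sum_(i <- r) F i k).
Proof.
elim: r => [|i r IH] h.
  by apply: (@eq_bddp _ (fun=> 0)); [move=> k; rewrite big_nil|exact: bddp_cst].
apply: (@eq_bddp _ (fun k => F i k + \sum_(j <- r) F j k)).
  by move=> k; rewrite big_cons.
by apply: bddpD; [apply: h; rewrite inE eqxx|apply: IH => j jr; apply: h; rewrite inE jr orbT].
Qed.

Lemma bddp_horner f (x : R) : bddp f -> bddr (fun k => (f k).[x]).
Proof.
move=> [N [sN bN]].
apply: (@eq_bddr _ (fun k => \sum_(i <- index_enum 'I_N) (f k)`_i * x ^+ i)).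
  by move=> k; rewrite (horner_coef_wide _ (sN k)).
by apply: bddr_sum => i _; apply: bddrM (bN i) (bddr_cst _).
Qed.

Section Solution.
Variables (T : {poly R}) (cs : seq R).
Hypothesis CT : critical T cs.
Local Notation m := (size cs).
Local Notation d := (size cs).+1.
Local Notation tau := (lead_coef T).
Variables (a : int) (pt qt : int -> R) (W : int -> R -> R).
Local Notation b := (site a d).
Hypothesis Wrec : forall k c, c \in cs ->
  W k c = T.[c] - qt k - pt (k + 1) ^+ 2 / W (k + 1) c.
Hypothesis Wsgn : forall k c, c \in cs -> 0 < W k c * T.[c].
Hypothesis Wbdd : forall c, c \in cs -> bddr (fun k => W k c) /\ bddr (fun k => (W k c)^-1).
Hypothesis ptb : bddr pt.
Local Notation w k := (wt T cs W k).
Local Notation h k := (hnorm cs (w k)).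

Let csU := crit_uniq CT.
Let wp k : forall c, c \in cs -> 0 < w k c.
Proof. by move=> c hc; apply: (wt_gt0 CT Wsgn). Qed.
Let t0 : 0 < tau := crit_lead CT.

Lemma wt_bdd c : c \in cs -> bddr (fun k => w k c).
Proof.
move=> hc; have [b1 _] := Wbdd hc; rewrite /wt.
exact: (bddrM (bddrN b1) (bddr_cst _)).
Qed.

Lemma wtV_bdd c : c \in cs -> bddr (fun k => (w k c)^-1).
Proof.
move=> hc; have [_ b1] := Wbdd hc.
apply: eq_bddr (bddrM (bddrN b1) (bddr_cst (tau * (lpoly cs c).[c]))) => k.
by rewrite /wt invfM invrK invrN.
Qed.

Lemma ip_bdd f g : bddp f -> bddp g -> bddr (fun k => ip cs (w k) (f k) (g k)).
Proof.
move=> bf bg; apply: bddr_sum => c hc.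
exact: bddrM (bddrM (wt_bdd hc) (bddp_horner c bf)) (bddp_horner c bg).
Qed.

(** Some node carries |opol i| >= |l_c(c)| / m, because the coefficient of degree
    m - 1 of X^(m-1-i) * opol i is 1 and the nodes are in [-1, 1]. *)
Lemma hV_bdd i : (i < m)%N -> bddr (fun k => (h k i)^-1).
Proof.
move=> im; have m0 := crit_nil CT.
apply: (@bddr_le _ (fun k => \sum_(c <- cs) m%:R ^+ 2 / (lpoly cs c).[c] ^+ 2 * (w k c)^-1)); last first.
  by apply: bddr_sum => c hc; apply: bddrM (bddr_cst _) (wtV_bdd hc).
move=> k; set f := opol cs (w k) i.
have tm c : c \in cs -> 0 <= m%:R ^+ 2 / (lpoly cs c).[c] ^+ 2 * (w k c)^-1.
  by move=> hc; rewrite mulr_ge0 ?divr_ge0 ?sqr_ge0 ?invr_ge0 ?(ltW (wp k hc)).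
have hk : 0 < h k i by exact: (hnorm_gt0 csU (@wp k) im).
rewrite ger0_norm ?invr_ge0 ?(ltW hk)// ger0_norm; last first.
  by rewrite big_seq; apply: sumr_ge0 => c hc; apply: tm.
pose g := f * 'X^(m.-1 - i).
have sg : (size g <= m)%N.
  rewrite /g size_mulXn ?size_opol; last by rewrite -size_poly_eq0 size_opol.
  by have := im; lia.
have : 1 <= \sum_(c <- cs) `|f.[c]| / `|(lpoly cs c).[c]|.
  have E : g`_m.-1 = 1.
    by rewrite /g coefMXn ltnNge leq_subr /= subKn ?coef_opol//; have := im; lia.
  have E' : g`_m.-1 = \sum_(c <- cs) g.[c] / (lpoly cs c).[c].
    by rewrite {1}(lagrange csU sg) coef_lsum.
  rewrite -[leLHS]normr1 -E E' (le_trans (ler_norm_sum _ _ _))// big_seq [leRHS]big_seq.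
  apply: ler_sum => c hc; rewrite normrM normfV ler_wpM2r ?invr_ge0//.
  rewrite /g hornerM hornerXn normrM normrX ler_piMr// exprn_ile1//.
  exact: (crit_in CT).
have [c hc avg] := exists_ge_avg (fun c => `|f.[c]| / `|(lpoly cs c).[c]|) m0.
move=> s1; have {avg} avg : m%:R^-1 <= `|f.[c]| / `|(lpoly cs c).[c]|.
  by apply: le_trans avg; rewrite -[leLHS]mul1r ler_wpM2r ?invr_ge0.
have l0 : 0 < `|(lpoly cs c).[c]| by rewrite normr_gt0 lpoly_neq0.
have mR : 0 < m%:R :> R by rewrite ltr0n.
apply: (@le_trans _ _ (m%:R ^+ 2 / (lpoly cs c).[c] ^+ 2 * (w k c)^-1)); last first.
  rewrite (bigD1_seq c)//= lerDl big_seq_cond; apply: sumr_ge0 => e /andP[he _].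
  exact: tm.
have wc := wp k hc.
have E2 : m%:R^-1 * `|(lpoly cs c).[c]| <= `|f.[c]| by rewrite -ler_pdivlMr.
have E3 : (m%:R^-1 * `|(lpoly cs c).[c]|) ^+ 2 <= f.[c] ^+ 2.
  rewrite -[leRHS]real_normK ?num_real// ler_pXn2r ?nnegrE ?mulr_ge0 ?invr_ge0 ?(ltW mR)//.
have L2 : 0 < (lpoly cs c).[c] ^+ 2 by rewrite -[ltRHS]real_normK ?num_real// exprn_gt0.
have {}E3 : w k c * (m%:R ^- 2 * (lpoly cs c).[c] ^+ 2) <= h k i.
  apply: le_trans (opol_bound csU (@wp k) i hc); rewrite ler_pM2l//.
  by move: E3; rewrite exprMn exprVn real_normK ?num_real.
have M2 : 0 < m%:R ^+ 2 :> R by rewrite exprn_gt0.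
have X0 : 0 < m%:R ^+ 2 / (lpoly cs c).[c] ^+ 2 * (w k c)^-1.
  by rewrite mulr_gt0 ?invr_gt0// divr_gt0.
rewrite -[leRHS]invrK lef_pV2 ?posrE ?invr_gt0//; apply: le_trans E3.
rewrite le_eqVlt; apply/orP; left; apply/eqP.
by rewrite invfM invrK invf_div [LHS]mulrC; congr (_ * _); rewrite mulrC.
Qed.

Lemma opol_bdd2 i : (i < m)%N -> bddp (fun k => opol cs (w k) i) /\ bddp (fun k => opol cs (w k) i.+1).
Proof.
have Qb j : (j < m)%N -> bddp (fun k => opol cs (w k) j) -> bddr (fun k => opQ cs (w k) j).
  move=> jm bj; apply: bddrM (hV_bdd jm); apply: ip_bdd => //; exact: bddpX.
elim: i => [|i IH] im.
  split; first exact: bddp_cst.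
  apply: (@eq_bddp _ (fun k => 'X + (- opQ cs (w k) 0) *: 1)).
    by move=> k; rewrite opol1 scaleNr alg_polyC.
  apply: bddpD; first exact: bddp_cst.
  by apply: bddpZ; [apply: bddrN; apply: Qb => //; exact: bddp_cst|exact: bddp_cst].
have [b1 b2] := IH (ltnW im); split => //.
apply: (@eq_bddp _ (fun k => 'X * opol cs (w k) i.+1 + ((- opQ cs (w k) i.+1) *: opol cs (w k) i.+1
   + (- opP2 cs (w k) i) *: opol cs (w k) i))).
  by move=> k; rewrite opolS !scaleNr; ring.
apply: bddpD; first exact: bddpX.
apply: bddpD; apply: bddpZ => //; apply: bddrN; first exact: Qb.
by apply: bddrM; [exact: ip_bdd|apply: hV_bdd; apply: ltnW].
Qed.

Lemma opol_bdd i : (i < m)%N -> bddp (fun k => opol cs (w k) i).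
Proof. by move=> im; have [] := opol_bdd2 im. Qed.

Lemma h_bdd i : (i < m)%N -> bddr (fun k => h k i).
Proof. by move=> im; apply: ip_bdd; apply: opol_bdd. Qed.

Lemma sqrth_bdd i : (i < m)%N -> bddr (fun k => Num.sqrt (h k i)).
Proof. by move=> im; apply: bddr_sqrt; apply: h_bdd. Qed.

Lemma sqrthV_bdd i : (i < m)%N -> bddr (fun k => (Num.sqrt (h k i))^-1).
Proof.
move=> im; apply: eq_bddr (bddr_sqrt (hV_bdd im)) => k.
by rewrite sqrtrV// ltW//; exact: (hnorm_gt0 csU (@wp k) im).
Qed.

Lemma solp_at_bdd i : (i < d)%N -> bddr (fun k => solp_at T cs pt W k i).
Proof.
have m0 := crit_nil CT; case: i => [|i] im; first exact: sqrth_bdd.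
have [e|ne] := eqVneq i.+1 m.
  apply: (@eq_bddr _ (fun k => pt k * (tau^-1 * (Num.sqrt (h k m.-1))^-1))).
    by move=> k; rewrite /solp_at e eqxx invfM.
  by apply: bddrM ptb (bddrM (bddr_cst _) (sqrthV_bdd _)); rewrite prednK.
rewrite /solp_at (negPf ne).
by apply: bddrM; [apply: sqrth_bdd|apply: sqrthV_bdd]; move: im ne; lia.
Qed.

Lemma solpV_at_bdd i : (i < m)%N -> bddr (fun k => (solp_at T cs pt W k i)^-1).
Proof.
case: i => [|i] im; first exact: sqrthV_bdd.
apply: (@eq_bddr _ (fun k => Num.sqrt (h k i) * (Num.sqrt (h k i.+1))^-1)).
  by move=> k; rewrite /solp_at (ltn_eqF im) invfM invrK mulrC.
by apply: bddrM; [apply: sqrth_bdd; apply: ltnW|apply: sqrthV_bdd].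
Qed.

Lemma solq_at_bdd i : (i < d)%N -> bddr (fun k => solq_at T cs W k i).
Proof.
case: i => [|i] im; first exact: bddr_cst.
apply: bddrM; last exact: hV_bdd.
by apply: ip_bdd; [apply: bddpX|]; apply: opol_bdd.
Qed.

Lemma solp_bdd : bddr (solp T cs a pt W).
Proof.
apply: (@bddr_sites a d) => // i id; apply: eq_bddr (solp_at_bdd id) => k.
by rewrite solpE.
Qed.

Lemma solq_bdd : bddr (solq T cs a W).
Proof.
apply: (@bddr_sites a d) => // i id; apply: eq_bddr (solq_at_bdd id) => k.
by rewrite solqE.
Qed.

Lemma solL_bdd i : (i < d)%N -> bddp (fun k => solL T cs W k i).
Proof.
case: i => [|i] im; first exact: bddp_cst.
apply: bddpZ; first by apply: bddrM (bddr_cst _) (sqrthV_bdd _).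
apply: bddp_sum => c hc; apply: bddpZ; last exact: bddp_cst.
by apply: bddrM (wt_bdd hc) (bddp_horner c (opol_bdd _)).
Qed.

Lemma solP_bdd i : (i < d)%N -> bddp (fun k => solP T cs W k i).
Proof.
case: i => [|i] im; first exact: bddp_cst.
by apply: bddpZ; [apply: sqrthV_bdd|apply: opol_bdd].
Qed.
End Solution.
End BoundedSequences.

(** * Jacobi operators and their spectrum *)

Section Jacobi.
Local Open Scope complex_scope.
Variable R : realType.
Local Notation C := R[i].
Local Notation l2 := (l2 R).
Local Notation bop := (bop R).
Implicit Types (f g h : l2) (A B D : bop) (p q s : int -> R).

Definition rdiag s : bop := diag (fun k => (s k)%:C).

Lemma bddr_bddseq s : bddr s -> bddseq (fun k => (s k)%:C).
Proof. by move=> [M h]; exists M => k; rewrite normc_real. Qed.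

Lemma rdiagE s f k : bddr s -> rdiag s f k = (s k)%:C * f k.
Proof. by move=> h; rewrite diagE//; apply: bddr_bddseq. Qed.

Lemma conjR (x : R) : Num.conj (x%:C : C) = x%:C.
Proof. by rewrite -[LHS]/(x -i* 0)%C /= oppr0. Qed.
Lemma conjcR (x : R) : conjc (x%:C : C) = x%:C.
Proof. by rewrite -[LHS]/(x -i* 0)%C /= oppr0. Qed.

Lemma rdiag_adj s : bddr s -> is_adjoint (rdiag s) (rdiag s).
Proof.
move=> /bddr_bddseq/diag_adj; rewrite /rdiag.
by have -> : (fun k => ((s k)%:C)^*) = (fun k => (s k)%:C) by apply/funext => k; rewrite conjcR.
Qed.

Lemma rdiag_norm s (M : R) f : 0 <= M -> (forall k, `|s k| <= M) -> l2norm (rdiag s f) <= M * l2norm f.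
Proof.
move=> M0 h.
have -> : M * l2norm f = l2norm (M%:C *: f) by rewrite l2normZE normc_real ger0_norm.
apply: l2norm_mono => k; rewrite rdiagE; last by exists M.
by rewrite l2Z !normcM !normc_real (ger0_norm M0) ler_wpM2r ?normc_nneg.
Qed.

(** D_q + D_p S + S^-1 D_p. *)
Definition jop p q : bop := rdiag q + rdiag p * sh R 1 + sh R (- 1) * rdiag p.

Lemma jopE p q f n : bddr p -> bddr q ->
  jop p q f n = (p n)%:C * f (n - 1) + (q n)%:C * f n + (p (n + 1))%:C * f (n + 1).
Proof.
move=> bp bq.
transitivity (rdiag q f n + rdiag p (sh R 1 f) n + sh R (-1) (rdiag p f) n); first by [].
by rewrite !shE !rdiagE// shE opprK [X in X + _]addrC.
Qed.

Lemma jop_adj p q : bddr p -> bddr q -> is_adjoint (jop p q) (jop p q).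
Proof.
move=> bp bq.
have h := adjD (adjD (rdiag_adj bq) (adjM (rdiag_adj bp) (sh_adj (R := R) 1)))
    (adjM (sh_adj (R := R) (- 1)) (rdiag_adj bp)).
move=> f g; rewrite {1}/jop h opprK /jop; congr (l2dot f _).
by rewrite !bopDE -!addrA; congr (_ + _); rewrite addrC.
Qed.

Lemma ketE (j k : int) : ket R k j = (j == k)%:R. Proof. by []. Qed.

Lemma jop_ket p q k : bddr p -> bddr q ->
  jop p q (ket R k) = (p k)%:C *: ket R (k - 1) + (q k)%:C *: ket R k
     + (p (k + 1))%:C *: ket R (k + 1).
Proof.
move=> bp bq; apply: l2P => n; rewrite jopE// !l2D !l2Z !ketE.
rewrite (_ : (n - 1 == k) = (n == k + 1)); last by rewrite subr_eq.
rewrite (_ : (n + 1 == k) = (n == k - 1)); last by rewrite [RHS]eq_sym subr_eq eq_sym.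
have E (a b : int) (s : int -> R) : (s a)%:C * (a == b)%:R = (s b)%:C * (a == b)%:R :> C.
  by case: eqP => [->//|_]; rewrite !mulr0.
have := E (n + 1) k p; rewrite (_ : (n + 1 == k) = (n == k - 1)); last first.
  by rewrite [RHS]eq_sym subr_eq eq_sym.
by move=> ->; rewrite (E n k q) (E n (k + 1) p); ring.
Qed.

Lemma jop_jacobi p q : bddr p -> bddr q -> (forall k, 0 <= p k) -> is_jacobi (jop p q).
Proof.
move=> bp bq p0; split; first exact: jop_adj.
by exists p, q; split => // k; apply: jop_ket.
Qed.

(** (J f)(n) is the product of f with J |n>. *)
Lemma jacobi_jop J : is_jacobi J ->
  exists p q, [/\ bddr p, bddr q, forall k, 0 <= p k & J = jop p q].
Proof.
move=> [sa [p [q [p0 E]]]].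
have bp : bddr p.
  exists (opnorm J) => k; apply: le_trans (opnorm_entry J (k - 1) k).
  rewrite E !l2D !l2Z !ketE eqxx (_ : (k - 1 == k) = false); last by lia.
  rewrite (_ : (k - 1 == k + 1) = false); last by lia.
  by rewrite !mulr0 mulr1 !addr0 normc_real.
have bq : bddr q.
  exists (opnorm J) => k; apply: le_trans (opnorm_entry J k k).
  rewrite E !l2D !l2Z !ketE eqxx (_ : (k == k - 1) = false); last by lia.
  rewrite (_ : (k == k + 1) = false); last by lia.
  by rewrite !mulr0 mulr1 !addr0 add0r normc_real.
exists p, q; split => //; apply: bopP => f; apply: l2P => n.
rewrite -[LHS]dot_ketl -sa E jopE// !dotDl !dotZl !dot_ketl.
by rewrite ?conjR ?conjcR.
Qed.

Lemma jop_dist p q p' q' (e : R) : bddr p -> bddr q -> bddr p' -> bddr q' -> 0 <= e ->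
  (forall k, `|p k - p' k| <= e) -> (forall k, `|q k - q' k| <= e) ->
  opnorm (jop p q - jop p' q') <= 3 * e.
Proof.
move=> bp bq bp' bq' e0 hp hq; apply: opnorm_le => [|f]; first by rewrite mulr_ge0.
pose dp k := p k - p' k; pose dq k := q k - q' k.
have bdp : bddr dp by exists e.
have bdq : bddr dq by exists e.
have -> : (jop p q - jop p' q') f = rdiag dq f + rdiag dp (sh R 1 f) + sh R (-1) (rdiag dp f).
  apply: l2P => n.
  transitivity (rdiag dq f n + rdiag dp (sh R 1 f) n + sh R (-1) (rdiag dp f) n); last by [].
  rewrite bopBE l2B !jopE// shE !rdiagE// shE opprK.
  by rewrite /dp /dq !rmorphB; ring.
apply: (le_trans (l2norm_triangle _ _)).
have -> : 3 * e * l2norm f = (e * l2norm f + e * l2norm f) + e * l2norm f by ring.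
apply: lerD; last by rewrite sh_norm; apply: rdiag_norm.
apply: (le_trans (l2norm_triangle _ _)); apply: lerD; first exact: rdiag_norm.
by rewrite -(sh_norm 1 f); apply: rdiag_norm.
Qed.

Lemma jop_entries p q p' q' k : bddr p -> bddr q -> bddr p' -> bddr q' ->
  `|p k - p' k| <= opnorm (jop p q - jop p' q') /\ `|q k - q' k| <= opnorm (jop p q - jop p' q').
Proof.
move=> bp bq bp' bq'; split.
  apply: le_trans (opnorm_entry _ (k - 1) k).
  rewrite bopBE l2B !jopE// !ketE subrK eqxx (_ : (k - 1 == k) = false); last by lia.
  rewrite (_ : (k - 1 - 1 == k) = false); last by lia.
  by rewrite !mulr0 !mulr1 !add0r -rmorphB normc_real.
apply: le_trans (opnorm_entry _ k k).
rewrite bopBE l2B !jopE// !ketE eqxx (_ : (k - 1 == k) = false); last by lia.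
  rewrite (_ : (k + 1 == k) = false); last by lia.
by rewrite !mulr0 !mulr1 !add0r !addr0 -rmorphB normc_real.
Qed.

Lemma jop_conj p q k : bddr p -> bddr q ->
  sh R (- k) * jop p q * sh R k = jop (fun n => p (n + k)) (fun n => q (n + k)).
Proof.
move=> bp bq; apply: bopP => f; apply: l2P => n.
have bp' : bddr (fun n => p (n + k)) by case: bp => M h; exists M.
have bq' : bddr (fun n => q (n + k)) by case: bq => M h; exists M.
rewrite !bopME shE !jopE// !shE opprK addrK -(addrAC n 1 k).
by congr (_ * f _ + _ + _ * f _); ring.
Qed.

Lemma form_self A f : is_adjoint A A -> l2dot f (A f) = (rdot f (A f))%:C.
Proof.
move=> sa; have := dotC f (A f); rewrite sa /rdot.
by case: (l2dot f (A f)) => x y [/= e]; congr (_ +i* _); lra.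
Qed.

Lemma selfadj_nonreal_unit A (z : C) : is_adjoint A A -> complex.Im z != 0 ->
  z%:A - A \is a GRing.unit.
Proof.
(* rotates the form of z - A, whose imaginary part is that of z, to the positive axis *)
move=> sa y0; pose s : C := 0 +i* (- Num.sg (complex.Im z)).
have s0 : s != 0 by rewrite /s eq_complex /= oppr_eq0 sgr_eq0 negb_and y0 orbT.
apply: (unit_scale s0); apply: (@coercive_unit R _ `|complex.Im z|); first by rewrite normr_gt0.
move=> f; rewrite /rdot (bopZE s) dotZr bopBE dotBr (form_self f sa) (bopZE z) bop1E dotZr dotff.
case: z y0 @s s0 => x y /= y0 _.
by rewrite normrEsg; lra.
Qed.

Lemma rdot_scal (x : R) A f : rdot f ((x%:C%:A - A) f) = x * l2norm f ^+ 2 - rdot f (A f).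
Proof. by rewrite bopBE rdotDr rdotNr bopZE bop1E rdotZr rdotff. Qed.

Lemma form_spectrum J : is_adjoint J J ->
  (forall f, rdot f (J f) <= l2norm f ^+ 2) -> (forall f, - l2norm f ^+ 2 <= rdot f (J f)) ->
  spectrum J `<=` unit_segment R.
Proof.
move=> sa up lo z nu.
have [y0|/eqP y0] := eqVneq (complex.Im z) 0; last first.
  by case/negP: nu; apply: selfadj_nonreal_unit => //; apply/eqP.
have zE : z = (complex.Re z)%:C by case: z y0 nu => x y /= ->.
exists (complex.Re z); last by rewrite -zE.
rewrite /= in_itv /=; apply/andP; split; rewrite leNgt; apply/negP => h; case/negP: nu.
  have n1 : (-1 : C) != 0 by rewrite oppr_eq0 oner_eq0.
  apply: (unit_scale n1); apply: (@coercive_unit R _ (- 1 - complex.Re z)); first by rewrite subr_gt0.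
  by move=> f; rewrite zE bopZE scaleN1r rdotNr rdot_scal; have := lo f; lra.
apply: (@coercive_unit R _ (complex.Re z - 1)); first by rewrite subr_gt0.
by move=> f; rewrite {2}zE rdot_scal; have := up f; lra.
Qed.

(** Expand the nonnegative form at f - A f / K. *)
Lemma psd_norm A (K : R) : is_adjoint A A -> 0 < K -> (forall f, l2norm (A f) <= K * l2norm f) ->
  (forall f, 0 <= rdot f (A f)) -> forall f, l2norm (A f) ^+ 2 <= K * rdot f (A f).
Proof.
move=> sa K0 hK psd f; set g := A f.
have h := psd (f + (- K^-1)%:C *: g).
have sym : rdot f (A g) = rdot g g by rewrite /rdot -sa.
have gg : rdot g (A g) <= K * l2norm g ^+ 2.
  apply: le_trans (rdot_CS _ _) _.
  by rewrite expr2 [K * _]mulrCA ler_wpM2l ?l2norm_ge0// mulrC mulrA.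
move: h; rewrite bopAdd bopC rdotDl !rdotDr !rdotZl !rdotZr sym -/g rdotff => h.
have iK : K * K^-1 = 1 by rewrite mulfV// gt_eqF.
set u := K^-1 in h iK; set n := l2norm g ^+ 2 in h gg *.
have u0 : 0 < u by rewrite invr_gt0.
have : u ^+ 2 * rdot g (A g) <= u * n.
  rewrite expr2 -mulrA ler_pM2l// -[leRHS]mul1r -iK [K * u]mulrC -mulrA.
  by rewrite ler_pM2l.
move=> h2; have h3 : u * n <= rdot f g by nra.
by rewrite -[leLHS]mul1r -iK -mulrA ler_pM2l.
Qed.

(** If the supremum M of the form on the unit ball exceeded 1, M - J would be
    nonnegative and invertible, hence bounded below by [psd_norm], and the form of
    J would be bounded by a number smaller than M. *)
Lemma spectrum_form_up J : is_adjoint J J -> (forall t : R, 1 < t -> t%:C%:A - J \is a GRing.unit) ->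
  forall f, rdot f (J f) <= l2norm f ^+ 2.
Proof.
move=> sa un; have [K K0 hK] := bop_bound J.
have JK f : rdot f (J f) <= K * l2norm f ^+ 2.
  apply: le_trans (rdot_CS _ _) _.
  by rewrite expr2 [K * _]mulrCA ler_wpM2l ?l2norm_ge0// mulrC.
pose E := [set rdot f (J f) | f in [set f | l2norm f <= 1]].
have supE : has_sup E.
  split; first by exists (rdot 0 (J 0)); exists 0 => //=; rewrite l2norm0 ler01.
  exists K => _ [f /= f1 <-]; apply: le_trans (JK f) _.
  by rewrite -[leRHS]mulr1 ler_pM2l// expr_le1 ?l2norm_ge0.
have supP (M : R) : (forall f, l2norm f <= 1 -> rdot f (J f) <= M) -> forall f, rdot f (J f) <= M * l2norm f ^+ 2.
  move=> hM f; have [f0|f0] := eqVneq (l2norm f) 0.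
    by rewrite (l2norm_eq0 f0) bopA0 l2norm0 expr0n mulr0 /rdot dot0r.
  have fp : 0 < l2norm f by rewrite lt_neqAle eq_sym f0 l2norm_ge0.
  have := hM ((l2norm f)^-1%:C *: f); rewrite l2normZE normc_real ger0_norm ?invr_ge0 ?l2norm_ge0//.
  rewrite mulVf// => /(_ (lexx _)); rewrite bopC rdotZl rdotZr mulrA -expr2 exprVn.
  by rewrite mulrC ler_pdivrMr// exprn_gt0.
have [M1|M1] := lerP (sup E) 1.
  move=> f; rewrite -[leRHS]mul1r; apply: supP => g g1; apply: le_trans M1.
  by apply: ub_le_sup; [case: supE|exists g].
exfalso; set M := sup E in M1.
pose A := M%:C%:A - J.
have saA : is_adjoint A A.
  have := adjB (adjZ M%:C (@adj1 R)) sa; rewrite ?conjR ?conjcR; exact.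
have upM : forall f, rdot f (J f) <= M * l2norm f ^+ 2.
  by apply: supP => g g1; apply: ub_le_sup; [case: supE|exists g].
have psd f : 0 <= rdot f (A f) by rewrite rdot_scal subr_ge0.
have [K' K'0 hK'] := bop_bound A.
have h := psd_norm saA K'0 hK' psd.
have [B [BA _]] := bop_unitr_inv (un _ M1).
have [c c0 hc] := bop_bound B.
have fb f : l2norm f ^+ 2 <= c ^+ 2 * K' * rdot f (A f).
  have h1 : l2norm f <= c * l2norm (A f) by have := hc (A f); rewrite -bopME BA bop1E.
  apply: (@le_trans _ _ ((c * l2norm (A f)) ^+ 2)).
    by rewrite ler_pXn2r ?nnegrE ?mulr_ge0 ?l2norm_ge0// ltW.
  by rewrite exprMn -mulrA ler_pM2l ?exprn_gt0.
set k := c ^+ 2 * K' in fb.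
have k0 : 0 < k by rewrite mulr_gt0 ?exprn_gt0.
have ub f : rdot f (J f) <= (M - k^-1) * l2norm f ^+ 2.
  have := fb f; rewrite rdot_scal -ler_pdivrMl// => h1; lra.
have : M <= Num.max (M - k^-1) 0.
  apply: ge_sup; first by case: supE.
  move=> _ [f /= f1 <-]; rewrite le_max; have [m0|m0] := lerP (M - k^-1) 0.
    by apply/orP; right; apply: le_trans (ub f) _; rewrite mulr_le0_ge0 ?sqr_ge0.
  apply/orP; left; apply: le_trans (ub f) _; rewrite -[leRHS]mulr1 ler_pM2l//.
  by rewrite expr_le1 ?l2norm_ge0.
rewrite le_max => /orP[|]; last lra.
by rewrite lerBrDl gerDr leNgt invr_gt0 k0.
Qed.

Lemma spectrum_form J : is_adjoint J J -> spectrum J `<=` unit_segment R ->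
  forall f, `|rdot f (J f)| <= l2norm f ^+ 2.
Proof.
move=> sa sp f; rewrite ler_norml; apply/andP; split; last first.
  apply: spectrum_form_up => // t t1; apply/negPn/negP => /sp[x].
  by rewrite /= in_itv /= => /andP[_ x1] [e]; move: t1; rewrite -e ltNge x1.
have saN : is_adjoint (- J) (- J) by have := adjB (@adj0 R) sa; rewrite sub0r.
rewrite lerNl -rdotNr -bopNE; apply: spectrum_form_up => // t t1.
have n1 : (-1 : C) != 0 by rewrite oppr_eq0 oner_eq0.
apply: (unit_scale n1); rewrite scaleN1r opprB addrC.
have e : (- t)%:C%:A - J = - J - t%:C%:A by rewrite rmorphN scaleNr addrC.
rewrite addrC -e; apply/negPn/negP => /sp[x].
by rewrite /= in_itv /= => /andP[x1 _] [e']; lra.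
Qed.

(** The finitely supported vectors tested by [form_bd]. *)
Fixpoint vec n (k : int) (f : nat -> R) : l2 :=
  (f 0%N)%:C *: ket R k + (if n is n'.+1 then vec n' (k + 1) (fun i => f i.+1) else 0).

Lemma vec0E k (f : nat -> R) : vec 0 k f = (f 0%N)%:C *: ket R k + 0. Proof. by []. Qed.
Lemma vecSE n k (f : nat -> R) :
  vec n.+1 k f = (f 0%N)%:C *: ket R k + vec n (k + 1) (fun i => f i.+1).
Proof. by []. Qed.

Lemma vec_lt n k (f : nat -> R) (j : int) : j < k -> vec n k f j = 0.
Proof.
elim: n k f => [|n IH] k f jk.
  by rewrite vec0E l2D l20 l2Z ketE lt_eqF// mulr0 addr0.
by rewrite vecSE l2D l2Z ketE lt_eqF// mulr0 add0r IH//; lia.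
Qed.

Lemma vec_head n k (f : nat -> R) : vec n k f k = (f 0%N)%:C.
Proof.
case: n => [|n]; first by rewrite vec0E l2D l2Z ketE eqxx mulr1 l20 addr0.
by rewrite vecSE l2D l2Z ketE eqxx mulr1 vec_lt ?addr0//; lia.
Qed.

Lemma rdot_ketl j g : rdot (ket R j) g = complex.Re (g j).
Proof. by rewrite /rdot dot_ketl. Qed.

Lemma vec_norm n k (f : nat -> R) : l2norm (vec n k f) ^+ 2 = sqsum n f.
Proof.
elim: n k f => [|n IH] k f.
  by rewrite vec0E /= !addr0 l2normZE l2norm_ket mulr1 normc_real real_normK ?num_real.
rewrite vecSE norm2D IH rdotZl rdot_ketl vec_lt ?mulr0 ?addr0; last by lia.
by rewrite l2normZE l2norm_ket mulr1 normc_real real_normK ?num_real.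
Qed.

Lemma vec_form p q n k (f : nat -> R) : bddr p -> bddr q ->
  rdot (vec n k f) (jop p q (vec n k f)) = qform p q n k f.
Proof.
move=> bp bq; have sa := jop_adj bp bq.
have h0 (j : int) : complex.Re (jop p q (ket R j) j) = q j.
  rewrite jopE// !ketE eqxx (_ : (j - 1 == j) = false); last by lia.
  rewrite (_ : (j + 1 == j) = false); last by lia.
  by rewrite !mulr0 mulr1 add0r addr0.
elim: n k f => [|n IH] k f.
  by rewrite vec0E [RHS]/= !addr0 bopC rdotZl rdotZr rdot_ketl h0; ring.
rewrite vecSE; have IHv := IH (k + 1) (fun i => f i.+1).
set v := vec n _ _ in IHv *; rewrite bopAdd bopC.
have F1 : rdot (ket R k) (jop p q v) = p (k + 1) * f 1%N.
  rewrite rdot_ketl jopE// /v vec_head.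
  have -> : vec n (k + 1) (fun i => f i.+1) (k - 1) = 0 by apply: vec_lt; lia.
  have -> : vec n (k + 1) (fun i => f i.+1) k = 0 by apply: vec_lt; lia.
  by rewrite !mulr0 !add0r -rmorphM.
have F2 : rdot v (jop p q (ket R k)) = p (k + 1) * f 1%N.
  by rewrite -F1 rdotC /rdot sa.
have F3 : rdot (ket R k) (jop p q (ket R k)) = q k by rewrite rdot_ketl h0.
move: (jop p q v) (jop p q (ket R k)) IHv F1 F2 F3 => Jv Jk IHv F1 F2 F3.
rewrite rdotDl !rdotDr IHv !rdotZl !rdotZr F1 F2 F3 [RHS]/=; ring.
Qed.

Lemma spectrum_form_bd p q : bddr p -> bddr q -> spectrum (jop p q) `<=` unit_segment R ->
  form_bd p q.
Proof.
move=> bp bq sp n k f; rewrite -(vec_form n k f bp bq) -(vec_norm n k f).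
exact: spectrum_form (jop_adj bp bq) sp _.
Qed.

Lemma weyl_bdd p q t (W : int -> R) : bddr p -> bddr q -> 1 < `|t| ->
  (forall k, W k = t - q k - p (k + 1) ^+ 2 / W (k + 1)) -> (forall k, `|t| - 1 <= `|W k|) -> bddr W.
Proof.
move=> [P hP] [Q hQ] t1 WE Wb; exists (`|t| + Q + P ^+ 2 / (`|t| - 1)) => k.
have t0 : 0 < `|t| - 1 by rewrite subr_gt0.
rewrite WE; apply: (le_trans (ler_normB _ _)); apply: lerD.
  by apply: (le_trans (ler_normB _ _)); apply: lerD.
rewrite normrM normrX normfV; apply: ler_pM; rewrite ?sqr_ge0 ?invr_ge0//.
  by rewrite ler_pXn2r ?nnegrE// (le_trans _ (hP 0)).
by rewrite lef_pV2 ?posrE//; apply: lt_le_trans (Wb _).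
Qed.

(** t - J = B^* B with B = sqrt(W) - (p / sqrt(W)) S, where W is a Weyl sequence at
    the energy t. *)
Lemma weyl_psd p q t f : bddr p -> bddr q -> 1 < t -> form_bd p q ->
  rdot f (jop p q f) <= t * l2norm f ^+ 2.
Proof.
move=> bp bq t1 fb; have t0 : 0 < t by apply: lt_trans t1.
have ta : 1 < `|t| by rewrite gtr0_norm.
have [W [N [M [WE Wb _ _]]]] := weyl fb ta.
have W0 k : 0 < W k by have [] := Wb k; rewrite pmulr_lgt0.
have [BW hBW] := weyl_bdd bp bq ta WE (fun k => (Wb k).2).
have BW0 : 0 <= BW by apply: le_trans (hBW 0).
pose s k := Num.sqrt (W k); pose r k := p k / s k.
have s2 k : s k ^+ 2 = W k by rewrite sqr_sqrtr// ltW.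
have s0 k : 0 < s k by rewrite sqrtr_gt0.
have bs : bddr s.
  exists (Num.sqrt BW) => k; rewrite ger0_norm ?(ltW (s0 k))// ler_sqrt//.
  by apply: le_trans (hBW k); apply: ler_norm.
have br : bddr r.
  have [P hP] := bp; exists (P * (Num.sqrt (t - 1))^-1) => k.
  rewrite normrM; apply: ler_pM => //; rewrite normfV gtr0_norm//.
  rewrite lef_pV2 ?posrE ?sqrtr_gt0 ?subr_gt0//; apply: ler_wsqrtr.
  by have [_] := Wb k; rewrite (gtr0_norm (W0 k)) (gtr0_norm t0).
pose B := rdiag s - rdiag r * sh R 1.
pose B' := rdiag s - sh R (-1) * rdiag r.
have adj : is_adjoint B B'.
  exact: adjB (rdiag_adj bs) (adjM (rdiag_adj br) (sh_adj 1)).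
have fac0 n : B' (B f) n = t%:C * f n - jop p q f n.
  rewrite (jopE f n bp bq).
  have BE m : B f m = (s m)%:C * f m - (r m)%:C * f (m - 1).
    by rewrite bopBE l2B bopME !rdiagE// shE.
  rewrite bopBE l2B bopME shE !rdiagE// !BE opprK addrK.
  have e1 m : s m * r m = p m by rewrite /r mulrCA divff ?mulr1// gt_eqF.
  have e2 : s n ^+ 2 + r (n + 1) ^+ 2 = t - q n.
    by rewrite /r exprMn exprVn !s2 WE; ring.
  have C1 m : (s m)%:C * (r m)%:C = (p m)%:C :> C by rewrite -rmorphM e1.
  have C2 : (s n)%:C ^+ 2 + (r (n + 1))%:C ^+ 2 = t%:C - (q n)%:C :> C.
    by rewrite -!rmorphXn -rmorphD e2 rmorphB.
  rewrite -(C1 n) -(C1 (n + 1)).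
  transitivity (((s n)%:C ^+ 2 + (r (n + 1))%:C ^+ 2) * f n
     - (s n)%:C * (r n)%:C * f (n - 1) - (s (n + 1))%:C * (r (n + 1))%:C * f (n + 1)); first by ring.
  by rewrite C2; ring.
have fac : B' (B f) = t%:C *: f - jop p q f by apply: l2P => n; apply: fac0.
have : 0 <= rdot f (B' (B f)).
  by rewrite /rdot -adj -/(rdot _ _) rdotff sqr_ge0.
by rewrite fac rdotDr rdotNr rdotZr rdotff subr_ge0.
Qed.

Lemma form_bd_le p q f : bddr p -> bddr q -> form_bd p q -> rdot f (jop p q f) <= l2norm f ^+ 2.
Proof.
move=> bp bq fb; apply/ler_addgt0Pr => e e0.
pose n := l2norm f ^+ 2; have n0 : 0 <= n by apply: sqr_ge0.
have n1 : 0 < n + 1 by lra.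
have t1 : 1 < 1 + e / (n + 1) by rewrite ltrDl divr_gt0.
apply: (le_trans (weyl_psd f bp bq t1 fb)); rewrite -/n mulrDl mul1r lerD2l.
by rewrite mulrAC ler_pdivrMr// ler_pM2l//; lra.
Qed.

(** The lower bound of the form follows from the upper one for the matrix with
    diagonal - q, conjugate to - J by the signs (-1)^k. *)
Lemma form_bd_spectrum p q : bddr p -> bddr q -> form_bd p q ->
  spectrum (jop p q) `<=` unit_segment R.
Proof.
move=> bp bq fb; apply: form_spectrum; first exact: jop_adj.
  by move=> f; apply: form_bd_le.
move=> f; pose q' k := - q k.
have bq' : bddr q' by have [M h] := bq; exists M => k; rewrite normrN.
(* the unitary (-1)^k turns J(p,q) into -J(p,-q) *)
pose u : int -> R := fun k => (-1) ^+ `|k|%N.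
have bu : bddr u by exists 1 => k; rewrite normrX normrN1 expr1n.
have uu k : u k * u k = 1 by rewrite -expr2 -exprM mulnC exprM sqrrN !expr1n.
have uS k : u (k + 1) = - u k.
  have o : odd (absz (k + 1)%R) = ~~ odd (absz k) by lia.
  have sg n : (-1 : R) ^+ n = if odd n then -1 else 1.
    by rewrite -signr_odd; case: (odd n).
  by rewrite /u !sg o; case: (odd _) => /=; rewrite ?opprK.
have uP k : u (k - 1) = - u k by have := uS (k - 1); rewrite subrK => ->; rewrite opprK.
have CU k : (u k)%:C * (u k)%:C = 1 :> C by rewrite -rmorphM uu.
have := form_bd_le (rdiag u f) bp bq' (form_bd_opp fb).
have nE : l2norm (rdiag u f) ^+ 2 = l2norm f ^+ 2.
  rewrite -!rdotff /rdot rdiag_adj//; congr (complex.Re (l2dot _ _)); apply: l2P => k.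
  by rewrite !rdiagE// mulrA CU mul1r.
have -> : rdot (rdiag u f) (jop p q' (rdiag u f)) = - rdot f (jop p q f).
  rewrite -rdotNr /rdot rdiag_adj//; congr (complex.Re (l2dot _ _)); apply: l2P => k.
  rewrite rdiagE// jopE// l2N jopE// !rdiagE// uS uP /q' !rmorphN.
  transitivity (- ((u k)%:C * (u k)%:C * ((p k)%:C * f (k - 1) + (q k)%:C * f k + (p (k + 1))%:C * f (k + 1)))); first by ring.
  by rewrite CU mul1r.
by rewrite nE; lra.
Qed.
End Jacobi.

(** * Lower bounds *)

Section Dom.
Local Open Scope complex_scope.
Variable R : realType.
Local Notation C := R[i].
Local Notation l2 := (l2 R).
Local Notation bop := (bop R).
Implicit Types (f g h u : l2) (A B D X Y : bop).

(** X u is controlled by A u. Controlled operators form a left ideal, and A is bounded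
    below when 1 is controlled. *)
Definition dom A X := exists K : R, forall u, l2norm (X u) <= K * l2norm (A u).

Lemma domL A X Y : dom A X -> dom A (Y * X).
Proof.
move=> [K hK]; have [M M0 hM] := bop_bound Y; exists (M * K) => u.
by apply: (le_trans (hM _)); rewrite -mulrA ler_pM2l.
Qed.

Lemma domD A X Y : dom A X -> dom A Y -> dom A (X + Y).
Proof.
move=> [K hK] [M hM]; exists (K + M) => u.
by apply: (le_trans (l2norm_triangle _ _)); rewrite mulrDl; apply: lerD; [apply: hK|apply: hM].
Qed.

Lemma domN A X : dom A X -> dom A (- X).
Proof. by move=> [K hK]; exists K => u; rewrite bopNE l2normN. Qed.

Lemma domZ A X (z : C) : dom A X -> dom A (z *: X).
Proof. by move=> h; have := domL (z *: 1) h; rewrite -scalerAl mul1r. Qed.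

Lemma dom_self A Y : dom A (Y * A).
Proof. by apply: domL; exists 1 => u; rewrite mul1r. Qed.

Lemma dom0 A : dom A 0.
Proof. by exists 0 => u; rewrite mul0r l2norm0. Qed.

Lemma dom_sum A n (F : nat -> bop) : (forall i, (i < n)%N -> dom A (F i)) ->
  dom A (\sum_(i < n) F i).
Proof.
elim: n => [|n IH] h; first by rewrite big_ord0; exact: dom0.
by rewrite big_ord_recr /=; apply: domD; [apply: IH => i ni; apply: h; apply: ltnW|apply: h].
Qed.

(** A^2 is coercive. *)
Lemma dom_unit A : is_adjoint A A -> dom A 1 -> A \is a GRing.unit.
Proof.
move=> sa [K hK].
have : A * A \is a GRing.unit.
  pose k := `|K| + 1; have k0 : 0 < k by rewrite ltr_wpDl.
  apply: (@coercive_unit R _ (k ^- 2)); first by rewrite invr_gt0 exprn_gt0.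
  move=> f; rewrite bopME /rdot -sa -/(rdot _ _) rdotff ler_pdivrMl ?exprn_gt0//.
  rewrite -exprMn ler_pXn2r ?nnegrE ?mulr_ge0 ?l2norm_ge0 ?(ltW k0)//.
  apply: (le_trans (hK f)); apply: ler_wpM2r; first exact: l2norm_ge0.
  by apply: (le_trans (ler_norm _)); rewrite /k lerDl.
by rewrite unitrM_comm// => /andP[].
Qed.

(** With the weight N^(-1/2) the operator S^-1 r has norm at most
    sqrt(1 - 1/M). *)
Lemma weighted_recursion (r N : int -> R) (M : R) : (forall k, 1 <= N k <= M) ->
  (forall k, 1 + r k ^+ 2 * N k <= N (k - 1)) -> bddr r ->
  dom (1 - sh R (- 1) * rdiag r) 1.
Proof.
move=> NM hN br.
have N0 k : 0 < N k by case/andP: (NM k) => h _; apply: lt_le_trans h.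
have M1 : 1 <= M by case/andP: (NM 0) => h1 h2; apply: le_trans h2.
have M0 : 0 < M by apply: lt_le_trans M1.
pose g k := (Num.sqrt (N k))^-1.
have g0 k : 0 < g k by rewrite invr_gt0 sqrtr_gt0.
have g2 k : g k ^+ 2 = (N k)^-1 by rewrite exprVn sqr_sqrtr// ltW.
have g1 k : g k <= 1.
  rewrite -(ler_pXn2r (n := 2)) ?nnegrE ?(ltW (g0 k))// g2 expr1n invf_le1//.
  by case/andP: (NM k).
have bg : bddr g by exists 1 => k; rewrite gtr0_norm.
pose kap := Num.sqrt (1 - M^-1).
have MV : 0 < M^-1 <= 1 by rewrite invr_gt0 M0 invf_le1.
have kap2 : kap ^+ 2 = 1 - M^-1 by rewrite sqr_sqrtr// subr_ge0; case/andP: MV.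
have kap0 : 0 <= kap by apply: sqrtr_ge0.
have kap1 : kap < 1.
  rewrite -(ltr_pXn2r (n := 2)) ?nnegrE// expr1n kap2 gtrDl oppr_lt0.
  by case/andP: MV.
have gr k : g (k - 1) * `|r k| <= kap * g k.
  rewrite -(ler_pXn2r (n := 2)) ?nnegrE ?mulr_ge0 ?(ltW (g0 _))//.
  rewrite !exprMn !g2 kap2 real_normK ?num_real//.
  have h1 := hN k; have n0 := N0 k; have n1 := N0 (k - 1).
  have /andP[nl nM] := NM (k - 1).
  rewrite ler_pdivlMr// -mulrA ler_pdivrMl//.
  have h3 : N (k - 1) * M^-1 <= 1 by rewrite ler_pdivrMr// mul1r.
  by rewrite mulrBr mulr1; lra.
have key f : l2norm (rdiag g (sh R (-1) (rdiag r f))) <= kap * l2norm (rdiag g f).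
  rewrite -(sh_norm 1) -{1}(ger0_norm kap0) -normc_real -l2normZE.
  apply: l2norm_mono => k; rewrite shE rdiagE// shE rdiagE// opprK subrK l2Z rdiagE//.
  rewrite !normcM !normc_real mulrA mulrA ler_wpM2r ?normc_nneg//.
  by rewrite (gtr0_norm (g0 (k - 1))) (gtr0_norm (g0 k)) (ger0_norm kap0).
have lowg f : l2norm f <= Num.sqrt M * l2norm (rdiag g f).
  rewrite -{1}(ger0_norm (sqrtr_ge0 M)) -normc_real -l2normZE.
  apply: l2norm_mono => k; rewrite l2Z rdiagE// !normcM !normc_real mulrA.
  rewrite -[leLHS]mul1r ler_wpM2r ?normc_nneg// (ger0_norm (sqrtr_ge0 M)) gtr0_norm//.
  rewrite ler_pdivlMr ?sqrtr_gt0// mul1r; apply: ler_wsqrtr.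
  by case/andP: (NM k).
exists (Num.sqrt M / (1 - kap)) => f; rewrite bop1E.
apply: (le_trans (lowg f)); rewrite -mulrA ler_wpM2l ?sqrtr_ge0//.
have k1 : 0 < 1 - kap by rewrite subr_gt0.
rewrite ler_pdivlMl//.
set e := ((1 - sh R (- 1) * rdiag r : bop) f).
have E : rdiag g f = rdiag g e + rdiag g (sh R (-1) (rdiag r f)).
  by rewrite -bopAdd /e bopBE bop1E bopME subrK.
have := l2norm_triangle (rdiag g e) (rdiag g (sh R (-1) (rdiag r f))).
rewrite -E => h1; have h2 := key f.
have h3 : l2norm (rdiag g e) <= l2norm e.
  rewrite -[leRHS]mul1r; apply: rdiag_norm => // k; rewrite gtr0_norm//.
by rewrite mulrBl mul1r; lra.
Qed.

Lemma bop_sumE (I : Type) (r : seq I) (F : I -> bop) f k :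
  (\sum_(i <- r) F i) f k = \sum_(i <- r) (F i f k).
Proof.
elim: r => [|i r IH]; first by rewrite !big_nil.
by rewrite !big_cons -IH.
Qed.

Lemma bddseqM (s t : int -> C) : bddseq s -> bddseq t -> bddseq (fun k => s k * t k).
Proof. by move=> [M h] [N g]; exists (M * N) => k; rewrite normcM; apply: ler_pM; rewrite ?normc_nneg. Qed.

Lemma complexify_horner_wide (f : {poly R}) (z : C) N : (size f <= N)%N ->
  (complexify f).[z] = \sum_(i < N) (f`_i)%:C * z ^+ i.
Proof.
move=> sf; rewrite (@horner_coef_wide _ N); last by rewrite size_complexify.
by apply: eq_bigr => i _; rewrite /complexify coef_map.
Qed.

Lemma bddp_hornerC (f : int -> {poly R}) (z : C) : bddp f ->
  bddseq (fun k => (complexify (f k)).[z]).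
Proof.
move=> [N [sN bN]].
suff : forall n, bddseq (fun k => \sum_(i < n) ((f k)`_i)%:C * z ^+ i).
  move=> /(_ N)[M hM]; exists M => k; rewrite (complexify_horner_wide _ (sN k)); exact: hM.
elim=> [|n [M hM]]; first by exists 0 => k; rewrite big_ord0 normc0.
have [M' hM'] : bddseq (fun k => ((f k)`_n)%:C * z ^+ n).
  by apply: bddseqM; [apply: bddr_bddseq; exact: bN|exists (normc (z ^+ n))].
exists (M + M') => k; rewrite big_ord_recr /=.
by apply: (le_trans (le_normcD _ _)); apply: lerD.
Qed.
End Dom.

(** * The renormalization equation for operators *)

Lemma not_dvdz_small (d : nat) (k x : int) : x != 0 -> (absz x < d)%N ->
  ~~ ((d : int) %| (d : int) * k + x)%Z.
Proof.
move=> x0 xd; rewrite rpredDl ?dvdz_mulr// dvdzE absz_nat; apply/negP => /dvdn_leq.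
by rewrite absz_gt0 => /(_ x0); rewrite leqNgt xd.
Qed.

Section Renormalize.
Local Open Scope complex_scope.
Variable R : realType.
Local Notation C := R[i].
Local Notation l2 := (l2 R).
Local Notation bop := (bop R).
Implicit Types (f g h u x : l2).
Variables (T : {poly R}) (cs : seq R).
Hypothesis CT : critical T cs.
Local Notation m := (size cs).
Local Notation d := (size cs).+1.
Local Notation tau := (lead_coef T).
Variables (a : int) (pt qt : int -> R) (W : int -> R -> R).
Local Notation b := (site a d).
Hypothesis Wrec : forall k c, c \in cs ->
  W k c = T.[c] - qt k - pt (k + 1) ^+ 2 / W (k + 1) c.
Hypothesis Wsgn : forall k c, c \in cs -> 0 < W k c * T.[c].
Hypothesis Wbdd : forall c, c \in cs -> bddr (fun k => W k c) /\ bddr (fun k => (W k c)^-1).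
Hypotheses (ptb : bddr pt) (qtb : bddr qt).
Local Notation p := (solp T cs a pt W).
Local Notation q := (solq T cs a W).
Local Notation F := (solF T cs a pt W).
Local Notation w k := (wt T cs W k).
Local Notation h k := (hnorm cs (w k)).
Local Notation J := (jop p q).
Local Notation Jt := (jop pt qt).

Let pb : bddr p. Proof. exact: (solp_bdd CT a Wsgn Wbdd ptb). Qed.
Let qb : bddr q. Proof. exact: (solq_bdd CT a Wsgn Wbdd). Qed.
Let dn0 : (d : int) != 0. Proof. by []. Qed.
Local Notation U i := (proj R (a - i%:Z) dn0).
Let d1 : (1 < d)%N. Proof. by rewrite ltnS (crit_nil CT). Qed.

Section Point.
Variable z : C.
Local Notation Fz k n := ((complexify (F k n)).[z]).
Local Notation Tz := ((complexify T).[z]).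
Local Notation Dz := ((complexify (dpoly T cs)).[z]).

(** Evaluation at z is a ring morphism. *)
Lemma sol_kernelC : kernel a d z Tz Dz (fun n => (p n)%:C) (fun n => (q n)%:C)
  (fun k => (pt k)%:C) (fun k => (qt k)%:C) (fun k n => Fz k n).
Proof.
have := kernel_morph (horner_eval z \o map_poly (real_complex R)) (sol_kernel CT a Wrec Wsgn).
have E (s : int -> R) : (horner_eval z \o map_poly (real_complex R)) \o (fun n => (s n)%:P)
   = fun n => (s n)%:C by apply/funext => n; rewrite /= /horner_eval map_polyC hornerC.
rewrite !E; congr kernel.
by rewrite /= /horner_eval map_polyX hornerX.
Qed.

(** The rows of Phi(z) indexed by the sites b_k - i. *)
Definition phi_at (i : nat) : bop :=
  diag (fun k => Fz k (b k - i%:Z)) + diag (fun k => Fz (k - 1) (b k - i%:Z)) * sh R 1.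

Definition phi : bop := \sum_(i < d) emb R (a - i%:Z) (d : int) * phi_at i.

Lemma FL_bdd i : (i < d)%N -> bddseq (fun k => Fz k (b k - i%:Z)).
Proof.
move=> id; have [M hM] := bddp_hornerC z (solL_bdd CT Wsgn Wbdd id).
by exists M => k; rewrite solFE.
Qed.

Lemma FP_bdd i : (i < d)%N -> bddseq (fun k => Fz (k - 1) (b k - i%:Z)).
Proof.
move=> id; have [M hM] := bddp_hornerC z (bddpZ ptb (solP_bdd CT Wsgn Wbdd id)).
by exists M => k; rewrite solFrE.
Qed.

Lemma phiE x n : phi x n = kext a d (fun k n => Fz k n) x n.
Proof.
have [k [i [id ->]]] := @siteP a d n isT.
have E0 : \sum_(j < d | j != Ordinal id)
    (emb R (a - (j : nat)%:Z) (d : int) * phi_at j) x (b k - i%:Z) = 0.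
  apply: big1 => -[j jd] ji; rewrite bopME emb_out//.
  rewrite (_ : b k - i%:Z - (a - (nat_of_ord (Ordinal jd))%:Z) = (d : int) * k + (j%:Z - i%:Z)).
    have {ji} ji : j != i by apply: contraNneq ji => ji; apply/eqP/val_inj.
    by apply: not_dvdz_small; lia.
  by rewrite /site /=; ring.
rewrite /phi bop_sumE (bigD1 (Ordinal id)) //.
transitivity ((emb R (a - i%:Z) (d : int) * phi_at i) x (b k - i%:Z) + 0).
  by congr (_ + _); exact: E0.
rewrite addr0 (_ : b k - i%:Z = (a - i%:Z) + (d : int) * k); last by rewrite /site; ring.
rewrite bopME embE// /phi_at.
transitivity (diag (fun k => Fz k (b k - i%:Z)) x k
    + diag (fun k => Fz (k - 1) (b k - i%:Z)) (sh R 1 x) k); first by [].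
rewrite (diagE _ _ (FL_bdd id)) (diagE _ _ (FP_bdd id)) shE.
rewrite (_ : (a - i%:Z) + (d : int) * k = b k - i%:Z); last by rewrite /site; ring.
by rewrite (kext_site d1 sol_kernelC) 1?ltnW.
Qed.

Lemma phi_eq : (z%:A - J) * phi = emb R a (d : int) * (Tz%:A - Jt).
Proof.
apply: bopP => x; apply: l2P => n; rewrite bopME.
have AE (A : bop) (s : C) f k : (s%:A - A) f k = s * f k - A f k by [].
rewrite AE (jopE _ n pb qb) !phiE.
have [k [i [id ->]]] := @siteP a d n isT.
case: (posnP i) => [->|i0]; last first.
  rewrite (kext_in d1 sol_kernelC); last by rewrite i0.
  rewrite subrr emb_out// (_ : b k - i%:Z - a = (d : int) * k + - i%:Z).
    by apply: not_dvdz_small; lia.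
  by rewrite /site; ring.
rewrite subr0 (kext_diag d1 sol_kernelC) embE// AE (jopE _ k ptb qtb); ring.
Qed.

Lemma proj_phi : U 0 * phi = Dz%:A.
Proof.
apply: bopP => x; apply: l2P => k; rewrite bopME projE subr0 phiE.
by rewrite -/(b k) (kext_lat d1 sol_kernelC).
Qed.

(** (z - J)^-1 V = Phi(z) (T(z) - Jt)^-1. *)
Lemma renormalization_at : z%:A - J \is a GRing.unit -> Tz%:A - Jt \is a GRing.unit ->
  adjoint (emb R a (d : int)) * (z%:A - J)^-1 * emb R a (d : int)
   = Dz *: (Tz%:A - Jt)^-1.
Proof.
move=> uz ut; rewrite (adjE (emb_adj (R := R) a dn0)) -mulrA.
have -> : (z%:A - J)^-1 * emb R a (d : int) = phi * (Tz%:A - Jt)^-1.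
  apply: (mulrI uz); rewrite !mulrA divrr// mul1r phi_eq -mulrA divrr// mulr1//.
have := proj_phi; rewrite subr0 mulrA => ->.
by rewrite -scalerAl mul1r.
Qed.

Lemma phi_adj : exists phi', is_adjoint phi phi'.
Proof.
rewrite /phi; suff H : forall i, (i < d)%N -> exists D, is_adjoint (emb R (a - i%:Z) (d : int) * phi_at i) D.
  have {}H : forall i : 'I_d, exists D, is_adjoint (emb R (a - (i : nat)%:Z) (d : int) * phi_at i) D.
    by move=> i; apply: H.
  have [D hD] := choice H; exists (\sum_(i < d) D i).
  elim/big_rec2: _ => [|i A A' _ hA]; first exact: adj0.
  exact: adjD.
move=> i id; eexists; apply: adjM; first exact: emb_adj.
apply: adjD; first exact: diag_adj (FL_bdd id).
by apply: adjM (sh_adj _); apply: diag_adj; exact: FP_bdd.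
Qed.
End Point.

Section RealPoint.
Variable t : R.
Hypothesis ut : (T.[t])%:C%:A - Jt \is a GRing.unit.
Local Notation A := ((t%:C)%:A - J).

Let saJ : is_adjoint J J. Proof. exact: jop_adj. Qed.
Let saJt : is_adjoint Jt Jt. Proof. exact: jop_adj. Qed.

Lemma real_shift_adj (D : bop) (s : R) : is_adjoint D D -> is_adjoint (s%:C%:A - D) (s%:C%:A - D).
Proof. by move=> hD; have := adjB (adjZ s%:C (@adj1 R)) hD; rewrite ?conjR ?conjcR. Qed.

(** The adjoint of [phi_eq] is Phi^* (t - J) = (T(t) - Jt) V^*, and T(t) - Jt is
    invertible. *)
Lemma dom_lattice : dom A (U 0).
Proof.
have [phi' ad] := phi_adj t%:C.
have E : phi' * A = ((T.[t])%:C%:A - Jt) * U 0.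
  have e1 := adjM (real_shift_adj t saJ) ad.
  have e2 := adjM (emb_adj (R := R) a dn0) (real_shift_adj T.[t] saJt).
  have e3 : a - 0%:Z = a by rewrite subr0.
  rewrite e3; apply: (adj_uniq e1); rewrite phi_eq complexifyE.
  exact: e2.
have -> : U 0 = ((T.[t])%:C%:A - Jt)^-1 * phi' * A by rewrite -mulrA E mulrA mulVr// mul1r.
exact: dom_self.
Qed.

Local Notation P i := (fun k => (solP T cs W k i).[t]).
Local Notation sp i := (fun k => solp_at T cs pt W k i).
Local Notation sq i := (fun k => solq_at T cs W k i).

Let P_bdd i : (i < d)%N -> bddr (P i).
Proof. by move=> id; apply: bddp_horner; exact: (solP_bdd CT Wsgn Wbdd id). Qed.
Let sp_bdd i : (i < d)%N -> bddr (sp i).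
Proof. by move=> id; exact: (solp_at_bdd CT Wsgn Wbdd ptb id). Qed.
Let sq_bdd i : (i < d)%N -> bddr (sq i).
Proof. by move=> id; exact: (solq_at_bdd CT Wsgn Wbdd id). Qed.

(** The sequence p_(b_k) u(b_k - 1): together with u(b_k), the Cauchy data of u at
    the top of a block. *)
Definition ymom : bop := rdiag (sp 0%N) * U 1.
(** The part of u at the sites b_k - i which is not propagated from [ymom] by the
    orthogonal polynomials. *)
Definition err (i : nat) : bop := U i - rdiag (P i) * ymom.

Lemma UE i u k : U i u k = u (b k - i%:Z).
Proof. by rewrite projE /site; congr (u _); ring. Qed.

Lemma errE i u k : (i < d)%N ->
  err i u k = u (b k - i%:Z) - (P i k)%:C * ((sp 0%N k)%:C * u (b k - 1)).
Proof.
move=> id; rewrite /err bopBE l2B UE bopME (rdiagE _ _ (P_bdd id)) bopME.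
by rewrite (rdiagE _ _ (sp_bdd (ltn0Sn _))) UE.
Qed.

Lemma block_eq i u k : (0 < i < d)%N -> t%:C * u (b k - i%:Z) =
   (sp i k)%:C * u (b k - i.+1%:Z) + (sq i k)%:C * u (b k - i%:Z)
   + (sp i.-1 k)%:C * u (b k - i.-1%:Z) + A u (b k - i%:Z).
Proof.
move=> /andP[i0 id].
have -> : A u (b k - i%:Z) = t%:C * u (b k - i%:Z) - J u (b k - i%:Z) by [].
rewrite (jopE _ _ pb qb) (_ : b k - i%:Z + 1 = b k - i.-1%:Z); last by lia.
rewrite (_ : b k - i%:Z - 1 = b k - i.+1%:Z); last by lia.
by rewrite !solpE ?solqE//; [ring|lia].
Qed.

Lemma P_eq i k : (0 < i < m)%N -> t * P i k = sp i k * P i.+1 k + sq i k * P i k + sp i.-1 k * P i.-1 k.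
Proof.
move=> /andP[i0 im]; have id : (0 < i < d)%N by rewrite i0 ltnW.
have := congr1 (horner^~ t) (solP_in CT pt Wsgn k id).
by rewrite (ltn_eqF im) !(hornerE, hornerM, hornerD, hornerZ, hornerX).
Qed.

Lemma P_eq_last k :
  t * P m k = (Num.sqrt (h k m.-1))^-1 * (nodal cs).[t] + sq m k * P m k + sp m.-1 k * P m.-1 k.
Proof.
have id : (0 < m < d)%N by rewrite (crit_nil CT) ltnSn.
have := congr1 (horner^~ t) (solP_in CT pt Wsgn k id).
by rewrite eqxx !(hornerE, hornerM, hornerD, hornerZ, hornerX).
Qed.

Lemma err0 : err 0 = U 0.
Proof.
apply: bopP => u; apply: l2P => k; rewrite errE// UE /solP horner0.
by rewrite mul0r subr0.
Qed.

Lemma err1 : err 1 = 0.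
Proof.
have m0 := crit_nil CT.
apply: bopP => u; apply: l2P => k; rewrite errE// /solP /solp_at.
rewrite mulrA -rmorphM opol0 hornerZ hornerC mulr1 mulVf ?mul1r ?subrr//.
exact: (hneq0 CT Wsgn).
Qed.

Lemma err_step j u k : (j.+1 < m)%N ->
  err j.+2 u k = ((sp j.+1 k)^-1)%:C * (t%:C * err j.+1 u k - (sq j.+1 k)%:C * err j.+1 u k
   - (sp j k)%:C * err j u k - A u (b k - j.+1%:Z)).
Proof.
move=> jm; have jd : (0 < j.+1 < d)%N by rewrite /= ltnW.
rewrite (errE u k (jm : (j.+2 < d)%N)) (errE u k (ltnW jm : (j.+1 < d)%N)).
rewrite (errE u k (ltnW (ltnW jm) : (j < d)%N)).
have Eu := block_eq u k jd; have EP := P_eq k (i := j.+1) jm.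
have sp0 : sp j.+1 k != 0.
  rewrite /= (ltn_eqF jm); apply: mulf_neq0; last rewrite invr_eq0.
    exact: (hneq0 CT Wsgn).
  by apply: (hneq0 CT Wsgn); apply: ltnW.
have EPC : (t * P j.+1 k)%:C = (sp j.+1 k * P j.+2 k + sq j.+1 k * P j.+1 k + sp j k * P j k)%:C :> C.
  by rewrite EP.
have VC : ((sp j.+1 k)^-1 * sp j.+1 k)%:C = 1 :> C by rewrite mulVf.
move: Eu EPC VC; rewrite [j.+1.-1]/=.
move: (A u (b k - j.+1%:Z)) ((sp 0%N k)%:C * u (b k - 1)) => fu y.
move: (u (b k - j.+2%:Z)) (u (b k - j.+1%:Z)) (u (b k - j%:Z)) => u2 u1 u0.
move: (sp j.+1 k) (sq j.+1 k) (sp j k) (P j.+2 k) (P j.+1 k) (P j k) => s qq s' P2 P1 P0.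
rewrite !rmorphD !rmorphM => Eu EPC VC.
transitivity (s^-1%:C * s%:C * (u2 - P2%:C * y)); first by rewrite VC mul1r.
rewrite -mulrA; congr (_ * _).
transitivity (s%:C * u2 - (s%:C * P2%:C) * y); first by ring.
have -> : s%:C * u2 = t%:C * u1 - qq%:C * u1 - s'%:C * u0 - fu by rewrite Eu; ring.
have -> : s%:C * P2%:C = t%:C * P1%:C - qq%:C * P1%:C - s'%:C * P0%:C by rewrite EPC; ring.
by ring.
Qed.

Lemma comb_eval (V X1 S1 S0 X0 Y D : bop) (s : C) u k :
  (V * (s *: X1 - S1 * X1 - S0 * X0 - Y * D)) u k
  = V (s *: X1 u - S1 (X1 u) - S0 (X0 u) - Y (D u)) k.
Proof. by []. Qed.

Lemma comb_evalC (X1 S1 S0 Y : l2) (s : C) k :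
  (s *: X1 - S1 - S0 - Y) k = s * X1 k - S1 k - S0 k - Y k.
Proof. by []. Qed.

Lemma errS j : (j.+1 < m)%N -> err j.+2 = rdiag (fun k => (sp j.+1 k)^-1)
   * (t%:C *: err j.+1 - rdiag (sq j.+1) * err j.+1 - rdiag (sp j) * err j - U j.+1 * A).
Proof.
move=> jm; have bV : bddr (fun k => (sp j.+1 k)^-1).
  exact: (solpV_at_bdd CT pt Wsgn Wbdd jm).
apply: bopP => u; apply: l2P => k; rewrite err_step//.
rewrite comb_eval (rdiagE _ _ bV); congr (_ * _).
rewrite (comb_evalC (err j.+1 u) (rdiag (sq j.+1) (err j.+1 u))
  (rdiag (sp j) (err j u)) (U j.+1 (A u)) t%:C k).
rewrite (rdiagE (err j.+1 u) k (sq_bdd (ltnW jm : (j.+1 < d)%N))).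
by rewrite (rdiagE (err j u) k (sp_bdd (ltnW (ltnW jm) : (j < d)%N))) (UE j.+1 (A u) k).
Qed.

Lemma dom_rec (V X1 S1 S0 X0 Y D : bop) (s : C) : dom D X1 -> dom D X0 ->
  dom D (V * (s *: X1 - S1 * X1 - S0 * X0 - Y * D)).
Proof.
move=> h1 h0; apply: domL; apply: domD; last by apply: domN; exact: dom_self.
apply: domD; last by apply: domN; apply: domL.
by apply: domD; [exact: domZ|apply: domN; apply: domL].
Qed.

(** The errors satisfy the recurrence of the block with initial data on the lattice
    and with a source term in the range of t - J. *)
Lemma dom_err i : (i <= m)%N -> dom A (err i).
Proof.
have m0 := crit_nil CT.
suff H : forall j, (j < m)%N -> dom A (err j) /\ dom A (err j.+1).
  case: i => [|i] im; first by have [] := H 0%N m0.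
  by have [] := H i im.
elim=> [|j IH] jm.
  by split; [rewrite err0; exact: dom_lattice|rewrite err1; exact: dom0].
case: (IH (ltnW jm)) => h0 h1; split; first exact: h1.
by rewrite (errS jm); apply: dom_rec.
Qed.
(** The last equation of the block: the nodal polynomial appears because it is the
    orthogonal polynomial of degree m. *)
Lemma err_last u k : ((Num.sqrt (h k m.-1))^-1 * (nodal cs).[t])%:C * ymom u k
   = (sp m k)%:C * u (b (k - 1)) + (sq m k)%:C * err m u k - t%:C * err m u k
     + (sp m.-1 k)%:C * err m.-1 u k + A u (b k - m%:Z).
Proof.
have m0 := crit_nil CT; have md : (0 < m < d)%N by rewrite m0 ltnSn.
have m1d : (m.-1 < d)%N by rewrite (leq_ltn_trans (leq_pred _)).
rewrite (errE u k (ltnSn m)) (errE u k m1d).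
have -> : ymom u k = (sp 0%N k)%:C * u (b k - 1).
  by rewrite /ymom bopME (rdiagE _ _ (sp_bdd (ltn0Sn _))) UE.
have Eu := block_eq u k md.
have EPC : (t * P m k)%:C = ((Num.sqrt (h k m.-1))^-1 * (nodal cs).[t] + sq m k * P m k
    + sp m.-1 k * P m.-1 k)%:C :> C by rewrite P_eq_last.
move: Eu EPC; rewrite -siteB1.
move: (A u (b k - m%:Z)) ((sp 0%N k)%:C * u (b k - 1)) => fu y.
move: (u (b (k - 1))) (u (b k - m%:Z)) (u (b k - m.-1%:Z)) => u2 u1 u0.
move: (sp m k) (sq m k) (sp m.-1 k) (P m k) (P m.-1 k) => s qq s' P1 P0.
move: ((Num.sqrt (h k m.-1))^-1 * (nodal cs).[t]) => nu.
rewrite !rmorphD !rmorphM => Eu EPC.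
have -> : nu%:C = t%:C * P1%:C - qq%:C * P1%:C - s'%:C * P0%:C by rewrite EPC; ring.
have -> : fu = t%:C * u1 - s%:C * u2 - qq%:C * u1 - s'%:C * u0 by rewrite Eu; ring.
by ring.
Qed.

Lemma regular_eval (V S1 S X0 S2 X1 S3 X2 Y D : bop) (s : C) u k :
  (V * (S1 * (S * X0) + S2 * X1 - s *: X1 + S3 * X2 + Y * D)) u k
  = V (S1 (S (X0 u)) + S2 (X1 u) - s *: X1 u + S3 (X2 u) + Y (D u)) k.
Proof. by []. Qed.

Lemma regular_evalC (f1 f2 f3 f4 f5 : l2) (s : C) k :
  (f1 + f2 - s *: f3 + f4 + f5) k = f1 k + f2 k - s * f3 k + f4 k + f5 k.
Proof. by []. Qed.

(** Away from the critical points [err_last] can be solved for [ymom]. *)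
Lemma dom_ymom_regular : (nodal cs).[t] != 0 -> dom A ymom.
Proof.
move=> n0; have m0 := crit_nil CT; have m1 : (m.-1 < m)%N by rewrite prednK.
have m1d : (m.-1 < d)%N by rewrite (leq_ltn_trans (leq_pred _)).
pose V k := Num.sqrt (h k m.-1) * (nodal cs).[t]^-1.
have bV : bddr V by apply: bddrM (sqrth_bdd CT Wsgn Wbdd m1) (bddr_cst _).
have -> : ymom = rdiag V * (rdiag (sp m) * (sh R 1 * U 0) + rdiag (sq m) * err m
    - t%:C *: err m + rdiag (sp m.-1) * err m.-1 + U m * A).
  apply: bopP => u; apply: l2P => k; rewrite regular_eval (rdiagE _ _ bV).
  rewrite (regular_evalC (rdiag (sp m) (sh R 1 (U 0 u))) (rdiag (sq m) (err m u))
    (err m u) (rdiag (sp m.-1) (err m.-1 u)) (U m (A u)) t%:C k).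
  rewrite (rdiagE (sh R 1 (U 0 u)) k (sp_bdd (ltnSn _))) (rdiagE (err m u) k (sq_bdd (ltnSn _))).
  rewrite (rdiagE (err m.-1 u) k (sp_bdd m1d)) (shE 1 (U 0 u) k) (UE m (A u) k) (UE 0 u (k - 1)) subr0.
  rewrite -err_last mulrA -rmorphM /V.
  have s0 : Num.sqrt (h k m.-1) != 0 by exact: (hneq0 CT Wsgn).
  have E (x y : R) : x != 0 -> y != 0 -> x * y^-1 * (x^-1 * y) = 1.
    by move=> x0 y0; field; rewrite x0 y0.
  by rewrite E ?mul1r.
apply: domL; apply: domD; last exact: dom_self.
apply: domD; last by apply: domL; apply: dom_err; exact: leq_pred.
apply: domD; last by apply: domN; apply: domZ; exact: dom_err.
apply: domD; first by apply: domL; apply: domL; exact: dom_lattice.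
by apply: domL; exact: dom_err.
Qed.

(** The equation at a lattice site links the values of [ymom] of two neighbouring
    blocks. *)
Lemma diag_eq u k : ymom u k + (sp m (k + 1) * P m (k + 1))%:C * ymom u (k + 1) =
  t%:C * u (b k) - (sol_q0 T cs)%:C * u (b k)
   - (sp m (k + 1))%:C * err m u (k + 1) - A u (b k).
Proof.
have yE k' : ymom u k' = (sp 0%N k')%:C * u (b k' - 1).
  by rewrite /ymom bopME (rdiagE _ _ (sp_bdd (ltn0Sn _))) UE.
rewrite (errE u (k + 1) (ltnSn m)) -[(sp 0%N (k + 1))%:C * _]yE.
have Au : A u (b k) = t%:C * u (b k) - J u (b k) by [].
have e1 : b k + 1 = b (k + 1) - m%:Z by rewrite siteD1; lia.
have p0 : p (b k) = sp 0%N k by have := @solpE _ T cs a pt W k 0 isT; rewrite subr0.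
have q0 : q (b k) = sol_q0 T cs by have := @solqE _ T cs a W k 0 isT; rewrite subr0.
rewrite Au (jopE _ _ pb qb) e1 p0 q0 (@solpE _ T cs a pt W (k + 1) m (ltnSn m)) -yE.
move: (ymom u k) (ymom u (k + 1)) (u (b k)) (u (b (k + 1) - m%:Z)) => y0 y1 u0 um.
by rewrite rmorphM; ring.
Qed.

Lemma weyl_ratio k : t \in cs -> sp m k * P m k = - (pt k / W k t).
Proof.
move=> tc; have m0 := crit_nil CT; have m1 : (m.-1 < m)%N by rewrite prednK.
rewrite (solp_at_last CT) (solPm CT) hornerZ.
have wk k' c : c \in cs -> 0 < w k' c by move=> hc; exact: (wt_gt0 CT Wsgn).
have o := opol_last (crit_uniq CT) (wk k) tc.
have h0 := lt0r_neq0 (h_gt0 CT Wsgn k m1).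
have W0 := W_neq0 Wsgn k tc; have l0 := lpoly_neq0 cs t.
have t0 := lt0r_neq0 (crit_lead CT).
have wE : w k t = - W k t / (tau * (lpoly cs t).[t]) by [].
have s2 := sqrt_h2 CT Wsgn k m1; have sn0 := hneq0 CT Wsgn k m1.
have : (opol cs (w k) m.-1).[t] * - W k t = tau * Num.sqrt (h k m.-1) ^+ 2.
  by rewrite -s2 -o wE; field; rewrite t0 l0.
move: (opol cs (w k) m.-1).[t] (Num.sqrt (h k m.-1)) sn0 => pi s sn0 E.
have -> : pi = - (tau * s ^+ 2) / W k t by rewrite -E; field.
by field; rewrite W0 t0 sn0.
Qed.

Lemma dom_trans (A' B X : bop) : dom B 1 -> dom A' (B * X) -> dom A' X.
Proof.
move=> [K hK] [L hL]; exists (`|K| * L) => u.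
have h1 := hK (X u); rewrite bop1E in h1; apply: (le_trans h1).
apply: (@le_trans _ _ (`|K| * l2norm (B (X u)))).
  by rewrite ler_wpM2r ?l2norm_ge0 ?ler_norm.
by rewrite -mulrA ler_wpM2l//; apply: hL.
Qed.

Lemma critical_eval (X0 S S1 X1 D : bop) (s s' : C) u k :
  (s *: X0 - s' *: X0 - S * (S1 * X1) - X0 * D) u k
  = s * X0 u k - s' * X0 u k - S (S1 (X1 u)) k - X0 (D u) k.
Proof. by []. Qed.

Lemma one_sub_eval (S X Y : bop) u k : ((1 - S * X) * Y) u k = Y u k - S (X (Y u)) k.
Proof. by []. Qed.

(** At a critical point the recursion of [diag_eq] has ratio pt / W, which is
    contractive in the weight provided by the Weyl sequence. *)
Lemma dom_ymom_critical (N : int -> R) (M : R) : t \in cs -> (forall k, 1 <= N k <= M) ->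
  (forall k, 1 + (pt k / W k t) ^+ 2 * N k <= N (k - 1)) -> dom A ymom.
Proof.
move=> tc NM hN; pose r k := pt k / W k t.
have br : bddr r by apply: bddrM ptb (Wbdd tc).2.
apply: (dom_trans (weighted_recursion NM hN br)).
have -> : (1 - sh R (- 1) * rdiag r) * ymom = t%:C *: U 0 - (sol_q0 T cs)%:C *: U 0
   - sh R (- 1) * (rdiag (sp m) * err m) - U 0 * A.
  apply: bopP => u; apply: l2P => k; rewrite one_sub_eval critical_eval.
  rewrite (shE (-1) (rdiag r (ymom u)) k) (shE (-1) (rdiag (sp m) (err m u)) k) opprK.
  rewrite (rdiagE (ymom u) _ br) (rdiagE (err m u) _ (sp_bdd (ltnSn _))).
  rewrite (UE 0 u k) (UE 0 (A u) k) subr0 -diag_eq (weyl_ratio _ tc) rmorphN mulNr.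
  by [].
apply: domD; last by apply: domN; exact: dom_self.
apply: domD; last by apply: domN; apply: domL; apply: domL; exact: dom_err.
apply: domD; first by apply: domZ; exact: dom_lattice.
by apply: domN; apply: domZ; exact: dom_lattice.
Qed.

Lemma lattice_decomposition : 1 = \sum_(i < d) emb R (a - i%:Z) (d : int) * U i :> bop.
Proof.
apply: bopP => u; apply: l2P => n; rewrite bop_sumE.
have [k [i [id ->]]] := @siteP a d n isT.
rewrite (bigD1 (Ordinal id)) //.
have E0 : \sum_(j < d | j != Ordinal id)
    (emb R (a - (j : nat)%:Z) (d : int) * U j) u (b k - i%:Z) = 0.
  apply: big1 => -[j jd] ji; rewrite bopME emb_out//.
  rewrite (_ : b k - i%:Z - (a - (nat_of_ord (Ordinal jd))%:Z) = (d : int) * k + (j%:Z - i%:Z)).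
    have {ji} ji : j != i by apply: contraNneq ji => ji; apply/eqP/val_inj.
    by apply: not_dvdz_small; lia.
  by rewrite /site /=; ring.
transitivity ((emb R (a - i%:Z) (d : int) * U i) u (b k - i%:Z) + 0); last first.
  by congr (_ + _); rewrite E0.
rewrite addr0 bopME (_ : b k - i%:Z = (a - i%:Z) + (d : int) * k); last by rewrite /site; ring.
by rewrite embE// projE.
Qed.

(** All sites are controlled: those of the lattice and [ymom] directly, the others by
    u = err + P * ymom. *)
Lemma real_point_unit : dom A ymom -> A \is a GRing.unit.
Proof.
move=> dy; apply: dom_unit; first exact: real_shift_adj.
suff H : dom A (\sum_(i < d) emb R (a - i%:Z) (d : int) * U i).
  by move: H; rewrite -lattice_decomposition.
have dU i : (i < d)%N -> dom A (U i).
  move=> id; have -> : U i = err i + rdiag (P i) * ymom by rewrite /err subrK.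
  by apply: domD; [exact: dom_err|apply: domL].
exact: (@dom_sum R A d (fun i => emb R (a - i%:Z) (d : int) * U i) (fun i id => domL _ (dU i id))).
Qed.
End RealPoint.
End Renormalize.

(** * Existence of solutions *)

Section Existence.
Local Open Scope complex_scope.
Variable R : realType.
Local Notation C := R[i].
Local Notation bop := (bop R).

Lemma form_bd_unit (p q : int -> R) (z : C) : bddr p -> bddr q -> form_bd p q ->
  ~ unit_segment R z -> z%:A - jop p q \is a GRing.unit.
Proof.
move=> bp bq fb nz; apply/negPn/negP => nu; apply: nz.
exact: (form_bd_spectrum bp bq fb).
Qed.

Lemma lowV_bdd (s : int -> R) (e : R) : 0 < e -> (forall k, e <= `|s k|) -> bddr (fun k => (s k)^-1).
Proof.
move=> e0 h; exists e^-1 => k; rewrite normfV lef_pV2 ?posrE//.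
exact: lt_le_trans (h k).
Qed.

(** The Weyl values of Jt at the critical values of T feed the inverse problem. A
    nonreal z is not in the spectrum of J; a real one with T(z) outside [-1, 1]
    is handled by [real_point_unit], according to whether z is critical or not. *)
Theorem renormalization_exists (T : {poly R}) (cs : seq R) (eps : nat) (pt qt : int -> R) :
  critical T cs -> (forall k, 0 <= pt k) -> bddr pt -> bddr qt -> form_bd pt qt ->
  exists W : int -> R -> R,
    [/\ forall k c, c \in cs -> W k c = T.[c] - qt k - pt (k + 1) ^+ 2 / W (k + 1) c,
        forall k c, c \in cs -> 0 < W k c * T.[c],
        forall k c, c \in cs -> `|T.[c]| - 1 <= `|W k c|
      & renormalization_solution eps (jop pt qt) T
          (jop (solp T cs (eps%:Z) pt W) (solq T cs (eps%:Z) W))].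
Proof.
move=> CT pt0 bp bq fb.
have weyl_c (c : R) : exists X : (int -> R) * (int -> R) * R, c \in cs ->
  [/\ forall k, X.1.1 k = T.[c] - qt k - pt (k + 1) ^+ 2 / X.1.1 (k + 1),
      forall k, 0 < X.1.1 k * T.[c] /\ `|T.[c]| - 1 <= `|X.1.1 k|,
      forall k, 1 <= X.1.2 k <= X.2 &
      forall k, 1 + (pt k / X.1.1 k) ^+ 2 * X.1.2 k <= X.1.2 (k - 1)].
  case: (boolP (c \in cs)) => hc; last by exists (fun=> 0, fun=> 0, 0).
  have [W [N [M h]]] := weyl fb (crit_val CT hc).
  by exists (W, N, M).
have [X hX] := choice weyl_c.
pose W k c := (X c).1.1 k; exists W.
have Wrec k c : c \in cs -> W k c = T.[c] - qt k - pt (k + 1) ^+ 2 / W (k + 1) c.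
  by move=> hc; have [h _ _ _] := hX c hc; apply: h.
have Wsgn k c : c \in cs -> 0 < W k c * T.[c].
  by move=> hc; have [_ h _ _] := hX c hc; have [] := h k.
have Wge k c : c \in cs -> `|T.[c]| - 1 <= `|W k c|.
  by move=> hc; have [_ h _ _] := hX c hc; have [] := h k.
split => //.
have Wbdd c : c \in cs -> bddr (fun k => W k c) /\ bddr (fun k => (W k c)^-1).
  move=> hc; have c1 := crit_val CT hc; split; last first.
    by apply: (@lowV_bdd _ (`|T.[c]| - 1)); [rewrite subr_gt0|move=> k; apply: Wge].
  by apply: (weyl_bdd bp bq c1); [move=> k; apply: Wrec|move=> k; apply: Wge].
have pb := solp_bdd CT eps%:Z Wsgn Wbdd bp.
have qb := solq_bdd CT eps%:Z Wsgn Wbdd.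
have dT : degree T = (size cs).+1 by rewrite /degree (crit_size CT).
have unit z : ~ preimage_segment T z ->
    z%:A - jop (solp T cs eps%:Z pt W) (solq T cs eps%:Z W) \is a GRing.unit.
  move=> nz; have [y0|y0] := eqVneq (complex.Im z) 0; last first.
    by apply: selfadj_nonreal_unit => //; exact: jop_adj.
  have zE : z = (complex.Re z)%:C by case: z y0 {nz} => x y /= ->.
  move: nz; rewrite zE; move: (complex.Re z) => t {zE y0 z} nz.
  have ut : (T.[t])%:C%:A - jop pt qt \is a GRing.unit.
    by apply: form_bd_unit => // h; apply: nz; rewrite /preimage_segment /= complexifyE.
  apply: (real_point_unit CT Wrec Wsgn Wbdd bp bq ut).
  have [n0|n0] := eqVneq (nodal cs).[t] 0; last first.
    exact: (dom_ymom_regular CT eps%:Z Wrec Wsgn Wbdd bp bq ut).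
  have tc : t \in cs.
    by rewrite -root_prod_XsubC; apply/eqP.
  have [_ _ hN hN'] := hX t tc.
  exact: (dom_ymom_critical CT eps%:Z Wrec Wsgn Wbdd bp bq ut tc hN hN').
split.
- apply: jop_jacobi => //; exact: (good_p0 (sol_good CT eps%:Z pt0 Wrec Wsgn)).
- by move=> z nu; apply: contrapT => nz; move: nu; rewrite /spectrum /= unit.
move=> z nz; rewrite dT.
have uT : (complexify T).[z]%:A - jop pt qt \is a GRing.unit by exact: form_bd_unit.
rewrite (renormalization_at CT Wrec Wsgn Wbdd bp bq (unit z nz) uT); congr (_ *: _).
rewrite complexify_deriv (dpolyE CT).
have -> : complexify ((size cs).+1%:R *: dpoly T cs) = (size cs).+1%:R *: complexify (dpoly T cs).
  by rewrite -[LHS]/(map_poly _ _) map_polyZ; congr (_ *: _); exact: rmorph_nat.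
by rewrite hornerZ mulrAC mulfV ?mul1r// pnatr_eq0.
Qed.
End Existence.

(** * Renormalization on coefficients *)

Section Tower.
Local Open Scope complex_scope.
Variable R : realType.
Local Notation C := R[i].
Local Notation bop := (bop R).
Local Notation data := ((int -> R) * (int -> R))%type.
Implicit Types (x y : data) (T : {poly R}).

(** Coefficients of a Jacobi matrix with spectrum in [-1, 1]. *)
Definition unit_jacobi x := (forall k, 0 <= x.1 k) /\ form_bd x.1 x.2.

Definition close (e : R) x y := forall n, `|x.1 n - y.1 n| <= e /\ `|x.2 n - y.2 n| <= e.

Definition dshift (k : int) x : data := (fun n => x.1 (n + k), fun n => x.2 (n + k)).

Definition jac x : bop := jop x.1 x.2.

(** One enumeration of the critical points is fixed for each polynomial, so that
    uniqueness statements refer to the same list. *)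
Definition critseq T : seq R := xget [::] [set cs | critical T cs /\
  forall z, critical_point T z <-> exists2 c, c \in cs & z = c%:C].

Definition large T := forall c, c \in critseq T -> 100 <= `|T.[c]|.

(** y solves the equation for x, with the attracting Weyl values. *)
Definition renorm_step T (a : int) x y := exists F,
  good a T (critseq T) x.1 x.2 y.1 y.2 F /\ bigW a (critseq T) y.1 F.

Lemma critseqP T : expanding T -> critical T (critseq T) /\
  forall z, critical_point T z <-> exists2 c, c \in critseq T & z = c%:C.
Proof.
move=> /expanding_critical[cs h]; rewrite /critseq.
by case: xgetP => [cs' _ //|/(_ cs)].
Qed.

Lemma critseq_size T : expanding T -> (size (critseq T)).+1 = degree T.
Proof. by move=> /critseqP[C _]; rewrite /degree (crit_size C). Qed.

Lemma large4 T : large T -> forall c, c \in critseq T -> 4 <= `|T.[c]|.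
Proof. by move=> h c hc; apply: le_trans (h c hc); lra. Qed.

Lemma unit_jacobi_unit x : unit_jacobi x -> unitdata x.1 x.2.
Proof. by move=> [_ fb]; apply: form_bd_entries. Qed.

Lemma unit_jacobi_bdd x : unit_jacobi x -> bddr x.1 /\ bddr x.2.
Proof. by move=> /unit_jacobi_unit h; split; exists 1 => k; case: (h k). Qed.

Lemma unit_jacobi_close x y : unit_jacobi x -> unit_jacobi y -> close 2 x y.
Proof.
move=> /unit_jacobi_unit hx /unit_jacobi_unit hy n; have [a1 a2] := hx n; have [b1 b2] := hy n.
by split; apply: (le_trans (ler_normB _ _)); lra.
Qed.

Lemma close_sym e x y : close e x y -> close e y x.
Proof. by move=> h n; rewrite ![`|y.1 n - _|]distrC ![`|y.2 n - _|]distrC. Qed.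

Lemma qform_shift p q n k (f : nat -> R) (s : int) :
  qform (fun j => p (j + s)) (fun j => q (j + s)) n k f = qform p q n (k + s) f.
Proof.
elim: n k f => [|n IH] k f //=; rewrite IH.
by have -> : k + 1 + s = k + s + 1 by ring.
Qed.

Lemma unit_jacobi_shift k x : unit_jacobi x -> unit_jacobi (dshift k x).
Proof.
move=> [p0 fb]; split => [n|n j f]; first exact: p0.
by rewrite qform_shift; apply: fb.
Qed.

Lemma unit_jacobi0 : unit_jacobi (fun=> 0, fun=> 0).
Proof.
split => // n k f /=.
have -> : forall k f, qform (fun=> 0) (fun=> 0) n k f = 0 :> R.
  by elim: n {k f} => [|n IH] k f /=; rewrite ?IH; ring.
by rewrite normr0; apply: le_trans (sqsum_ge n f); apply: sqr_ge0.
Qed.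

Lemma jacobi_has_data (J : bop) : is_jacobi J -> spectrum J `<=` unit_segment R ->
  exists2 x, unit_jacobi x & J = jac x.
Proof.
move=> /jacobi_jop[p [q [bp bq p0 ->]]] sp; exists (p, q) => //.
by split => //; apply: spectrum_form_bd.
Qed.

Lemma jac_inj x y : unit_jacobi x -> unit_jacobi y -> jac x = jac y -> x = y.
Proof.
move=> /unit_jacobi_bdd[p1 q1] /unit_jacobi_bdd[p2 q2] e.
have h k := jop_entries k p1 q1 p2 q2.
have n0 : opnorm (jop x.1 x.2 - jop y.1 y.2) = 0.
  apply/eqP; rewrite eq_le opnorm_ge0 andbT; apply: opnorm_le => // f.
  by rewrite -[jop x.1 x.2]/(jac x) e subrr bop0E l2norm0 mul0r.
case: x y p1 q1 p2 q2 {e} h n0 => [p q] [p' q'] /= _ _ _ _ h n0.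
by congr pair; apply/funext => k; have [h1 h2] := h k; apply/eqP;
  rewrite -subr_eq0 -normr_le0 -n0.
Qed.

Lemma jac_close (e : R) x y : 0 <= e -> unit_jacobi x -> unit_jacobi y -> close e x y -> opnorm (jac x - jac y) <= 3 * e.
Proof.
move=> e0 /unit_jacobi_bdd[p1 q1] /unit_jacobi_bdd[p2 q2] h.
by apply: jop_dist => // k; have [] := h k.
Qed.

Lemma close_jac x y : unit_jacobi x -> unit_jacobi y -> close (opnorm (jac x - jac y)) x y.
Proof. by move=> /unit_jacobi_bdd[p1 q1] /unit_jacobi_bdd[p2 q2] k; apply: jop_entries. Qed.

Lemma jac_shift k x : unit_jacobi x -> shiftZ R ^ (- k) * jac x * shiftZ R ^ k = jac (dshift k x).
Proof. by move=> /unit_jacobi_bdd[p1 q1]; rewrite !shiftX jop_conj. Qed.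

(** The construction has |W_k(c)| >= |T(c)| - 1, and its spectrum is in
    T^-1([-1, 1]), hence in [-1, 1]. *)
Lemma solution_step T (a : nat) x : expanding T -> unit_jacobi x -> exists2 y, unit_jacobi y &
  renormalization_solution a (jac x) T (jac y) /\ (large T -> renorm_step T a%:Z x y).
Proof.
move=> eT cx; have [CT _] := critseqP eT; have [p0 fb] := cx; have [bp bq] := unit_jacobi_bdd cx.
have [W [Wrec Wsgn Wge RS]] := renormalization_exists a CT p0 bp bq fb.
exists (solp T (critseq T) a%:Z x.1 W, solq T (critseq T) a%:Z W).
  have [j sp _] := RS.
  have G0 := good_p0 (sol_good CT a%:Z p0 Wrec Wsgn).
  have Wbdd c : c \in critseq T -> bddr (fun k => W k c) /\ bddr (fun k => (W k c)^-1).
    move=> hc; have c1 := crit_val CT hc; split; last first.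
      by apply: (@lowV_bdd _ _ (`|T.[c]| - 1)); [rewrite subr_gt0|move=> k; apply: Wge].
    by apply: (weyl_bdd bp bq c1); [move=> k; apply: Wrec|move=> k; apply: Wge].
  split; first exact: G0.
  apply: spectrum_form_bd.
  - exact: (solp_bdd CT a%:Z Wsgn Wbdd bp).
  - exact: (solq_bdd CT a%:Z Wsgn Wbdd).
  - by apply: (subset_trans sp); case: eT.
split; first exact: RS.
move=> bT; exists (solF T (critseq T) a%:Z x.1 W); split; first exact: sol_good.
move=> k c hc; rewrite (solL1_W CT a%:Z x.1 k hc Wsgn).
by apply: le_trans (Wge k c hc); have := bT c hc; lra.
Qed.

Lemma renorm_step_unique T a x y y' : expanding T -> large T -> unit_jacobi x -> renorm_step T a x y -> renorm_step T a x y' -> y = y'.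
Proof.
move=> eT bT cx [F [G B]] [F' [G' B']]; have [CT _] := critseqP eT.
have [e1 e2] := good_unique_big CT (large4 bT) (unit_jacobi_unit cx) G G' B B'.
by case: y y' {G B G' B'} e1 e2 => [p q] [p' q'] /= e1 e2; congr pair; apply/funext.
Qed.

Lemma renorm_step_lip T a x x' y y' (e : R) : expanding T -> large T -> unit_jacobi x -> unit_jacobi x' -> unit_jacobi y ->
  renorm_step T a x y -> renorm_step T a x' y' -> e <= 2 -> close e x x' -> close (e / 10) y y'.
Proof.
move=> eT bT cx cx' cy [F [G B]] [F' [G' B']] e2 h n; have [CT _] := critseqP eT.
exact: (good_lip CT bT cx.1 cx'.1 (unit_jacobi_unit cx) (unit_jacobi_unit cx') G B G' B' h e2 (unit_jacobi_unit cy)).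
Qed.

Lemma renorm_step_comp T1 T2 (a0 a1 : nat) x y z : expanding T1 -> expanding T2 -> large T1 -> large T2 ->
  unit_jacobi x -> unit_jacobi y -> renorm_step T2 a1%:Z x y -> renorm_step T1 a0%:Z y z ->
  renorm_step (T2 \Po T1) (a0 + a1 * degree T1)%N%:Z x z.
Proof.
move=> e1 e2 b1 b2 cx cy [F2 [G2 B2]] [F1 [G1 B1]].
have [C1 _] := critseqP e1; have [C2 _] := critseqP e2.
have [C12 _] := critseqP (expanding_comp e1 e2).
have -> : (a0 + a1 * degree T1)%N%:Z = a0%:Z + (size (critseq T1)).+1%:Z * a1%:Z.
  by rewrite critseq_size// PoszD PoszM mulrC.
exists (compF T1 (critseq T1) a0%:Z F1 F2); split; first exact: (comp_good C1 C2 C12 G1 G2).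
exact: (comp_big C1 C2 C12 G1 G2 B1 B2 (large4 b1) (large4 b2) (unit_jacobi_unit cx) (unit_jacobi_unit cy)).
Qed.

(** Shifting the coarse matrix by s shifts the fine one by d s. *)
Lemma kernel_shift (A : comNzRingType) (a : int) (d : nat) (z t D : A) p q pt qt F (s : int) :
  kernel a d z t D p q pt qt F ->
  kernel a d z t D (fun n => p (n + d%:Z * s)) (fun n => q (n + d%:Z * s))
    (fun k => pt (k + s)) (fun k => qt (k + s)) (fun k n => F (k + s) (n + d%:Z * s)).
Proof.
have sE k : site a d k + d%:Z * s = site a d (k + s) by rewrite /site; ring.
have sE1 k (i : int) : site a d k + i + d%:Z * s = site a d (k + s) + i by rewrite /site; ring.
have sE2 k (i j : int) : site a d k + i + j + d%:Z * s = site a d (k + s) + i + j.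
  by rewrite /site; ring.
have kB k : k - 1 + s = k + s - 1 by ring.
have kD k : k + 1 + s = k + s + 1 by ring.
case=> h1 h2 h3 h4 h5 h6 h7 h8; split.
- by move=> k; rewrite sE h1.
- by move=> k; rewrite sE kB h2.
- by move=> k; rewrite sE kD h3.
- by move=> k i hi n; rewrite /n !sE2 !sE1; apply: h4.
- by move=> k i hi n; rewrite /n !sE2 !sE1 !kB; apply: h5.
- by move=> k; rewrite !sE1 !sE; apply: h6.
- by move=> k; rewrite !sE1 !sE !kB; apply: h7.
- by move=> k; rewrite !sE1 !kD; apply: h8.
Qed.

Lemma renorm_step_shift T a x y (s : int) : expanding T ->
  renorm_step T a x y -> renorm_step T a (dshift s x) (dshift ((degree T)%:Z * s) y).
Proof.
move=> eT [F [[K p0 pp] B]]; rewrite -critseq_size//; set d := (size _).+1.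
have sE k : site a d k + d%:Z * s = site a d (k + s) by rewrite /site; ring.
have sE1 k (i : int) : site a d k + i + d%:Z * s = site a d (k + s) + i by rewrite /site; ring.
exists (fun k n => F (k + s) (n + d%:Z * s)); split.
  split; first exact: (kernel_shift s K).
  - by move=> n; apply: p0.
  - by move=> k i im; rewrite /= sE1; apply: pp.
by move=> k c hc; rewrite /Wof /= sE1 sE; apply: B.
Qed.

Lemma renorm_step_separation T a x y : expanding T -> large T -> unit_jacobi x -> unit_jacobi y -> renorm_step T a x y ->
  exists2 r : R, 0 < r & forall k, close r (dshift k y) y -> ((degree T)%:Z %| k)%Z.
Proof.
move=> eT bT cx cy [F [G B]]; have [CT _] := critseqP eT.
have ux := unit_jacobi_unit cx; have uy := unit_jacobi_unit cy.
pose W := Wof a (size (critseq T)).+1 y.1 F.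
have [e1 e2] := good_explicit CT bT cx.1 ux G B.
have e1' : y.1 = solp T (critseq T) a x.1 W by apply/funext.
have e2' : y.2 = solq T (critseq T) a W by apply/funext.
have Wrec k c : c \in critseq T -> W k c = T.[c] - x.2 k - x.1 (k + 1) ^+ 2 / W (k + 1) c.
  by move=> hc; exact: (bigWrec CT G B).
have Wsgn k c : c \in critseq T -> 0 < W k c * T.[c].
  by move=> hc; exact: (bigW_sgn CT (large4 bT) ux G B).
have Wbig k c : c \in critseq T -> 2 <= `|W k c| <= `|T.[c]| + 2.
  move=> hc; rewrite (bigW_le CT ux G B k hc) andbT.
  by apply: le_trans (bigW_ge CT ux G B k hc); have := bT c hc; lra.
have us : unitdata (solp T (critseq T) a x.1 W) (solq T (critseq T) a W) by rewrite -e1' -e2'.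
have [r r0 hr] := shift_separation CT ux Wrec Wsgn Wbig us.
exists r => // k h; rewrite -critseq_size//; apply: hr => n.
by rewrite -e1' -e2'; apply: h.
Qed.

(** Apply [tau_ge1] to the solution for the zero matrix. *)
Lemma large_lead T : expanding T -> large T -> 1 <= lead_coef T.
Proof.
move=> eT bT; have [y cy [_ /(_ bT)[F [G B]]]] := solution_step 0 eT unit_jacobi0.
have [CT _] := critseqP eT.
apply: (tau_ge1 CT (large4 bT) (unit_jacobi_unit unit_jacobi0) G B) => n.
by apply: le_trans (ler_norm _) _; have [] := unit_jacobi_unit cy n.
Qed.

Lemma critseq_mem T c : expanding T -> (c \in critseq T) = (T^`().[c] == 0).
Proof.
move=> eT; have [CT h] := critseqP eT.
have := crit_deriv CT => ->; rewrite hornerZ mulf_eq0 mulf_eq0 pnatr_eq0 orbF.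
by rewrite (gt_eqF (crit_lead CT)) /= /nodal -[RHS]/(root _ _) root_prod_XsubC.
Qed.

(** A critical value of T2 o T1 is a critical value of T2 or the image under T2 of a
    critical value of T1, and [critical_growth] applies to the latter. *)
Lemma large_comp T1 T2 : expanding T1 -> expanding T2 -> large T1 -> large T2 -> large (T2 \Po T1).
Proof.
move=> e1 e2 b1 b2 c; rewrite critseq_mem; last exact: expanding_comp.
rewrite deriv_comp hornerM !horner_comp mulf_eq0 -!critseq_mem// => /orP[|] hc; first exact: b2.
have [C2 _] := critseqP e2.
have h := b1 c hc; apply: (le_trans h).
by apply: (critical_growth C2 (large_lead e2 b2)); apply: le_trans h; lra.
Qed.

Lemma large_of_critical T (L : R) : expanding T -> 100 <= L ->
  (forall z, critical_point T z -> L <= normc (complexify T).[z]) -> large T.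
Proof.
move=> eT L1 h c hc; have [_ cp] := critseqP eT.
have /h : critical_point T c%:C by apply/cp; exists c.
by rewrite complexifyE normc_real; apply: le_trans.
Qed.
End Tower.

(** * Limits of coefficients *)

Section Limits.
Local Open Scope complex_scope.
Variable R : realType.
Local Notation C := R[i].
Local Notation bop := (bop R).
Local Notation data := ((int -> R) * (int -> R))%type.
Implicit Types (x y : data).

Lemma geometric_small (K e : R) : 0 <= K -> 0 < e -> exists n : nat, K * 10^-1 ^+ n < e.
Proof.
move=> K0 e0; pose n := Num.bound (K / e); exists n.
have h : K / e < n%:R by apply: archi_boundP; rewrite divr_ge0// ltW.
have h2 : n%:R <= 10 ^+ n :> R by rewrite -natrX ler_nat ltnW// ltn_expl.
rewrite exprVn ltr_pdivrMr ?exprn_gt0// mulrC -ltr_pdivrMr//.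
exact: lt_le_trans h2.
Qed.

(** The limit is the supremum of the lower bounds u k - e k. *)
Lemma sequence_limit (u e : nat -> R) : (forall k l, `|u k - u (k + l)%N| <= e k) ->
  exists s, forall k, `|u k - s| <= e k.
Proof.
move=> h.
have e0 k : 0 <= e k by apply: le_trans (h k 0%N).
have cross j k : u j - e j <= u k + e k.
  case: (leqP j k) => jk.
    by have := h j (k - j)%N; rewrite subnKC// ler_norml; have := e0 k; lra.
  by have := h k (j - k)%N; rewrite subnKC ?(ltnW jk)// ler_norml; have := e0 j; lra.
(* lower bounds never exceed upper bounds, so their supremum is squeezed *)
pose E := [set u k - e k | k in setT].
have sE : has_sup E.
  by split; [exists (u 0%N - e 0%N); exists 0%N|exists (u 0%N + e 0%N) => _ [j _ <-]; apply: cross].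
exists (sup E) => k; rewrite ler_norml.
have h1 : sup E <= u k + e k by apply: ge_sup; [case: sE|move=> _ [j _ <-]; apply: cross].
have h2 : u k - e k <= sup E by apply: ub_le_sup; [case: sE|exists k].
by apply/andP; split; lra.
Qed.

Lemma close_trans (e e' : R) x y z : close e x y -> close e' y z -> close (e + e') x z.
Proof.
move=> h h' n; have [a1 a2] := h n; have [b1 b2] := h' n.
split; first by apply: (le_trans (ler_distD (y.1 n) _ _)); apply: lerD.
by apply: (le_trans (ler_distD (y.2 n) _ _)); apply: lerD.
Qed.

Lemma close_le (e e' : R) x y : e <= e' -> close e x y -> close e' x y.
Proof. by move=> ee h n; have [a1 a2] := h n; split; apply: le_trans ee. Qed.

Lemma close_eq x y : (forall e : R, 0 < e -> close e x y) -> x = y.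
Proof.
move=> h; case: x y h => [p q] [p' q'] h; congr pair; apply/funext => n;
  apply/eqP; rewrite -subr_eq0 -normr_le0; apply/ler_addgt0Pr => e e0;
  by have [h1 h2] := h e e0 n; rewrite add0r.
Qed.

(** A bound for the dependence of the form on the coefficients. *)
Fixpoint qslack (n : nat) (f : nat -> R) : R :=
  f 0%N ^+ 2 + (if n is n'.+1 then 2 * `|f 0%N * f 1%N| + qslack n' (fun i => f i.+1) else 0).

Lemma qform_close (e : R) x y n k f : close e x y ->
  `|qform y.1 y.2 n k f - qform x.1 x.2 n k f| <= e * qslack n f.
Proof.
move=> h; elim: n k f => [|n IH] k f /=.
  rewrite !addr0 -mulrBl normrM [`|f 0%N ^+ 2|]ger0_norm ?sqr_ge0//.
  by rewrite ler_wpM2r ?sqr_ge0// distrC; case: (h k).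
have [_ h2] := h k; have [h1 _] := h (k + 1); have h3 := IH (k + 1) (fun i => f i.+1).
have -> : forall A B A' B' D D' : R, A * f 0%N ^+ 2 + (2 * B * f 0%N * f 1%N + D)
   - (A' * f 0%N ^+ 2 + (2 * B' * f 0%N * f 1%N + D'))
   = (A - A') * f 0%N ^+ 2 + ((B - B') * (2 * (f 0%N * f 1%N)) + (D - D')).
  by move=> *; ring.
rewrite !mulrDr; apply: (le_trans (ler_normD _ _)); apply: lerD.
  rewrite normrM [`|f 0%N ^+ 2|]ger0_norm ?sqr_ge0//.
  by rewrite ler_wpM2r ?sqr_ge0// distrC.
apply: (le_trans (ler_normD _ _)); apply: lerD => //.
have -> : 2 * `|f 0%N * f 1%N| = `|2 * (f 0%N * f 1%N)| by rewrite [RHS]normrM (ger0_norm (ler0n _ 2)).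
by rewrite normrM ler_wpM2r// distrC.
Qed.

Lemma qslack_ge0 n (f : nat -> R) : 0 <= qslack n f.
Proof.
elim: n f => [|n IH] f /=; first by rewrite addr0 sqr_ge0.
by rewrite addr_ge0 ?sqr_ge0// addr_ge0 ?mulr_ge0.
Qed.

(** Each form involves finitely many coefficients. *)
Lemma unit_jacobi_closed y : (forall e : R, 0 < e -> exists2 x, unit_jacobi x & close e x y) -> unit_jacobi y.
Proof.
move=> h; split => [k|n k f].
  rewrite -oppr_le0; apply/ler_addgt0Pr => e e0; rewrite add0r.
  have [x [p0 _] xy] := h e e0; have [h1 _] := xy k.
  by have := p0 k; move: h1; rewrite ler_norml; lra.
apply/ler_addgt0Pr => e e0.
have q0 := qslack_ge0 n f; have q1 : 0 < qslack n f + 1 by lra.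
have [x [_ fb] xy] := h (e / (qslack n f + 1)) ltac:(by rewrite divr_gt0).
have h1 := qform_close n k f xy; have h2 := fb n k f.
have h3 : e / (qslack n f + 1) * qslack n f <= e.
  by rewrite mulrAC ler_pdivrMr// ler_pM2l//; lra.
rewrite -(subrK (qform x.1 x.2 n k f) (qform y.1 y.2 n k f)).
by apply: (le_trans (ler_normD _ _)); lra.
Qed.
End Limits.

(** * Infinite towers *)

Section Tower2.
Local Open Scope complex_scope.
Variable R : realType.
Local Notation C := R[i].
Local Notation bop := (bop R).
Local Notation data := ((int -> R) * (int -> R))%type.
Implicit Types (x y : data).
Variables (d : nat -> nat) (T : nat -> {poly R}) (eps : nat -> nat).
Hypothesis eT : forall k, expanding (T k.+1).
Hypothesis bT : forall k, large (T k.+1).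
Hypothesis dT : forall k, degree (T k.+1) = d k.+1.
Local Notation kap := (10^-1 : R).
Local Notation zero := ((fun=> 0, fun=> 0) : data).

(** The chosen solution for T_(j+1), as a map on coefficients. *)
Definition pullback (j : nat) x : data := xget zero [set y | unit_jacobi y /\ renorm_step (T j.+1) (eps j)%:Z x y].

Lemma pullbackP j x : unit_jacobi x -> unit_jacobi (pullback j x) /\ renorm_step (T j.+1) (eps j)%:Z x (pullback j x).
Proof.
move=> cx; have [y cy [_ /(_ (@bT j)) s]] := solution_step (eps j) (eT j) cx.
by rewrite /pullback; case: xgetP => [z _ //|/(_ y)[]].
Qed.

Fixpoint iterated (j k : nat) x : data := if k is k'.+1 then pullback j (iterated j.+1 k' x) else x.

Lemma iterated_cl j k x : unit_jacobi x -> unit_jacobi (iterated j k x).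
Proof. by move=> cx; elim: k j => //= k IH j; have [] := pullbackP j (IH j.+1). Qed.

Lemma iterated_lip j k x y (e : R) : unit_jacobi x -> unit_jacobi y -> 0 <= e <= 2 -> close e x y ->
  close (e * kap ^+ k) (iterated j k x) (iterated j k y).
Proof.
move=> cx cy /andP[e0 e2] h; elim: k j => [|k IH] j; first by rewrite expr0 mulr1.
have cX := iterated_cl j.+1 k cx; have cY := iterated_cl j.+1 k cy.
have [c1 s1] := pullbackP j cX; have [c2 s2] := pullbackP j cY.
rewrite exprSr mulrA; apply: (renorm_step_lip (eT j) (@bT j) cX cY c1 s1 s2 _ (IH j.+1)).
apply: le_trans e2; rewrite ler_piMr// exprn_ile1// ?invr_ge0// invf_le1//.
by rewrite ler1n.
Qed.

Lemma iterated_close j k x y : unit_jacobi x -> unit_jacobi y -> close (2 * kap ^+ k) (iterated j k x) (iterated j k y).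
Proof. by move=> cx cy; apply: iterated_lip => //; [rewrite lexx andbT|exact: unit_jacobi_close]. Qed.

Lemma iterated_add j k l x : iterated j (k + l) x = iterated j k (iterated (j + k) l x).
Proof. by elim: k j => [|k IH] j /=; rewrite ?addn0// IH addnS addSn. Qed.

(** Successive approximations differ by at most 2 * 10^-k, whatever the data from
    which they start, since coefficients are bounded by 1. *)
Lemma tower_exists j : exists y, unit_jacobi y /\ forall k x, unit_jacobi x -> close (2 * kap ^+ k) (iterated j k x) y.
Proof.
have cauchy x y k l : unit_jacobi x -> unit_jacobi y -> close (2 * kap ^+ k) (iterated j k x) (iterated j (k + l) y).
  by move=> cx cy; rewrite iterated_add; apply: iterated_close => //; apply: iterated_cl.
have z0 := @unit_jacobi0 R.
have [p hp] := choice (fun n => sequence_limit (fun k l => (cauchy _ _ k l z0 z0 n).1)).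
have [q hq] := choice (fun n => sequence_limit (fun k l => (cauchy _ _ k l z0 z0 n).2)).
have lim0 k : close (2 * kap ^+ k) (iterated j k zero) (p, q) by move=> n; split; [apply: hp|apply: hq].
exists (p, q); split.
  apply: unit_jacobi_closed => e e0; have [k hk] := geometric_small (ler0n _ 2) e0.
  by exists (iterated j k zero); [exact: iterated_cl|apply: close_le (ltW hk) (lim0 k)].
move=> k x cx.
have H l : close (2 * kap ^+ k + 2 * kap ^+ (k + l)) (iterated j k x) (p, q).
  exact: close_trans (cauchy x zero k l cx z0) (lim0 (k + l)%N).
move=> n; split; apply/ler_addgt0Pr => e e0; have [l hl] := geometric_small (ler0n _ 2) e0.
  apply: le_trans (H l n).1 _; rewrite lerD2l; apply: le_trans (ltW hl).
  rewrite ler_pM2l// exprD ler_piMl ?exprn_ge0 ?invr_ge0//.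
  by rewrite exprn_ile1 ?invr_ge0// invf_le1// ler1n.
apply: le_trans (H l n).2 _; rewrite lerD2l; apply: le_trans (ltW hl).
rewrite ler_pM2l// exprD ler_piMl ?exprn_ge0 ?invr_ge0//.
by rewrite exprn_ile1 ?invr_ge0// invf_le1// ler1n.
Qed.

(** The coefficients of the limit matrix for the tower which starts at T_(j+1). *)
Definition tower (j : nat) : data := sval (cid (tower_exists j)).
Lemma tower_cl j : unit_jacobi (tower j). Proof. by have [] := svalP (cid (tower_exists j)). Qed.
Lemma tower_close j k x : unit_jacobi x -> close (2 * kap ^+ k) (iterated j k x) (tower j).
Proof. by move=> cx; have [_] := svalP (cid (tower_exists j)); apply. Qed.

Lemma tower_it j l : tower j = iterated j l (tower (j + l)).
Proof.
have z0 := @unit_jacobi0 R.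
apply: close_eq => e e0; have e2 : 0 < e / 2 by rewrite divr_gt0.
have [k hk] := geometric_small (ler0n _ 2) e2.
have kl : kap ^+ (l + k) <= kap ^+ k.
  rewrite exprD ler_piMl ?exprn_ge0 ?invr_ge0//.
  by rewrite exprn_ile1 ?invr_ge0// invf_le1// ler1n.
have h1 := close_sym (tower_close j (l + k) z0).
rewrite iterated_add in h1.
have h2 := iterated_lip j l (iterated_cl (j + l) k z0) (tower_cl (j + l)) _ (tower_close (j + l) k z0).
have k1 : kap ^+ k <= 1 by rewrite exprn_ile1 ?invr_ge0// invf_le1// ler1n.
have k0 : 0 <= kap ^+ k by rewrite exprn_ge0// invr_ge0.
have {h2} h2 := h2 ltac:(by apply/andP; split; lra).
apply: close_le (close_trans h1 h2).
have -> : 2 * kap ^+ k * kap ^+ l = 2 * kap ^+ (l + k) by rewrite exprD; ring.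
by lra.
Qed.

Local Notation P n := (poly_iter T n).
Local Notation an n := (\sum_(k < n) eps k * deg_prod d k)%N.

Lemma deg_prodS n : deg_prod d n.+1 = (deg_prod d n * d n.+1)%N.
Proof. by rewrite /deg_prod big_nat_recr. Qed.

Lemma deg_prod0 : deg_prod d 0 = 1%N.
Proof. by rewrite /deg_prod big_nil. Qed.

Lemma degree_comp (T1 T2 : {poly R}) : degree (T2 \Po T1) = (degree T1 * degree T2)%N.
Proof. by rewrite /degree size_comp_poly mulnC. Qed.

(** Iterated pullbacks solve the equation for the composed polynomial; the digit
    expansion of the offset comes from the composition law of [comp_good]. *)
Lemma tower_poly n : [/\ expanding (P n.+1), large (P n.+1), degree (P n.+1) = deg_prod d n.+1 &
  forall x, unit_jacobi x -> renorm_step (P n.+1) (an n.+1)%:Z x (iterated 0 n.+1 x)].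
Proof.
elim: n => [|n [IH1 IH2 IH3 IH4]].
  rewrite /= comp_polyXr deg_prodS deg_prod0 mul1n; split => // x cx.
  by rewrite big_ord_recr big_ord0 /= deg_prod0 muln1 add0n; have [] := pullbackP 0 cx.
have E1 := expanding_comp IH1 (eT n.+1); have E2 := large_comp IH1 (eT n.+1) IH2 (@bT n.+1).
split => //.
  by rewrite -[P n.+2]/(T n.+2 \Po P n.+1) degree_comp IH3 dT -deg_prodS.
move=> x cx; rewrite big_ord_recr -IH3.
have [cG sG] := pullbackP n.+1 cx.
have -> : iterated 0 n.+2 x = iterated 0 n.+1 (pullback n.+1 x) by rewrite -[n.+2]addn1 iterated_add.
exact: (renorm_step_comp IH1 (eT n.+1) IH2 (@bT n.+1) cx cG sG (IH4 _ cG)).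
Qed.

(** Both [tower 0] and its shift are obtained by the same l + 1 contractions, from
    [tower (l + 1)] and from its shift by s. *)
Lemma tower_shift l (s : int) : close (2 * kap ^+ l.+1)
  (dshift ((deg_prod d l.+1)%:Z * s) (tower 0)) (tower 0).
Proof.
have [eP bP dP sP] := tower_poly l.
have cl1 := tower_cl l.+1; have cs := unit_jacobi_shift s cl1.
have e0 : tower 0 = iterated 0 l.+1 (tower l.+1) by rewrite (tower_it 0 l.+1).
have s1 := renorm_step_shift s eP (sP _ cl1); rewrite -e0 dP in s1.
have <- := renorm_step_unique eP bP cs (sP _ cs) s1.
exact: tower_close.
Qed.

Lemma tower_separation l : exists2 r : R, 0 < r &
  forall k, close r (dshift k (tower 0)) (tower 0) -> ((deg_prod d l.+1)%:Z %| k)%Z.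
Proof.
have [eP bP dP sP] := tower_poly l.
have s1 := sP _ (tower_cl l.+1); rewrite -(tower_it 0 l.+1) in s1.
by rewrite -dP; exact: (renorm_step_separation eP bP (tower_cl l.+1) (tower_cl 0) s1).
Qed.
End Tower2.

(** * The limit matrix *)

Section Solution.
Local Open Scope complex_scope.
Variable R : realType.
Local Notation bop := (bop R).
Local Notation data := ((int -> R) * (int -> R))%type.

(** Besides the equation, the solution must have the attracting Weyl values
    whenever the critical values are large: this is what makes it unique. *)
Definition solves (eps : nat) (Jt : bop) (T : {poly R}) (J : bop) :=
  renormalization_solution eps Jt T J /\
  forall x : data, unit_jacobi x -> Jt = jac x -> large T ->
    exists2 y, J = jac y & renorm_step T eps%:Z x y.

Definition sol (eps : nat) (Jt : bop) (T : {poly R}) : bop := xget 0 [set J | solves eps Jt T J].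

Lemma sol_solves eps Jt T : expanding T -> is_jacobi Jt -> spectrum Jt `<=` unit_segment R ->
  solves eps Jt T (sol eps Jt T).
Proof.
move=> eT j sp; have [x cx ->] := jacobi_has_data j sp.
have [y cy [RS st]] := solution_step eps eT cx.
rewrite /sol; case: xgetP => [J' _ //|/(_ (jac y))[]]; split => //.
by move=> x' cx' e bT; exists y => //; rewrite -(jac_inj cx cx' e); apply: st.
Qed.
End Solution.

Theorem mainTheorem2 (R : realType) :
  exists (L c : R) (Sol : nat -> bop R -> {poly R} -> bop R),
    [/\ 1 < L, 0 < c < 1,
        (forall (eps : nat) (Jt : bop R) (T : {poly R}),
           expanding T -> (eps < degree T)%N ->
           is_jacobi Jt -> spectrum Jt `<=` unit_segment R ->
           renormalization_solution eps Jt T (Sol eps Jt T))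
      & forall (d : nat -> nat) (T : nat -> {poly R}) (eps : nat -> nat),
          (forall k, (1 <= k)%N ->
             [/\ (2 <= d k)%N, expanding (T k), degree (T k) = d k
               & forall z, critical_point (T k) z ->
                   L <= normc (complexify (T k)).[z]]) ->
          (forall k, (eps k <= d k.+1 - 1)%N) ->
          exists J : bop R,
            [/\ (forall Jt : bop R,
                   is_jacobi Jt -> spectrum Jt `<=` unit_segment R ->
                   (fun n => opnorm
                      (Sol (\sum_(k < n) eps k * deg_prod d k)%N Jt
                           (poly_iter T n) - J)) @ \oo --> (0 : R)),
                (exists2 A : R, 0 < A &
                   forall (l : nat) (m : int), (1 <= l)%N ->
                     opnorm (J - shiftZ R ^ (- ((deg_prod d l)%:Z * m)) * J
                                 * shiftZ R ^ ((deg_prod d l)%:Z * m))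
                     <= A * c ^+ l)
              & forall U : set int, rho_open J U <-> adic_open d U]].
Proof.
(* 100 and 1/10 are the constants of the contraction estimate *)
exists 100, 10^-1, (@sol R); split.
- by rewrite ltr1n.
- by rewrite invr_gt0 ltr0n invf_lt1 ?ltr1n ?ltr0n.
- by move=> eps Jt T eT _ j sp; have [] := sol_solves eps eT j sp.
move=> d T eps hT _.
have eT k : expanding (T k.+1) by have [] := hT k.+1 isT.
have dT k : degree (T k.+1) = d k.+1 by have [] := hT k.+1 isT.
have bT k : large (T k.+1) by have [_ _ _ h] := hT k.+1 isT; exact: (large_of_critical (eT k) (lexx _) h).
have K0 n : 0 <= 2 * 10^-1 ^+ n :> R by rewrite mulr_ge0 ?exprn_ge0 ?invr_ge0.
pose x0 := tower eps eT bT 0; have cx0 : unit_jacobi x0 := tower_cl eps eT bT 0.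
have closeS l (s : int) : (1 <= l)%N ->
    close (2 * 10^-1 ^+ l) (dshift ((deg_prod d l)%:Z * s) x0) x0.
  by case: l => // l _; exact: (tower_shift eps eT bT dT l s).
exists (jac x0); split.
- move=> Jt j sp; have [x cx Je] := jacobi_has_data j sp.
  have bound n : opnorm (sol (\sum_(k < n.+1) eps k * deg_prod d k)%N Jt (poly_iter T n.+1) - jac x0)
      <= 6 * 10^-1 ^+ n.+1.
    have [eP bP _ sP] := tower_poly eps eT bT dT n.
    have [_ /(_ x cx Je bP)[y -> sy]] :=
      sol_solves (\sum_(k < n.+1) eps k * deg_prod d k)%N eP j sp.
    rewrite (renorm_step_unique eP bP cx sy (sP x cx)).
    have h := tower_close eps eT bT 0 n.+1 cx.
    apply: le_trans (jac_close (K0 _) (iterated_cl eps eT bT 0 n.+1 cx) cx0 h) _.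
    by rewrite mulrA -natrM.
  apply/cvgrPdist_le => e e0; have [N hN] := geometric_small (ler0n _ 6) e0.
  near=> n; have nN : (N < n)%N by near: n; exact: nbhs_infty_gt.
  rewrite sub0r normrN ger0_norm ?opnorm_ge0//.
  case: (n) nN => // i nN; apply: (le_trans (bound i)); apply: le_trans (ltW hN).
  rewrite ler_pM2l// -(subnKC (ltnW nN)) exprD ler_piMr ?exprn_ge0 ?invr_ge0//.
  by rewrite exprn_ile1 ?invr_ge0// invf_le1// ler1n.
- exists 6 => // l m l1; rewrite jac_shift//.
  apply: le_trans (jac_close (K0 l) cx0 (unit_jacobi_shift _ cx0) (close_sym (closeS l m l1))) _.
  by rewrite mulrA -natrM.
have rhoE k : rho (jac x0) k = opnorm (jac (dshift k x0) - jac x0).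
  by rewrite /rho jac_shift.
move=> U; split => hU x Ux.
  have [r r0 hr] := hU x Ux; have [l hl] := geometric_small (ler0n _ 6) r0.
  exists l.+1 => // m; apply: hr; rewrite addrC addKr rhoE.
  apply: le_lt_trans (jac_close (K0 l.+1) (unit_jacobi_shift _ cx0) cx0 (closeS l.+1 m isT)) _.
  rewrite mulrA -natrM; apply: le_lt_trans hl; rewrite ler_pM2l// exprS ler_piMl ?exprn_ge0 ?invr_ge0//.
  by rewrite invf_le1// ler1n.
have [[|l] // _ hl] := hU x Ux.
have [r r0 hr] := tower_separation eps eT bT dT l.
exists r => // y hy.
have /dvdzP[m e] : ((deg_prod d l.+1)%:Z %| y - x)%Z.
  apply: hr; rewrite rhoE in hy.
  apply: close_le (ltW hy) _; apply: close_jac => //; exact: unit_jacobi_shift.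
have -> : y = x + (deg_prod d l.+1)%:Z * m by rewrite [_ * m]mulrC -e; ring.
exact: hl.
Unshelve. all: by end_near.
Qed.
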